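(* The dg algebra $\mathcal{A}$ and the $A_\infty$ algebra $\mathcal{B}^\infty$ are quasi-isomorphic as $A_\infty$ algebras over $\mathbb{F}$.
   Context: $\mathbb{F}=\mathbb{F}_2$, $\widetilde{R}^\partial=\mathbb{F}[x,y,z]$. Let $\widetilde{M}(\mathcal{D}_0)$ be the matrix factorization $\widetilde{R}^\partial\rightleftarrows\widetilde{R}^\partial$ with maps $x$ (from the first copy to the second) and $yz$ (back), and $\widetilde{M}(\mathcal{D}_1)$ the one with maps $y$ and $xz$; both have potential $xyz$ with total differential $d_0$, $d_0^2=xyz\cdot\mathrm{id}$. Let $\mathcal{A}=\mathrm{End}_{\widetilde{R}^\partial}(\widetilde{M}(\mathcal{D}_0)\oplus\widetilde{M}(\mathcal{D}_1))$ be the algebra of all $\widetilde{R}^\partial$-linear maps of the underlying free modules (irrespective of the differentials), with composition as product and differential $f\mapsto f\circ d_0+d_0\circ f$. $\mathcal{B}$: the path algebra over $\mathbb{F}$ of the quiver with vertices $\circ,\bullet$, loops $D_\circ,D_\bullet$ and arrows ${}_\circ S_\bullet,{}_\bullet S_\circ$, modulo: every product of a $D$-arrow with an $S$-arrow is zero (${}_a x_b\cdot{}_b y_c$ denotes concatenation). Basis: idempotents, $D_\circ^n,D_\bullet^n$ ($n\ge1$), alternating $S$-words $S^n$ ($n\ge1$). $\mathcal{B}^\infty$ has the same space, $\mu_1=0$, $\mu_2$ the product of $\mathcal{B}$, and higher products from disk sequences: $E_4$ consists of the cyclic permutations of $({}_\circ S_\bullet,{}_\bullet D_\bullet,{}_\bullet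 S_\circ,{}_\circ D_\circ)$; $E_{2m+2}$ is obtained from $E_{2m}$ by replacing two consecutive entries via one of $(D^k_\bullet,{}_\bullet S^\ell)\mapsto(D^{k+1}_\bullet,{}_\bullet S_\circ,{}_\circ D_\circ,{}_\circ S^{\ell+1})$, $(D^k_\circ,{}_\circ S^\ell)\mapsto(D^{k+1}_\circ,{}_\circ S_\bullet,{}_\bullet D_\bullet,{}_\bullet S^{\ell+1})$, $(S^k_\bullet,{}_\bullet D^\ell)\mapsto(S^{k+1}_\circ,{}_\circ D_\circ,{}_\circ S_\bullet,{}_\bullet D^{\ell+1})$, $(S^k_\circ,{}_\circ D^\ell)\mapsto(S^{k+1}_\bullet,{}_\bullet D_\bullet,{}_\bullet S_\circ,{}_\circ D^{\ell+1})$ (left/right subscripts denote start/end vertices). For $(a_1,\dots,a_{2m})\in E_{2m}$ and $b\in\{\text{idempotents},S^n,D^n:n\ge1\}$: $\mu_{2m}(a_1,\dots,a_{2m}b)=b$ if $a_{2m}b\ne0$, and $\mu_{2m}(ba_1,\dots,a_{2m})=b$ if $ba_1\ne0$; all other higher products of basis elements vanish, extended multilinearly. E.g. $\mu_4(D,S,D,S^k)=S^{k-1}$, $\mu_4(S^k,D,S,D)=S^{k-1}$ for $k\ge1$. *)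

(* Defs.v *)
From HB Require Import structures.
From mathcomp Require Import all_boot all_algebra.
From mathcomp Require Import finmap mpoly monalg.
From Stdlib Require Import ClassicalEpsilon.

Set Implicit Arguments.
Unset Strict Implicit.
Unset Printing Implicit Defensive.

Import GRing.Theory.
Local Open Scope ring_scope.

(* Ungraded A-infinity algebras over F = F_2.  An A_oo algebra is an  *)
(* F_2-vector space V with operations mu_n : V^(x)n -> V, encoded as   *)
(* a single map  mu : seq V -> V  (mu_n = mu restricted to lists of   *)
(* length n).  Over F_2 all Koszul signs are +1.                       *)

Definition multilinear (V W : lmodType 'F_2) (f : seq V -> W) : Prop :=
  forall (s1 s2 : seq V) (a : 'F_2) (x y : V),
    f (s1 ++ (a *: x + y) :: s2) = a *: f (s1 ++ x :: s2) + f (s1 ++ y :: s2).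

Definition slice (T : Type) (i j : nat) (s : seq T) : seq T :=
  take (j - i) (drop i s).

Definition insert_sum (V W : lmodType 'F_2) (F : seq V -> W) (g : seq V -> V)
    (s : seq V) : W :=
  \sum_(0 <= i < size s) \sum_(i.+1 <= j < (size s).+1)
      F (take i s ++ g (slice i j s) :: drop j s).

Definition is_Ainf_algebra (V : lmodType 'F_2) (mu : seq V -> V) : Prop :=
  [/\ multilinear mu,
      mu [::] = 0
    & forall s : seq V, insert_sum mu mu s = 0].

Fixpoint compositions (T : Type) (s : seq T) : seq (seq (seq T)) :=
  match s with
  | [::] => [:: [::]]
  | x :: s' =>
      flatten [seq [:: [:: x] :: c] ++
                   (if c is b :: c' then [:: (x :: b) :: c'] else [::])
              | c <- compositions s']
  end.

Definition is_Ainf_morphism (V W : lmodType 'F_2) (muV : seq V -> V)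
    (muW : seq W -> W) (f : seq V -> W) : Prop :=
  [/\ multilinear f,
      f [::] = 0
    & forall s : seq V,
        insert_sum f muV s = \sum_(c <- compositions s) muW (map f c)].

Definition is_quasi_iso (V W : lmodType 'F_2) (muV : seq V -> V)
    (muW : seq W -> W) (f : seq V -> W) : Prop :=
  (forall x : V, muV [:: x] = 0 ->
      (exists w : W, f [:: x] = muW [:: w]) -> exists v : V, x = muV [:: v])
  /\
  (forall y : W, muW [:: y] = 0 ->
      exists x : V, muV [:: x] = 0 /\ exists w : W, y - f [:: x] = muW [:: w]).

Definition Ainf_quasi_isomorphism (V W : lmodType 'F_2) (muV : seq V -> V)
    (muW : seq W -> W) (f : seq V -> W) : Prop :=
  is_Ainf_morphism muV muW f /\ is_quasi_iso muV muW f.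

(* The dg algebra A = End_R(M(D0) (+) M(D1)),  R = F_2[x,y,z].         *)
(* The underlying free module is R^4 = R e0 + R e1 (M(D0)) +           *)
(* R e2 + R e3 (M(D1)); an R-linear map f is its matrix                *)
(* f (i,j) = coefficient of e_i in f(e_j).                             *)

Definition Rd := {mpoly 'F_2[3]}.
Definition px : Rd := 'X_(inord 0).
Definition py : Rd := 'X_(inord 1).
Definition pz : Rd := 'X_(inord 2).

Definition Aalg := {ffun 'I_4 * 'I_4 -> Rd}.

Definition Acomp (f g : Aalg) : Aalg :=
  [ffun ij : 'I_4 * 'I_4 => \sum_(k < 4) f (ij.1, k) * g (k, ij.2)].

Definition d0 : Aalg :=
  [ffun ij : 'I_4 * 'I_4 =>
     let i := nat_of_ord ij.1 in let j := nat_of_ord ij.2 in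
     if (i == 1%N) && (j == 0%N) then px
     else if (i == 0%N) && (j == 1%N) then py * pz
     else if (i == 3%N) && (j == 2%N) then py
     else if (i == 2%N) && (j == 3%N) then px * pz
     else 0].

Definition muA (s : seq Aalg) : Aalg :=
  match s with
  | [:: f] => Acomp f d0 + Acomp d0 f
  | [:: f; g] => Acomp f g
  | _ => 0
  end.

(* The A_oo algebra B^oo.  Vertices: false = o (circ), true = bullet.   *)
(* Basis:  Be v = idempotent at v;  BD v n = D_v^(n+1);                *)
(*         BS v n = alternating S-word with n+1 letters starting at v. *)

Inductive Bbasis : Type :=
  | Be of bool
  | BD of bool & nat
  | BS of bool & nat.

Definition Bbasis_enc (b : Bbasis) : nat * (bool * nat) :=
  match b with
  | Be v => (0%N, (v, 0%N))
  | BD v n => (1%N, (v, n))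
  | BS v n => (2%N, (v, n))
  end.

Definition Bbasis_dec (p : nat * (bool * nat)) : option Bbasis :=
  match p with
  | (0%N, (v, _)) => Some (Be v)
  | (1%N, (v, n)) => Some (BD v n)
  | (2%N, (v, n)) => Some (BS v n)
  | _ => None
  end.

Lemma Bbasis_encK : pcancel Bbasis_enc Bbasis_dec.
Proof. by case. Qed.

HB.instance Definition _ := Countable.copy Bbasis (pcan_type Bbasis_encK).

Definition Bsrc (b : Bbasis) : bool :=
  match b with Be v | BD v _ | BS v _ => v end.

Definition Btgt (b : Bbasis) : bool :=
  match b with
  | Be v | BD v _ => v
  | BS v n => if odd n then v else ~~ v
  end.

(* concatenation product of basis elements (None = 0) *)
Definition Bmul (a b : Bbasis) : option Bbasis :=
  if Btgt a != Bsrc b then None else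
  match a, b with
  | Be _, _ => Some b
  | _, Be _ => Some a
  | BD v n, BD _ m => Some (BD v (n + m).+1)
  | BS v n, BS _ m => Some (BS v (n + m).+1)
  | _, _ => None
  end.

Definition disk_base : seq Bbasis := [:: BS false 0; BD true 0; BS true 0; BD false 0].

Definition disk_step (a b : Bbasis) : option (seq Bbasis) :=
  match a, b with
  | BD u k, BS w l =>
      if u == w then Some [:: BD u k.+1; BS u 0; BD (~~ u) 0; BS (~~ u) l.+1]
      else None
  | BS v n, BD u l =>
      if Btgt (BS v n) == u
      then Some [:: BS v n.+1; BD (~~ u) 0; BS (~~ u) 0; BD u l.+1]
      else None
  | _, _ => None
  end.

Inductive disk : seq Bbasis -> Prop :=
  | disk_E4 : forall i, (i < 4)%N -> disk (rot i disk_base)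
  | disk_next : forall s1 s2 a b t,
      disk (s1 ++ a :: b :: s2) -> disk_step a b = Some t ->
      disk (s1 ++ t ++ s2).

Definition Bv := {malg 'F_2[Bbasis]}.

Definition higher_rel (c : seq Bbasis) (b : Bbasis) : Prop :=
  (exists (a : seq Bbasis) (al p : Bbasis),
      disk (rcons a al) /\ Bmul al b = Some p /\ c = rcons a p)
  \/
  (exists (a1 : Bbasis) (a : seq Bbasis) (p : Bbasis),
      disk (a1 :: a) /\ Bmul b a1 = Some p /\ c = p :: a).

Definition higher_basis (c : seq Bbasis) : Bv :=
  match excluded_middle_informative (exists b, higher_rel c b) with
  | left H => << proj1_sig (constructive_indefinite_description _ H) >>
  | right _ => 0
  end.

Definition muB_basis (c : seq Bbasis) : Bv :=
  match c with
  | [::] | [:: _] => 0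
  | [:: a; b] => if Bmul a b is Some p then << p >> else 0
  | _ => higher_basis c
  end.

Fixpoint mlext (xs : seq Bv) (h : seq Bbasis -> Bv) {struct xs} : Bv :=
  match xs with
  | [::] => h [::]
  | x :: xs' => \sum_(b <- msupp x) monalg.mcoeff b x *: mlext xs' (fun bs => h (b :: bs))
  end.

Definition muB (s : seq Bv) : Bv := mlext s muB_basis.

(* Main.v *)
(** A composable list of non-idempotent basis elements of B is a path of
    elementary arrows, that is, a word in three kinds of junctions, and functions
    of such words form a ring of noncommutative power series.  In it the disk
    sequences are [g * g * g], where the series [g] of gaps is the solution of
    [g = Alt + Ext * g * g * g * Ext], and the operations of B^oo induce a
    derivation that kills [g].  There are matrices [T1], [T2], [T3], attached to
    alternating words of one, two and three arrows, such that
    [b = T1 + T2 * g + T3 * g * g] satisfies [d b = b * g * b + e * g * g * g];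
    then the solution of [F = b + b * Ext * F] consists of the components of an
    A-infinity morphism from B^oo to A.  Its linear part sends the basis of B to
    cocycles that represent a basis of the homology of A.  Since the linear part
    is injective, the A-infinity relations of B^oo follow from the morphism
    equation and need no separate combinatorial proof. *)
Require Import Defs.
From HB Require Import structures.
From mathcomp Require Import all_boot all_algebra.
From mathcomp Require Import finmap mpoly monalg.
From mathcomp Require Import ssrAC zify.
From Stdlib Require Import ClassicalEpsilon FunctionalExtensionality.

Set Implicit Arguments.
Unset Strict Implicit.
Unset Printing Implicit Defensive.

Import GRing.Theory.
Local Open Scope ring_scope.

(** * Sums over the splittings of a list *)

(** The matrices come from Massey products. An alternating product of two arrows vanishes in B, so
    its image is a boundary: [T2] is a null-homotopy of it, [T3] one of [T1 T2 + T2 T1]. The next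
    sum, [T1 T3 + T2 T2 + T3 T1], equals an idempotent on the nose. This is the value of the
    shortest higher product, and it produces the term [e * g * g * g]; the sums of length five and
    six vanish, so the family stops at three. The obstacle is that disk sequences are arbitrarily
    long and that their first or last entry may be prolonged. Filling an alternation with a tree of
    quadrilaterals means substituting [g] for [Alt]. Every gap leads from one arrow to the next
    exactly as a single [Alt] does, so the identities of the matrices on alternating words survive
    the substitution. Two features follow. Letters record only changes of type, so a series takes
    the first arrow as a further argument. Coefficients live in characteristic 2, so the languages
    must parse uniquely, or multiplicities could cancel. *)

Fixpoint ssum (T : Type) (V : nmodType) (s : seq T) (Phi : seq T -> seq T -> V) : V :=
  match s with
  | [::] => Phi [::] [::]
  | x :: s' => Phi [::] s + ssum s' (fun u v => Phi (x :: u) v)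
  end.

Section SplitSums.
Variables (T : Type) (V : nmodType).
Implicit Types (s u v : seq T) (Phi Psi : seq T -> seq T -> V).

Lemma eq_ssum_cat s Phi Psi :
  (forall u v, u ++ v = s -> Phi u v = Psi u v) -> ssum s Phi = ssum s Psi.
Proof.
elim: s Phi Psi => [|x s IHs] Phi Psi eqPP /=; first exact: eqPP.
congr (_ + _); first exact: eqPP.
by apply: IHs => u v uv; apply: eqPP; rewrite /= uv.
Qed.

Lemma eq_ssum s Phi Psi : (forall u v, Phi u v = Psi u v) -> ssum s Phi = ssum s Psi.
Proof. by move=> eqPP; apply: eq_ssum_cat. Qed.

Lemma ssum0 s Phi : (forall u v, u ++ v = s -> Phi u v = 0) -> ssum s Phi = 0.
Proof.
move=> Phi0; rewrite (@eq_ssum_cat _ _ (fun _ _ => 0)) // => {Phi Phi0}.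
by elim: s => //= x s ->; rewrite addr0.
Qed.

Lemma ssumD s Phi Psi :
  ssum s (fun u v => Phi u v + Psi u v) = ssum s Phi + ssum s Psi.
Proof.
elim: s Phi Psi => //= x s IHs Phi Psi.
by rewrite IHs addrACA.
Qed.

Lemma ssum_assoc s (Phi : seq T -> seq T -> seq T -> V) :
  ssum s (fun u v => ssum v (Phi u)) =
  ssum s (fun u v => ssum u (fun u1 u2 => Phi u1 u2 v)).
Proof.
elim: s Phi => //= x s IHs Phi.
by rewrite IHs -addrA; congr (_ + _); rewrite -ssumD.
Qed.

(** The letter [x] separates the cuts: those before it are the cuts of [u], those after it the cuts
    of [v]. Without a letter in the middle, the cut between [u] and [v] would count twice. *)
Lemma ssum_insert u x v Phi :
  ssum (u ++ x :: v) Phi = ssum u (fun u1 u2 => Phi u1 (u2 ++ x :: v)) +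
                          ssum v (fun v1 v2 => Phi (u ++ x :: v1) v2).
Proof.
by elim: u Phi => //= y u IHu Phi; rewrite IHu addrA.
Qed.

Lemma ssum_nil s Phi : (forall x u v, Phi (x :: u) v = 0) -> ssum s Phi = Phi [::] s.
Proof.
case: s => //= x s Phi0; rewrite ssum0 ?addr0 // => u v _; exact: Phi0.
Qed.

Lemma ssum_rnil s Phi : (forall u x v, Phi u (x :: v) = 0) -> ssum s Phi = Phi s [::].
Proof.
elim: s Phi => //= x s IHs Phi Phi0; by rewrite Phi0 add0r IHs.
Qed.

End SplitSums.

Lemma ssum_exchange (T T' : Type) (V : nmodType) (s : seq T) (s' : seq T') (Phi : seq T -> seq T -> seq T' -> seq T' -> V) :
  ssum s (fun u v => ssum s' (Phi u v)) = ssum s' (fun u' v' : seq T' => ssum s (fun u v => Phi u v u' v')).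
Proof.
elim: s Phi => //= x s IHs Phi.
by rewrite IHs -ssumD.
Qed.

Lemma ssum_mulrl (T : Type) (R : pzRingType) (s : seq T) Phi (a : R) :
  a * ssum s Phi = ssum s (fun u v => a * Phi u v).
Proof. by elim: s Phi => //= x s IHs Phi; rewrite mulrDr IHs. Qed.

Lemma ssum_mulrr (T : Type) (R : pzRingType) (s : seq T) Phi (a : R) :
  ssum s Phi * a = ssum s (fun u v => Phi u v * a).
Proof. by elim: s Phi => //= x s IHs Phi; rewrite mulrDl IHs. Qed.

(** * The ring of series over the elementary arrows *)

(* A composable list of non-idempotent basis elements of B is a path of
   elementary arrows; it is recorded by its first arrow and by the junctions
   between consecutive arrows.  [Ext] continues the same basis element, [Alt]
   starts a basis element of the other type, [Rep] one of the same type. *)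
Inductive sym := Ext | Alt | Rep.

Notation word := (seq sym).

(* (v, t) is the elementary arrow starting at v: D_v if t = false, S_v if t = true *)
Notation state := (bool * bool)%type.

Definition tgt_state (q : state) : bool := q.1 (+) q.2.

Definition act (q : state) (a : sym) : state :=
  (tgt_state q, if a is Alt then ~~ q.2 else q.2).

Definition acts : state -> word -> state := foldl act.

Lemma acts_cat q u v : acts q (u ++ v) = acts (acts q u) v.
Proof. exact: foldl_cat. Qed.

(** The two arguments describe a path: its first arrow and its junctions. *)
Definition series (R : Type) := state -> word -> R.

Section Series.
Variable R : pzRingType.
Implicit Types P Q S : series R.

(** The ring interface demands decidable equality and choice; for functions on all words both come
    from classical logic. *)
Lemma series_eqP : Equality.axiom
  (fun P Q : series R => if excluded_middle_informative (P = Q) then true else false).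
Proof. by move=> P Q; case: excluded_middle_informative => ?; constructor. Qed.

HB.instance Definition _ := hasDecEq.Build (series R) series_eqP.

Definition series_find (p : pred (series R)) (n : nat) : option (series R) :=
  match excluded_middle_informative (exists P, p P) with
  | left H => Some (proj1_sig (constructive_indefinite_description _ H))
  | right _ => None
  end.

Fact series_choice_correct p n P : series_find p n = Some P -> p P.
Proof.
rewrite /series_find; case: excluded_middle_informative => // H [<-].
by case: constructive_indefinite_description.
Qed.

Fact series_choice_complete (p : pred (series R)) :
  (exists P, p P) -> exists n, series_find p n.
Proof. by move=> ex; exists 0; rewrite /series_find; case: excluded_middle_informative. Qed.

Fact series_choice_extensional (p q : pred (series R)) :
  p =1 q -> series_find p =1 series_find q.
Proof. by move=> /functional_extensionality->. Qed.

HB.instance Definition _ := hasChoice.Build (series R)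
  series_choice_correct series_choice_complete series_choice_extensional.

Lemma seriesP P Q : (forall q w, P q w = Q q w) -> P = Q.
Proof.
by move=> eqPQ; apply: functional_extensionality => q; apply: functional_extensionality.
Qed.

Definition series_zero : series R := fun _ _ => 0.
Definition series_opp P : series R := fun q w => - P q w.
Definition series_add P Q : series R := fun q w => P q w + Q q w.

Fact series_addA : associative series_add.
Proof. by move=> P Q S; apply: seriesP => q w; apply: addrA. Qed.
Fact series_addC : commutative series_add.
Proof. by move=> P Q; apply: seriesP => q w; apply: addrC. Qed.
Fact series_add0 : left_id series_zero series_add.
Proof. by move=> P; apply: seriesP => q w; apply: add0r. Qed.
Fact series_addN : left_inverse series_zero series_opp series_add.
Proof. by move=> P; apply: seriesP => q w; apply: addNr. Qed.

HB.instance Definition _ := GRing.isZmodule.Build (series R)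
  series_addA series_addC series_add0 series_addN.

Definition series_one : series R := fun _ w => if w is [::] then 1 else 0.
(** Paths are cut at an arrow: the arrow that ends [u] also starts [v]. A junction between two
    factors is therefore a factor of its own, such as [arrow a] or a gap. *)
Definition series_mul P Q : series R :=
  fun q w => ssum w (fun u v => P q u * Q (acts q u) v).

Fact series_mulA : associative series_mul.
Proof.
move=> P Q S; apply: seriesP => q w; rewrite /series_mul.
under eq_ssum => u v do rewrite ssum_mulrl.
rewrite ssum_assoc; apply: eq_ssum => u v; rewrite ssum_mulrr.
by apply: eq_ssum_cat => u1 u2 <-; rewrite acts_cat mulrA.
Qed.

Fact series_mul1 : left_id series_one series_mul.
Proof.
move=> P; apply: seriesP => q w; rewrite /series_mul ssum_nil /= ?mul1r //.
by move=> x u v; rewrite mul0r.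
Qed.

Fact series_mulr1 : right_id series_one series_mul.
Proof.
move=> P; apply: seriesP => q w; rewrite /series_mul ssum_rnil /= ?mulr1 //.
by move=> u x v; rewrite mulr0.
Qed.

Fact series_mulDl : left_distributive series_mul series_add.
Proof.
move=> P Q S; apply: seriesP => q w; rewrite /series_mul /series_add -ssumD.
by apply: eq_ssum => u v; rewrite mulrDl.
Qed.

Fact series_mulDr : right_distributive series_mul series_add.
Proof.
move=> P Q S; apply: seriesP => q w; rewrite /series_mul /series_add -ssumD.
by apply: eq_ssum => u v; rewrite mulrDr.
Qed.

HB.instance Definition _ := GRing.Zmodule_isPzRing.Build (series R)
  series_mulA series_mul1 series_mulr1 series_mulDl series_mulDr.

Lemma seriesD P Q q w : (P + Q) q w = P q w + Q q w. Proof. by []. Qed.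
Lemma seriesM P Q q w : (P * Q) q w = ssum w (fun u v => P q u * Q (acts q u) v).
Proof. by []. Qed.

End Series.

Definition sym_eq (a b : sym) : bool :=
  match a, b with Ext, Ext | Alt, Alt | Rep, Rep => true | _, _ => false end.

Lemma sym_eqP : Equality.axiom sym_eq.
Proof. by do 2!case; constructor. Qed.

HB.instance Definition _ := hasDecEq.Build sym sym_eqP.

(** * The gap language *)

(* A disk sequence arises by gluing quadrilaterals; the junctions of a
   quadrilateral carry ternary trees of further quadrilaterals.  [gapw] lists
   the words such a (possibly empty) tree inserts between two surviving
   arrows; the first and the last letter [Ext] are the contributions of the
   root to the two adjacent basis elements. *)
Inductive gapw : word -> Prop :=
  | gap_leaf : gapw [:: Alt]
  | gap_node u1 u2 u3 : gapw u1 -> gapw u2 -> gapw u3 ->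
      gapw (Ext :: (u1 ++ u2 ++ u3) ++ [:: Ext]).

Inductive diskw : word -> Prop :=
  | DiskWord u1 u2 u3 : gapw u1 -> gapw u2 -> gapw u3 -> diskw (u1 ++ u2 ++ u3).

(** The first letter decides the production, as in Polish notation, so a parse is unique. Hence
    products of the indicator of gaps are again indicators, with no multiplicities that could vanish
    modulo 2. *)
Lemma gapw_prefix_free u u' v v' : gapw u -> gapw u' -> u ++ v = u' ++ v' -> u = u' /\ v = v'.
Proof.
move=> Gu; elim: Gu u' v v' => [|u1 u2 u3 _ IH1 _ IH2 _ IH3] u' v v' [|u1' u2' u3' G1 G2 G3] //=.
  by case=> ->.
case; rewrite -!catA => /(IH1 _ _ _ G1)[-> /(IH2 _ _ _ G2)[-> /(IH3 _ _ _ G3)[-> /=]]].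
by case=> ->.
Qed.

Lemma diskw_prefix_free u u' v v' :
  diskw u -> diskw u' -> u ++ v = u' ++ v' -> u = u' /\ v = v'.
Proof.
case=> u1 u2 u3 G1 G2 G3 [u1' u2' u3' G1' G2' G3']; rewrite -!catA.
case/(gapw_prefix_free G1 G1') => -> /(gapw_prefix_free G2 G2')[-> ].
by case/(gapw_prefix_free G3 G3') => -> ->.
Qed.

(** The arrows of a quadrilateral close up to a loop, so passing through a whole tree of them
    changes the state like the bare alternation it replaces. *)
Lemma acts_gapw w q : gapw w -> acts q w = act q Alt.
Proof.
move=> Gw; elim: Gw q => // u1 u2 u3 _ IH1 _ IH2 _ IH3 q.
rewrite [LHS]/= !acts_cat IH1 IH2 IH3 /=.
by case: q => [[] []].
Qed.

Lemma acts_diskw w q : diskw w -> acts q w = act (act (act q Alt) Alt) Alt.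
Proof. by case=> u1 u2 u3 G1 G2 G3; rewrite !acts_cat !acts_gapw. Qed.

(* [delw a m]: the products of B^oo turn the factor [m] of a word into the
   letter [a]. *)
Inductive delw : sym -> word -> Prop :=
  | DelMerge : delw Ext [:: Rep]
  | DelRepl h : diskw h -> delw Rep (Ext :: h ++ [:: Alt])
  | DelRepr h : diskw h -> delw Rep (Alt :: h ++ [:: Ext])
  | DelAltl h : diskw h -> delw Alt (Ext :: h ++ [:: Rep])
  | DelAltr h : diskw h -> delw Alt (Rep :: h ++ [:: Ext]).

Lemma acts_delw a m q : delw a m -> acts q m = act q a.
Proof.
case=> // h Dh; rewrite [LHS]/= acts_cat (acts_diskw _ Dh) /=;
  by case: q => [[] []].
Qed.

(** * Indicator series and the derivation induced by the products *)

Section Indicator.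
Variable R : pzRingType.

Definition ind (T : Type) (p : T -> Prop) (x : T) : R :=
  if excluded_middle_informative (p x) then 1 else 0.

Lemma ind1 (T : Type) (p : T -> Prop) x : p x -> ind p x = 1.
Proof. by rewrite /ind; case: excluded_middle_informative. Qed.

Lemma ind0 (T : Type) (p : T -> Prop) x : ~ p x -> ind p x = 0.
Proof. by rewrite /ind; case: excluded_middle_informative. Qed.

Lemma indP (T : Type) (p : T -> Prop) x : (p x /\ ind p x = 1) \/ (~ p x /\ ind p x = 0).
Proof. by rewrite /ind; case: excluded_middle_informative; [left | right]. Qed.

Lemma indC (T : Type) (p : T -> Prop) x (r : R) : ind p x * r = r * ind p x.
Proof. by case: (indP p x) => [[_ ->]|[_ ->]]; rewrite ?(mul1r, mulr1, mul0r, mulr0). Qed.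

Lemma ind_eq (T U : Type) (p : T -> Prop) (q : U -> Prop) x y :
  (p x <-> q y) -> ind p x = ind q y.
Proof.
case=> pq qp; case: (indP p x) => [[px ->]|[npx ->]]; first by rewrite ind1 //; apply: pq.
by rewrite ind0 // => qy; apply/npx/qp.
Qed.

Lemma ssum_unique (T : Type) (V : nmodType) (s u0 v0 : seq T) (Phi : seq T -> seq T -> V) :
  u0 ++ v0 = s -> (forall u v, u ++ v = s -> u <> u0 -> Phi u v = 0) ->
  ssum s Phi = Phi u0 v0.
Proof.
elim: s u0 Phi => [|x s IHs] [|y u0] Phi //=.
- by move=> ->.
- move=> -> Phi0; rewrite ssum0 ?addr0 // => u v uv; apply: Phi0 => //=; by rewrite uv.
case=> -> eq_s Phi0; rewrite Phi0 // add0r (IHs u0) // => u v uv nu.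
by apply: Phi0 => [|[]]; rewrite //= uv.
Qed.

Lemma ssum_ind (T : Type) (p : seq T -> Prop) s (Phi : seq T -> seq T -> R) :
  (forall u u' v v', p u -> p u' -> u ++ v = u' ++ v' -> u = u' /\ v = v') ->
  forall u0 v0, u0 ++ v0 = s -> p u0 ->
  ssum s (fun u v => ind p u * Phi u v) = Phi u0 v0.
Proof.
move=> pf u0 v0 eq_s pu0; rewrite (ssum_unique eq_s) ?ind1 ?mul1r // => u v uv nu.
rewrite ind0 ?mul0r // => pu; case: nu.
by have [] := pf _ _ v v0 pu pu0; rewrite ?uv.
Qed.

End Indicator.

Arguments ind R {T} p x.
Arguments indP R {T} p x.

Section SeriesCalculus.
Variables (R : pzRingType) (char2 : forall x : R, x + x = 0).
Implicit Types (P Q : series R) (q : state) (w : word) (a : sym).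

Lemma series_char2 P : P + P = 0.
Proof. by apply: seriesP => q w; apply: char2. Qed.

Lemma char2_cancel P Q S : P + Q + (Q + S + P) = S.
Proof.
by rewrite addrC -addrA (addrA P) series_char2 add0r addrAC series_char2 add0r.
Qed.

Definition arrow a : series R := fun _ w => if w == [:: a] then 1 else 0.

Definition cst (T : state -> R) : series R := fun q w => if w is [::] then T q else 0.

Definition gap : series R := fun _ w => ind R gapw w.

Lemma arrowM a P q w :
  (arrow a * P) q w = if w is b :: w' then if b == a then P (act q a) w' else 0 else 0.
Proof.
rewrite seriesM; case: w => [|b w] /=; first by rewrite mul0r.
rewrite mul0r add0r ssum_nil => [|x u v]; last by rewrite /arrow eqseq_cons andbF mul0r.
by rewrite /arrow eqseq_cons andbT; case: eqP => [->|]; rewrite ?mul1r ?mul0r.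
Qed.

Lemma Marrow_nil a P q : (P * arrow a) q [::] = 0.
Proof. by rewrite seriesM /= mulr0. Qed.

Lemma Marrow a P q w b : (P * arrow a) q (w ++ [:: b]) = if b == a then P q w else 0.
Proof.
rewrite seriesM ssum_insert /= [X in _ + X](_ : _ = 0) ?addr0; last by rewrite mulr0.
rewrite ssum_rnil => [|u x v]; last first.
  by rewrite /arrow eqseq_cons andbC; case: v => [|? ?] /=; rewrite mulr0.
by rewrite /arrow eqseq_cons andbT; case: eqP; rewrite ?mulr1 ?mulr0.
Qed.

Lemma gap3E q w : (gap * gap * gap) q w = ind R diskw w.
Proof.
pose gap2w x := exists u v, [/\ gapw u, gapw v & x = u ++ v].
have gg q' w' : (gap * gap) q' w' = ind R gap2w w'.
  rewrite seriesM; case: (indP R gap2w w') => [[[u [v [Gu Gv ->]]] ->]|[nG ->]].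
    by rewrite (ssum_ind _ gapw_prefix_free (u0 := u) (v0 := v)) // /gap ind1.
  apply: ssum0 => u v uv; rewrite /gap.
  case: (indP R gapw u) => [[Gu _]|[_ ->]]; last by rewrite mul0r.
  by rewrite [ind _ _ v]ind0 ?mulr0 // => Gv; apply: nG; exists u, v.
rewrite -mulrA seriesM; case: (indP R diskw w) => [[D ->]|[nD ->]].
  case: D => u1 u2 u3 G1 G2 G3.
  rewrite (ssum_ind _ gapw_prefix_free (u0 := u1) (v0 := u2 ++ u3)) // gg ind1 //.
  by exists u2, u3.
apply: ssum0 => u v uv; rewrite /gap.
case: (indP R gapw u) => [[Gu _]|[_ ->]]; last by rewrite mul0r.
rewrite gg [X in _ * X]ind0 ?mulr0 // => -[u2 [u3 [G2 G3 ev]]]; apply: nD.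
by rewrite -uv ev.
Qed.

Lemma sandwichE a b q w (p : word -> Prop) P :
    (forall q' w', P q' w' = ind R p w') ->
  (arrow a * P * arrow b) q w = ind R (fun x => exists2 h, p h & x = a :: h ++ [:: b]) w.
Proof.
move=> PE; rewrite -mulrA arrowM; case: w => [|c w].
  by rewrite ind0 // => -[].
case: eqP => [->|nca]; last by rewrite ind0 // => -[h _ []].
case/lastP: w => [|w d]; first by rewrite Marrow_nil ind0 // => -[[|? ?]].
rewrite -cats1 Marrow; case: eqP => [->|ndb]; last first.
  rewrite ind0 // => -[h _ []]; rewrite !cats1 => /eqP; rewrite eqseq_rcons.
  by case/andP => _ /eqP.
rewrite PE; apply: ind_eq; split=> [pw|[h ph []]]; first by exists w.
by rewrite !cats1 => /eqP; rewrite eqseq_rcons => /andP[/eqP-> _].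
Qed.

Lemma gapE : gap = arrow Alt + arrow Ext * (gap * gap * gap) * arrow Ext.
Proof.
apply: seriesP => q w; rewrite seriesD (sandwichE _ _ _ _ (p := diskw) gap3E) /gap /arrow.
case: (indP R gapw w) => [[Gw ->]|[nG ->]].
  case: Gw => [|u1 u2 u3 G1 G2 G3].
    by rewrite eqxx ind0 ?addr0 // => -[].
  by rewrite ind1 ?add0r //; exists (u1 ++ u2 ++ u3).
case: eqP => [ew|_]; first by case: nG; rewrite ew; constructor.
rewrite ind0 ?addr0 // => -[_ [u1 u2 u3 G1 G2 G3] ew].
by apply: nG; rewrite ew; constructor.
Qed.

Lemma cstM (T S : state -> R) : cst T * cst S = cst (fun q => T q * S q).
Proof.
apply: seriesP => q [|a w]; rewrite seriesM //= mulr0 add0r ssum0 // => u v _.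
by rewrite mul0r.
Qed.

Lemma cstD (T S : state -> R) : cst T + cst S = cst (fun q => T q + S q).
Proof. by apply: seriesP => q [|a w] //=; rewrite seriesD /= addr0. Qed.

Lemma cst0 : cst (fun _ => 0) = 0. Proof. by apply: seriesP => q []. Qed.

Lemma cstME (T : state -> R) P q w : (cst T * P) q w = T q * P q w.
Proof. by rewrite seriesM ssum_nil // => x u v; rewrite mul0r. Qed.

Lemma McstE (T : state -> R) P q w : (P * cst T) q w = P q w * T (acts q w).
Proof. by rewrite seriesM ssum_rnil // => u x v; rewrite mulr0. Qed.

Lemma arrow_cst a (T : state -> R) : arrow a * cst T = cst (fun q => T (act q a)) * arrow a.
Proof.
apply: seriesP => q w; rewrite McstE cstME /arrow.
by case: eqP => [->|_]; rewrite ?mul1r ?mulr1 ?mul0r ?mulr0.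
Qed.

(** Any gap shifts a coefficient by one alternation, whatever its length. Equations between series
    in [gap] thus reduce to equations between coefficients along alternating words. *)
Lemma gap_cst (T : state -> R) : gap * cst T = cst (fun q => T (act q Alt)) * gap.
Proof.
apply: seriesP => q w; rewrite McstE cstME /gap.
case: (indP R gapw w) => [[Gw ->]|[_ ->]]; last by rewrite mul0r mulr0.
by rewrite acts_gapw // mulr1 mul1r.
Qed.

(** The transpose of the action of the products on words: the value at [w] adds up [P] over the
    words obtained when one product contracts a factor [m] of [w] to [a]. Only factors with
    junctions on both sides are seen here; disks at an end of the word enter the master equation
    separately. *)
Definition bder1 a P : series R := fun q w =>
  ssum w (fun u z => ssum z (fun m v => ind R (delw a) m * P q (u ++ a :: v))).

Definition bder P : series R := bder1 Ext P + bder1 Alt P + bder1 Rep P.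

Lemma bder1D a P Q : bder1 a (P + Q) = bder1 a P + bder1 a Q.
Proof.
apply: seriesP => q w; rewrite seriesD -ssumD; apply: eq_ssum => u z.
by rewrite -ssumD; apply: eq_ssum => m v; rewrite mulrDr.
Qed.

Lemma bder1M a P Q : bder1 a (P * Q) = bder1 a P * Q + P * bder1 a Q.
Proof.
apply: seriesP => q w; rewrite seriesD !seriesM {1}/bder1.
transitivity (ssum w (fun u z => ssum z (fun m v =>
    ssum u (fun u1 u2 => P q u1 * (ind R (delw a) m * Q (acts q u1) (u2 ++ a :: v)))) +
    ssum z (fun m v => ssum v (fun v1 v2 =>
     ind R (delw a) m * P q (u ++ a :: v1) * Q (acts q (u ++ m ++ v1)) v2)))).
  apply: eq_ssum => u z; rewrite -ssumD; apply: eq_ssum => m v.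
  rewrite seriesM ssum_insert mulrDr !ssum_mulrl; congr (_ + _); apply: eq_ssum => u1 u2.
    by rewrite !mulrA -indC.
  (* A product does not change the state behind its window, so the right factor starts at the same
     arrow before and after the contraction. *)
  case: (indP R (delw a) m) => [[Dm ->]|[_ ->]]; last by rewrite !mul0r.
  by rewrite !mul1r !acts_cat (acts_delw _ Dm).
rewrite ssumD addrC; congr (_ + _).
  under eq_ssum => u z do rewrite ssum_assoc.
  rewrite ssum_assoc; apply: eq_ssum => y v2.
  rewrite ssum_mulrr; apply: eq_ssum_cat => u z uz; rewrite ssum_mulrr.
  by apply: eq_ssum_cat => m v1 mv1; rewrite mv1 uz.
under eq_ssum => u z do rewrite ssum_exchange.
rewrite -ssum_assoc; apply: eq_ssum => u1 y.
rewrite ssum_mulrl; apply: eq_ssum => u2 z; rewrite ssum_mulrl.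
by apply: eq_ssum.
Qed.

Lemma bderD P Q : bder (P + Q) = bder P + bder Q.
Proof. by rewrite /bder !bder1D [RHS]addrACA [X in _ = X + _]addrACA. Qed.

Lemma bderM P Q : bder (P * Q) = bder P * Q + P * bder Q.
Proof.
by rewrite /bder !bder1M !mulrDl !mulrDr [RHS]addrACA [X in _ = X + _]addrACA.
Qed.

Lemma bder_cst T : bder (cst T) = 0.
Proof.
apply: seriesP => q w; rewrite /bder /bder1 !seriesD !ssum0 ?addr0 //;
  move=> u z _; apply: ssum0 => m v _; case: u => *; exact: mulr0.
Qed.

Lemma bder1_arrow a b q w : bder1 a (arrow b) q w = if a == b then ind R (delw a) w else 0.
Proof.
rewrite /bder1 ssum_nil => [|x u z]; last first.
  by apply: ssum0 => m v _; rewrite /arrow; case: u => [|? ?] /=;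
     rewrite eqseq_cons ?andbF mulr0.
rewrite ssum_rnil => [|u x v]; last by rewrite /arrow eqseq_cons andbF mulr0.
by rewrite /arrow eqseq_cons andbT; case: eqP; rewrite ?mulr1 ?mulr0.
Qed.

Lemma bder_Ext : bder (arrow Ext) = arrow Rep.
Proof.
apply: seriesP => q w; rewrite /bder !seriesD !bder1_arrow /= !addr0 /arrow.
case: eqP => [->|nw]; first by rewrite ind1 //; constructor.
by rewrite ind0 // => Dw; apply: nw; inversion Dw.
Qed.

Let gap3 := gap * gap * gap.

Lemma delw_split a b w : a != Ext -> b != Ext -> a != b ->
    (forall h, diskw h -> delw a (Ext :: h ++ [:: b])) ->
    (forall h, diskw h -> delw a (b :: h ++ [:: Ext])) ->
    (forall m, delw a m -> (exists2 h, diskw h & m = Ext :: h ++ [:: b]) \/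
                           (exists2 h, diskw h & m = b :: h ++ [:: Ext])) ->
  ind R (delw a) w = ind R (fun x => exists2 h, diskw h & x = Ext :: h ++ [:: b]) w +
                     ind R (fun x => exists2 h, diskw h & x = b :: h ++ [:: Ext]) w.
Proof.
move=> na nb nab Dl Dr D; case: (indP R (delw a) w) => [[Dw ->]|[nD ->]].
  case: (D w Dw) => -[h Dh ew].
    rewrite ind1; last by exists h.
    by rewrite ind0 ?addr0 // ew => -[h' _ [e]]; rewrite -e eqxx in nb.
  rewrite addrC ind1; last by exists h.
  by rewrite ind0 ?addr0 // ew => -[h' _ [e]]; rewrite -e eqxx in nb.
by rewrite !ind0 ?addr0 //; move=> -[h Dh ew]; apply: nD; rewrite ew; auto.
Qed.

Lemma bder_Alt : bder (arrow Alt) = arrow Ext * gap3 * arrow Rep + arrow Rep * gap3 * arrow Ext.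
Proof.
apply: seriesP => q w; rewrite /bder !seriesD !bder1_arrow /= addr0 add0r.
rewrite !(sandwichE _ _ _ _ (p := diskw) gap3E).
apply: (@delw_split Alt Rep) => //; try by constructor.
by move=> m Dm; inversion Dm; subst; [left | right]; eexists; eauto.
Qed.

Definition vanishes n P := forall q w, (size w < n)%N -> P q w = 0.

Lemma vanishesMr n P Q : vanishes n P -> vanishes n (P * Q).
Proof.
move=> vP q w ltwn; rewrite seriesM; apply: ssum0 => u v uv.
by rewrite vP ?mul0r // (leq_ltn_trans _ ltwn) // -uv size_cat leq_addr.
Qed.

Lemma vanishesMl n P Q : vanishes n P -> vanishes n (Q * P).
Proof.
move=> vP q w ltwn; rewrite seriesM; apply: ssum0 => u v uv.
by rewrite vP ?mulr0 // (leq_ltn_trans _ ltwn) // -uv size_cat leq_addl.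
Qed.

Lemma vanishesD n P Q : vanishes n P -> vanishes n Q -> vanishes n (P + Q).
Proof. by move=> vP vQ q w ltwn; rewrite seriesD vP ?vQ ?addr0. Qed.

Lemma vanishes_arrow n a P : vanishes n P -> vanishes n.+1 (arrow a * P).
Proof. by move=> vP q [|b w] ltwn; rewrite arrowM //; case: eqP => // _; apply: vP. Qed.

(* [bder gap] is a fixed point of a contraction. *)
Lemma bder_gap : bder gap = 0.
Proof.
(* The two outer [Ext] of a node become [Rep] under the derivation; these terms coincide with those
   of [bder (arrow Alt)] and cancel modulo 2. *)
have bgE : bder gap = arrow Ext * (bder gap3 * arrow Ext).
  rewrite {1}gapE bderD bder_Alt (bderM (_ * _)) (bderM (arrow Ext)) bder_Ext -/gap3.
  by rewrite mulrDl -[_ * bder gap3 * _]mulrA; apply: char2_cancel.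
suff v n : vanishes n (bder gap) by apply: seriesP => q w; apply: (v (size w).+1).
elim: n => // n IHn; rewrite bgE; apply: vanishes_arrow; apply: vanishesMr.
rewrite /gap3 !bderM; apply: vanishesD; last exact: vanishesMl.
by apply: vanishesMr; apply: vanishesD; [apply: vanishesMr | apply: vanishesMl].
Qed.

End SeriesCalculus.

(** * Geometric series and the master equation *)

Lemma cat_nseq (T : Type) (x : T) n u v :
  u ++ v = nseq n x -> u = nseq (size u) x /\ v = nseq (size v) x.
Proof.
elim: n u v => [|n IHn] [|y u] v //=; first by move->.
  by move->; rewrite /= size_nseq.
by case=> -> /IHn[<- <-].
Qed.

Lemma gapw_Alt w : gapw w -> Alt \in w.
Proof. by elim=> // u1 u2 u3 _ A1 _ _ _ _; rewrite inE !mem_cat A1. Qed.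

Section MasterEquation.
Variables (R : pzRingType) (char2 : forall x : R, x + x = 0).

Lemma vanishesX n (N : series R) : vanishes 1 N -> vanishes n (N ^+ n).
Proof.
move=> vN; elim: n => [|n IHn] // q w ltwn; rewrite exprS seriesM.
apply: ssum0 => -[|x u] v uv; first by rewrite vN // mul0r.
by rewrite IHn ?mulr0 // -ltnS (leq_trans _ ltwn) // -uv size_cat /= !ltnS leq_addl.
Qed.

(** On a word of length n all powers beyond [N ^+ n] vanish, so the geometric series is a finite sum
    there, and the truncation may depend on the word. *)
Lemma exists_geometric (N : series R) : vanishes 1 N ->
  exists2 G : series R, G = 1 + N * G & G = 1 + G * N.
Proof.
move=> vN; pose S n : series R := \sum_(i < n) N ^+ i.
pose G : series R := fun q w => S (size w).+1 q w.
have coefD n m q w : (size w < n)%N -> S (n + m)%N q w = S n q w.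
  move=> ltwn; elim: m => [|m IHm]; first by rewrite addn0.
  rewrite addnS /S big_ord_recr /= seriesD -/(S _) IHm.
  by rewrite (vanishesX vN) ?addr0 // (leq_trans ltwn) // leq_addr.
have GE n q w : (size w < n)%N -> G q w = S n q w.
  by move=> ltwn; rewrite -(subnKC ltwn) coefD.
have S0 n : S n.+1 = 1 + N * S n.
  rewrite /S big_ord_recl mulr_sumr; congr (_ + _).
  by apply: eq_bigr => i _; rewrite -exprS.
have S1 n : S n.+1 = 1 + S n * N.
  rewrite /S big_ord_recl mulr_suml; congr (_ + _).
  by apply: eq_bigr => i _; rewrite -exprSr.
exists G; apply: seriesP => q w; rewrite (@GE (size w).+2) ?leqnSn //.
  rewrite S0 !seriesD; congr (_ + _); rewrite !seriesM; apply: eq_ssum_cat => u v uv.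
  by rewrite -(@GE (size w).+1) // -uv size_cat ltnS leq_addl.
rewrite S1 !seriesD; congr (_ + _); rewrite !seriesM; apply: eq_ssum_cat => u v uv.
by rewrite -(@GE (size w).+1) // -uv size_cat ltnS leq_addr.
Qed.

Lemma eq_cst (T S : state -> R) : T =1 S -> cst T = cst S.
Proof. by move=> /functional_extensionality ->. Qed.

Notation nxt q := (act q Alt).

Variables (D0 : R) (ev : bool -> R) (T1 T2 T3 : state -> R).
Hypothesis dT1 : forall q, T1 q * D0 + D0 * T1 q = 0.
Hypothesis dT2 : forall q, T2 q * D0 + D0 * T2 q = T1 q * T1 (nxt q).
Hypothesis dT3 : forall q,
  T3 q * D0 + D0 * T3 q = T1 q * T2 (nxt q) + T2 q * T1 (nxt (nxt q)).
Hypothesis T4 : forall q, T1 q * T3 (nxt q) + T2 q * T2 (nxt (nxt q)) +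
                     T3 q * T1 (nxt (nxt (nxt q))) = ev q.1.
Hypothesis T5 : forall q, T2 q * T3 (nxt (nxt q)) + T3 q * T2 (nxt (nxt (nxt q))) = 0.
Hypothesis T6 : forall q, T3 q * T3 (nxt (nxt (nxt q))) = 0.
Hypothesis evT1 : forall q, ev q.1 * T1 q = T1 q.
Hypothesis evT2 : forall q, ev q.1 * T2 q = T2 q.
Hypothesis evT3 : forall q, ev q.1 * T3 q = T3 q.
Hypothesis T1ev : forall q, T1 q * ev (tgt_state q) = T1 q.
Hypothesis T2ev : forall q, T2 q * ev (tgt_state (nxt q)) = T2 q.
Hypothesis T3ev : forall q, T3 q * ev (tgt_state (nxt (nxt q))) = T3 q.

Let g := gap R.
Let E := arrow R Ext.
Let e := cst (fun q => ev q.1).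
Let e' := cst (fun q => ev (tgt_state q)).
Let t1 := cst T1.
Let t2 := cst T2.
Let t3 := cst T3.
Let D := cst (fun _ => D0).
Let d (P : series R) : series R := P * D + D * P.

Let Bk : series R := t1 + t2 * g + t3 * g * g.

Let dD P Q : d (P + Q) = d P + d Q.
Proof. by rewrite /d mulrDl mulrDr addrACA. Qed.

Let dM P Q : d (P * Q) = d P * Q + P * d Q.
Proof.
rewrite /d mulrDl mulrDr !mulrA [RHS]addrC -[RHS]addrA; congr (_ + _).
by rewrite addrA series_char2 // add0r.
Qed.

Let dg : d g = 0.
Proof. by rewrite /d /g gap_cst series_char2. Qed.

Let dE : d E = 0.
Proof. by rewrite /d /E arrow_cst series_char2. Qed.

Let d_cst T : d (cst T) = cst (fun q => T q * D0 + D0 * T q).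
Proof. by rewrite /d !cstM cstD. Qed.

(** After [gap_cst] moves all coefficients to the left, both sides are polynomials in [g]. Degrees 1
    and 2 are the boundary formulas for [T2] and [T3]; degrees 3, 4 and 5 are [T4], [T5] and [T6],
    with [ev] in degree 3 absorbed by [e * (g * g * g)]. *)
Let dBk : d Bk = Bk * g * Bk + e * (g * g * g).
Proof.
have gc T : g * cst T = cst (fun q => T (nxt q)) * g by apply: gap_cst.
have ccg (T S : state -> R) U : cst T * (cst S * U) = cst (fun q => T q * S q) * U.
  by rewrite mulrA cstM.
have gcg T U : g * (cst T * U) = cst (fun q => T (nxt q)) * (g * U).
  by rewrite mulrA gc mulrA.
have cD (T S : state -> R) U : cst T * U + cst S * U = cst (fun q => T q + S q) * U.
  by rewrite -mulrDl cstD.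
have -> : d Bk = cst (fun q => T1 q * T1 (nxt q)) * g +
     cst (fun q => T1 q * T2 (nxt q) + T2 q * T1 (nxt (nxt q))) * (g * g).
  rewrite /Bk !dD !dM dg !mulr0 !addr0 /t1 /t2 /t3 !d_cst -mulrA.
  by rewrite (eq_cst dT1) (eq_cst dT2) (eq_cst dT3) cst0 add0r.
rewrite /Bk !(mulrDl, mulrDr) -!mulrA /t1 /t2 /t3 /e !(gcg, ccg, gc).
have T4' q : T1 q * T3 (nxt q) + T2 q * T2 (nxt (nxt q)) +
    T3 q * T1 (nxt (nxt (nxt q))) + ev q.1 = 0 by rewrite T4 char2.
have T5' q : T3 q * T2 (nxt (nxt (nxt q))) + T2 q * T3 (nxt (nxt q)) = 0.
  by rewrite addrC.
rewrite ![in RHS]addrA [RHS](ACl ((1*(4*2))*(6*8)*9*((7*5*3)*10)))%AC /=.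
rewrite !cD /=.
rewrite (eq_cst T4') (eq_cst T6) (eq_cst T5') cst0 !mul0r !addr0.
by [].
Qed.

Let Bk_nseq q n : Bk q (nseq n Ext) = if n is 0 then T1 q else 0.
Proof.
have g_nseq m q' : g q' (nseq m Ext) = 0.
  rewrite /g /gap ind0 // => /gapw_Alt; by rewrite mem_nseq andbF.
rewrite /Bk -mulrA !seriesD !cstME g_nseq mulr0 addr0 seriesM.
rewrite ssum0 => [|u v uv]; last first.
  by have [_ ->] := cat_nseq uv; rewrite g_nseq mulr0.
by rewrite mulr0 addr0; case: n.
Qed.

Let F_ex : exists F : series R, F = Bk + Bk * E * F /\ F = Bk + F * E * Bk.
Proof.
have vBE : vanishes 1 (Bk * E).
  by move=> q [|//] _; apply: Marrow_nil.
have [G G1 G2] := exists_geometric vBE; exists (G * Bk); split.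
  by rewrite {1}G1 mulrDl mul1r mulrA.
by rewrite {1}G2 mulrDl mul1r !mulrA.
Qed.

Let F := proj1_sig (constructive_indefinite_description _ F_ex).

Let FE : F = Bk + Bk * E * F.
Proof. by rewrite /F; case: constructive_indefinite_description => ? []. Qed.

Let FE' : F = Bk + F * E * Bk.
Proof. by rewrite /F; case: constructive_indefinite_description => ? []. Qed.

(** Since [bder] kills [Bk], it acts only on the [Ext] between consecutive blocks and turns one of
    them into [Rep]. Both sides solve the same linear recursion, and their sum vanishes to every
    order. *)
Let bF : bder F = F * arrow R Rep * F.
Proof.
have bBk : bder Bk = 0.
  by rewrite /Bk !(bderD, bderM) !bder_cst bder_gap // !(mul0r, mulr0, addr0).
have bFE : bder F = Bk * arrow R Rep * F + Bk * E * bder F.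
  by rewrite {1}FE bderD !bderM bBk mul0r add0r bder_Ext add0r.
suff v n : vanishes n (bder F + F * arrow R Rep * F).
  apply: seriesP => q w; have := v (size w).+1 q w (ltnSn _); rewrite seriesD.
  by move/(congr1 (fun x => x + (F * arrow R Rep * F) q w)); rewrite add0r -addrA char2 addr0.
elim: n => // n IHn.
have -> : bder F + F * arrow R Rep * F = Bk * (E * (bder F + F * arrow R Rep * F)).
  have FRF : F * arrow R Rep * F = Bk * arrow R Rep * F + Bk * E * (F * arrow R Rep * F).
    by rewrite {1}FE !mulrDl !mulrA.
  by rewrite {1}bFE {1}FRF addrACA series_char2 // add0r [RHS]mulrA [RHS]mulrDr.
by apply: vanishesMl; apply: vanishes_arrow.
Qed.

(** The derivative of a resolvent: [F] is [Bk] followed by a geometric series in [E * Bk], and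
    [1 + F * E] inverts [1 + Bk * E] up to the term [F * E * d F], which occurs on both sides and
    cancels. *)
Let dF : d F = (1 + F * E) * d Bk * (1 + E * F).
Proof.
have dFE : d F = d Bk * (1 + E * F) + Bk * E * d F.
  by rewrite {1}FE dD !dM dE mulr0 addr0 [X in _ = X + _]mulrDr mulr1 !mulrA addrA.
have eqF : (1 + F * E) * (Bk * E) = F * E.
  by rewrite mulrDl mul1r !mulrA -mulrDl -FE'.
have : (1 + F * E) * d F = (1 + F * E) * d Bk * (1 + E * F) + F * E * d F.
  by rewrite {1}dFE mulrDr (mulrA _ (Bk * E)) eqF mulrA.
by rewrite mulrDl mul1r => /addIr.
Qed.

Let eF : e * F = F.
Proof.
have eBk : e * Bk = Bk.
  rewrite /Bk !mulrDr !mulrA /e /t1 /t2 /t3 !cstM.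
  by rewrite (eq_cst evT1) (eq_cst evT2) (eq_cst evT3).
by rewrite FE mulrDr !mulrA eBk.
Qed.

Let Fe : F * e' = F.
Proof.
have eBk : Bk * e' = Bk.
  rewrite /Bk !mulrDl -!mulrA /e' /t1 /t2 /t3 !gap_cst (mulrA g) gap_cst -(mulrA _ g) !mulrA !cstM.
  by rewrite (eq_cst T1ev) (eq_cst T2ev) (eq_cst T3ev).
by rewrite FE' mulrDl -!mulrA eBk.
Qed.

(** The morphism equation in generating form. On the left, [bder F] handles contractions bounded by
    junctions on both sides; the next two terms handle a disk that is a proper initial or final
    factor of the word, and the last one a word that is itself a disk, whose product is an
    idempotent. On the right stand the differential of A and the product of two components at a
    boundary between basis elements. *)
Theorem master_equation : exists F : series R,
  [/\ bder F + gap R * gap R * gap R * arrow R Ext * F + F * arrow R Ext * gap R * gap R * gap R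
       + cst (fun q => ev q.1) * (gap R * gap R * gap R) =
      F * cst (fun _ => D0) + cst (fun _ => D0) * F + F * (arrow R Alt + arrow R Rep) * F,
      cst (fun q => ev q.1) * F = F,
      F * cst (fun q => ev (tgt_state q)) = F,
      forall q, F q [::] = T1 q
    & forall q n, F q (nseq n.+1 Ext) = T1 q * F (act q Ext) (nseq n Ext)].
Proof.
exists F; split => //; first last.
- move=> q n; rewrite {1}FE seriesD Bk_nseq add0r -mulrA seriesM [nseq _ _]/=.
  rewrite (@ssum_unique _ _ _ [::] (nseq n.+1 Ext)) //= => [|u v uv nu].
    by rewrite arrowM /= (Bk_nseq q 0).
  have [-> _] := @cat_nseq _ Ext n.+1 _ _ uv.
  by case: u {uv} nu => // a u _; rewrite Bk_nseq mul0r.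
- move=> q; rewrite FE seriesD (Bk_nseq q 0) -mulrA seriesM /= arrowM mulr0 addr0.
  by [].
rewrite -/g -/E -/e -/D -/(d F) bF dF dBk.
(* The gap equation solved for [Alt]. It makes [F * arrow R Alt * F] cancel the two terms of [d F]
   in which a gap or a whole node stands between two copies of [F]. *)
have altE : arrow R Alt = g + E * (g * g * g) * E.
  by rewrite {1}/g gapE -/g -/E -addrA series_char2 // addr0.
(* A disk path followed by one more arrow of its last type returns to the vertex where it started,
   so the idempotent passes through. *)
have eg : e * (g * g * g) * E = g * g * g * E * e.
  have gC (T : state -> R) P : g * (cst T * P) = cst (fun q => T (nxt q)) * (g * P).
    by rewrite mulrA gap_cst mulrA.
  rewrite -!mulrA /E /e arrow_cst !gC; congr (_ * _).
  by apply: eq_cst => -[[] []].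
have Ee : E * e = e' * E by rewrite /E /e arrow_cst.
have FEe : F * E * e = F * E by rewrite -mulrA Ee mulrA Fe.
have FEF : (1 + F * E) * Bk = F by rewrite mulrDl mul1r -FE'.
have BkF : Bk * (1 + E * F) = F by rewrite mulrDr mulr1 mulrA -FE.
have split u v c : u * (Bk * g * Bk + c) * v = u * Bk * g * (Bk * v) + u * c * v.
  by rewrite mulrDr mulrDl !mulrA.
rewrite split FEF BkF {split} altE.
have eg' X : e * (g * (g * (g * (E * X)))) = g * (g * (g * (E * (e * X)))).
  by move: eg; rewrite !mulrA => ->.
have -> : (1 + F * E) * (e * (g * g * g)) * (1 + E * F) =
    e * (g * g * g) + g * g * g * E * F + F * E * g * g * g +
                 F * E * (g * g * g) * E * F.
  rewrite !(mulrDl, mulrDr) !mulr1 !mul1r !mulrA FEe addrA; congr (_ + _).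
  rewrite addrAC; congr (_ + _ + _).
  by rewrite -!mulrA eg' eF.
have -> : F * (g + E * (g * g * g) * E + arrow R Rep) * F =
    F * g * F + F * E * (g * g * g) * E * F + F * arrow R Rep * F.
  by rewrite 2!(mulrDr F) 2!(mulrDl _ _ F) !mulrA.
rewrite ![in RHS]addrA [RHS](ACl ((1*6)*(5*7)*(8*3*4*2)))%AC /=.
by rewrite !series_char2 // !add0r.
Qed.

End MasterEquation.

(** * The matrices of the quasi-isomorphism *)

Lemma Rd_char2 (p : Rd) : p + p = 0.
Proof.
rewrite -[p]scale1r -scalerDl (_ : 1 + 1 = 0 :> 'F_2) ?scale0r //.
by apply/val_inj.
Qed.

Notation mat := 'M[Rd]_4.

Lemma mat_char2 (M : mat) : M + M = 0.
Proof. by apply/matrixP => i j; rewrite !mxE Rd_char2. Qed.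

(* A matrix with monomial entries as the list of its entries
   ((a, b, c), (i, j)), standing for x^a y^b z^c at position (i, j). *)
Notation entries := (seq ((nat * nat * nat) * ('I_4 * 'I_4))).

Definition entry (t : (nat * nat * nat) * ('I_4 * 'I_4)) : mat :=
  (px ^+ t.1.1.1 * py ^+ t.1.1.2 * pz ^+ t.1.2) *: delta_mx t.2.1 t.2.2.

Definition mx_of (l : entries) : mat := \sum_(t <- l) entry t.

Definition entry_mul (t u : (nat * nat * nat) * ('I_4 * 'I_4)) :=
  ((t.1.1.1 + u.1.1.1, t.1.1.2 + u.1.1.2, t.1.2 + u.1.2), (t.2.1, u.2.2))%N.

Definition entries_mul (l m : entries) : entries :=
  flatten [seq [seq entry_mul t u | u <- m & t.2.2 == u.2.1] | t <- l].

Lemma monomialM (S : comPzRingType) (x y z : S) a b c a' b' c' :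
  x ^+ a * y ^+ b * z ^+ c * (x ^+ a' * y ^+ b' * z ^+ c') =
  x ^+ (a + a') * y ^+ (b + b') * z ^+ (c + c').
Proof. by rewrite !exprD mulrACA (mulrACA (x ^+ a)). Qed.

Lemma entryM t u : entry t * entry u = if t.2.2 == u.2.1 then entry (entry_mul t u) else 0.
Proof.
rewrite /entry /entry_mul /= -[LHS]/(_ *m _) -scalemxAl -scalemxAr scalerA.
rewrite mul_delta_mx_cond; case: eqP => _; last by rewrite mulr0n scaler0.
rewrite mulr1n; congr (_ *: _); apply: monomialM.
Qed.

Lemma mx_ofM l m : mx_of l * mx_of m = mx_of (entries_mul l m).
Proof.
rewrite /mx_of /entries_mul big_flatten big_map mulr_suml; apply: eq_bigr => t _.
rewrite big_map big_filter mulr_sumr big_mkcond; apply: eq_bigr => u _.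
by rewrite entryM eq_sym.
Qed.

Lemma mx_ofD l m : mx_of l + mx_of m = mx_of (l ++ m).
Proof. by rewrite /mx_of big_cat. Qed.

Lemma mx_of_even l : all (fun t => ~~ odd (count_mem t l)) l -> mx_of l = 0.
Proof.
move=> /allP ev; rewrite /mx_of -big_undup_iterop_count big_seq big1 // => t.
rewrite mem_undup => /ev; rewrite -[iterop _ _ _ _]/(_ *+ _) => even_t.
by rewrite -(even_halfK even_t) -addnn mulrnDr mat_char2.
Qed.

(** In characteristic 2 only the parity of each multiplicity matters. The identities below thus
    become Boolean computations on short lists. *)
Lemma mx_of_eq l m : all (fun t => ~~ odd (count_mem t (l ++ m))) (l ++ m) -> mx_of l = mx_of m.
Proof.
move/mx_of_even; rewrite -mx_ofD => /(congr1 (+%R^~ (mx_of m))).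
by rewrite add0r -addrA mat_char2 addr0.
Qed.

Definition o0 : 'I_4 := Ordinal (isT : 0 < 4)%N.
Definition o1 : 'I_4 := Ordinal (isT : 1 < 4)%N.
Definition o2 : 'I_4 := Ordinal (isT : 2 < 4)%N.
Definition o3 : 'I_4 := Ordinal (isT : 3 < 4)%N.

Definition ld0 : entries :=
  [:: ((1, 0, 0), (o1, o0)); ((0, 1, 1), (o0, o1));
      ((0, 1, 0), (o3, o2)); ((1, 0, 1), (o2, o3))]%N.

Definition lidem (v : bool) : entries :=
  if v then [:: ((0, 0, 0), (o2, o2)); ((0, 0, 0), (o3, o3))]%N
  else [:: ((0, 0, 0), (o0, o0)); ((0, 0, 0), (o1, o1))]%N.

(* The image of the alternating word of n elementary arrows starting with q
   is [lT1 q], [lT2 q], [lT3 q] for n = 1, 2, 3 and zero for longer words. *)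
Definition lT1 (q : state) : entries :=
  match q with
  | (false, false) => [:: ((0, 1, 0), (o0, o0)); ((0, 1, 0), (o1, o1))]
  | (true, false) => [:: ((1, 0, 0), (o2, o2)); ((1, 0, 0), (o3, o3))]
  | (false, true) => [:: ((0, 0, 0), (o1, o2)); ((0, 0, 1), (o0, o3))]
  | (true, true) => [:: ((0, 0, 0), (o3, o0)); ((0, 0, 1), (o2, o1))]
  end%N.

Definition lT2 (q : state) : entries :=
  match q with
  | (false, false) => [:: ((0, 0, 0), (o1, o3))]
  | (true, false) => [:: ((0, 0, 0), (o3, o1))]
  | (false, true) => [:: ((0, 0, 0), (o0, o2))]
  | (true, true) => [:: ((0, 0, 0), (o2, o0))]
  end%N.

(** For S, D, S the products [T1 T2] and [T2 T1] agree and cancel, so zero is a null-homotopy. For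
    D, S, D starting at the vertex [false] their sum has the entries y at (0, 2) and x at (1, 3),
    which is the boundary of the unit entry at (0, 3); the other vertex is symmetric. *)
Definition lT3 (q : state) : entries :=
  match q with
  | (false, false) => [:: ((0, 0, 0), (o0, o3))]
  | (true, false) => [:: ((0, 0, 0), (o2, o1))]
  | _ => [::]
  end%N.

Definition md0 : mat := mx_of ld0.
Definition midem (v : bool) : mat := mx_of (lidem v).
Definition T1 (q : state) : mat := mx_of (lT1 q).
Definition T2 (q : state) : mat := mx_of (lT2 q).
Definition T3 (q : state) : mat := mx_of (lT3 q).

Lemma mx_of_nil : mx_of [::] = 0.
Proof. by rewrite /mx_of big_nil. Qed.

Section MatrixEquations.
Variable q : state.
Notation nxt q := (act q Alt).

Lemma T1_cycle : T1 q * md0 + md0 * T1 q = 0.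
Proof.
rewrite /md0 /T1 -mx_of_nil !mx_ofM ?mx_ofD; apply: mx_of_eq.
by case: q => [[] []].
Qed.

Lemma T2_boundary : T2 q * md0 + md0 * T2 q = T1 q * T1 (nxt q).
Proof.
rewrite /md0 /T1 /T2 !mx_ofM ?mx_ofD; apply: mx_of_eq.
by case: q => [[] []].
Qed.

Lemma T3_boundary : T3 q * md0 + md0 * T3 q = T1 q * T2 (nxt q) + T2 q * T1 (nxt (nxt q)).
Proof.
rewrite /md0 /T1 /T2 /T3 !mx_ofM ?mx_ofD; apply: mx_of_eq.
by case: q => [[] []].
Qed.

(** Four alternating arrows bound a quadrilateral, on which [mu_4] is an idempotent; here this value
    appears as the fourfold Massey product. *)
Lemma T_length4 : T1 q * T3 (nxt q) + T2 q * T2 (nxt (nxt q)) + T3 q * T1 (nxt (nxt (nxt q))) = midem q.1.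
Proof.
rewrite /midem /T1 /T2 /T3 !mx_ofM ?mx_ofD; apply: mx_of_eq.
by case: q => [[] []].
Qed.

Lemma T_length5 : T2 q * T3 (nxt (nxt q)) + T3 q * T2 (nxt (nxt (nxt q))) = 0.
Proof.
rewrite /T2 /T3 -mx_of_nil !mx_ofM ?mx_ofD; apply: mx_of_eq.
by case: q => [[] []].
Qed.

Lemma T_length6 : T3 q * T3 (nxt (nxt (nxt q))) = 0.
Proof.
rewrite /T3 -mx_of_nil !mx_ofM ?mx_ofD; apply: mx_of_eq.
by case: q => [[] []].
Qed.

Lemma midem_T1 : midem q.1 * T1 q = T1 q.
Proof.
rewrite /midem /T1 !mx_ofM ?mx_ofD; apply: mx_of_eq.
by case: q => [[] []].
Qed.

Lemma midem_T2 : midem q.1 * T2 q = T2 q.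
Proof.
rewrite /midem /T2 !mx_ofM ?mx_ofD; apply: mx_of_eq.
by case: q => [[] []].
Qed.

Lemma midem_T3 : midem q.1 * T3 q = T3 q.
Proof.
rewrite /midem /T3 !mx_ofM ?mx_ofD; apply: mx_of_eq.
by case: q => [[] []].
Qed.

Lemma T1_midem : T1 q * midem (tgt_state q) = T1 q.
Proof.
rewrite /midem /T1 !mx_ofM ?mx_ofD; apply: mx_of_eq.
by case: q => [[] []].
Qed.

Lemma T2_midem : T2 q * midem (tgt_state (nxt q)) = T2 q.
Proof.
rewrite /midem /T2 !mx_ofM ?mx_ofD; apply: mx_of_eq.
by case: q => [[] []].
Qed.

Lemma T3_midem : T3 q * midem (tgt_state (nxt (nxt q))) = T3 q.
Proof.
rewrite /midem /T3 !mx_ofM ?mx_ofD; apply: mx_of_eq.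
by case: q => [[] []].
Qed.

End MatrixEquations.

Lemma exists_functor_series : exists F : series mat,
  [/\ bder F + gap _ * gap _ * gap _ * arrow _ Ext * F
        + F * arrow _ Ext * gap _ * gap _ * gap _
        + cst (fun q => midem q.1) * (gap _ * gap _ * gap _) =
      F * cst (fun _ => md0) + cst (fun _ => md0) * F + F * (arrow _ Alt + arrow _ Rep) * F,
      cst (fun q => midem q.1) * F = F,
      F * cst (fun q => midem (tgt_state q)) = F,
      forall q, F q [::] = T1 q
    & forall q n, F q (nseq n.+1 Ext) = T1 q * F (act q Ext) (nseq n Ext)].
Proof.
exact: (@master_equation _ mat_char2 md0 midem T1 T2 T3 T1_cycle T2_boundary T3_boundary
  T_length4 T_length5 T_length6 midem_T1 midem_T2 midem_T3 T1_midem T2_midem T3_midem).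
Qed.

(** * Words of composable lists of basis elements *)

Definition nonidem (b : Bbasis) : bool := if b is Be _ then false else true.

Definition btype (b : Bbasis) : bool := if b is BS _ _ then true else false.

Definition blen (b : Bbasis) : nat := match b with Be _ => 0%N | BD _ n | BS _ n => n end.

Definition bst (b : Bbasis) : state := (Bsrc b, btype b).

Definition letter (q : state) (n : nat) : Bbasis := if q.2 then BS q.1 n else BD q.1 n.

Definition junc (t t' : bool) : sym := if t == t' then Rep else Alt.

(** The junction with a preceding element of type [t] is included; this makes the word additive
    under concatenation, unlike [wd]. *)
Fixpoint te (t : bool) (s : seq Bbasis) : word :=
  if s is b :: s' then junc t (btype b) :: nseq (blen b) Ext ++ te (btype b) s' else [::].

Definition wd (s : seq Bbasis) : word :=
  if s is b :: s' then nseq (blen b) Ext ++ te (btype b) s' else [::].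

Definition lt (t : bool) (s : seq Bbasis) : bool := last t (map btype s).

Definition ok (s : seq Bbasis) : bool :=
  all nonidem s && sorted (fun a b => Btgt a == Bsrc b) s.

Lemma te_cat t s1 s2 : te t (s1 ++ s2) = te t s1 ++ te (lt t s1) s2.
Proof. by elim: s1 t => //= b s1 IHs1 t; rewrite IHs1 catA. Qed.

Lemma wd_te t s : wd s = behead (te t s).
Proof. by case: s. Qed.

Lemma te_wd t b s : te t (b :: s) = junc t (btype b) :: wd (b :: s).
Proof. by []. Qed.

Lemma letter_bst b : nonidem b -> b = letter (bst b) (blen b).
Proof. by case: b. Qed.

Lemma letterK q n : bst (letter q n) = q /\ blen (letter q n) = n /\ nonidem (letter q n).
Proof. by case: q => v []. Qed.

Lemma btype_letter q n : btype (letter q n) = q.2.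
Proof. by case: q => v []. Qed.

Lemma Bsrc_letter q n : Bsrc (letter q n) = q.1.
Proof. by case: q => v []. Qed.

Lemma acts_nseq q n : acts q (nseq n Ext) = (if q.2 && odd n then ~~ q.1 else q.1, q.2).
Proof.
elim: n q => [|n IHn] [v t] /=; first by rewrite andbF.
by rewrite IHn /=; case: t; case: v; case: (odd n).
Qed.

Lemma Btgt_letter q n : Btgt (letter q n) = tgt_state (acts q (nseq n Ext)).
Proof.
by rewrite acts_nseq; case: q => v [] /=; rewrite /tgt_state /=;
  case: v; case: (odd n).
Qed.

Lemma Btgt_state b : nonidem b -> Btgt b = tgt_state (acts (bst b) (nseq (blen b) Ext)).
Proof. by move=> nb; rewrite -Btgt_letter -letter_bst. Qed.

Lemma ok_cons b s : ok (b :: s) = [&& nonidem b, (if s is c :: _ then Btgt b == Bsrc c else true) & ok s].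
Proof. by case: s => [|c s]; rewrite /ok /= ?andbT // -!andbA; do !bool_congr. Qed.

Lemma ok_cat s1 a b s2 : ok ((rcons s1 a) ++ b :: s2) = [&& ok (rcons s1 a), Btgt a == Bsrc b & ok (b :: s2)].
Proof.
elim: s1 => [|c s1 IHs1] /=.
  by rewrite ok_cons [ok [:: a]]ok_cons /= !andbT.
rewrite ok_cons IHs1 [ok (c :: rcons _ _)]ok_cons; case: s1 {IHs1} => [|d s1] /=;
  by rewrite -!andbA.
Qed.

Lemma ok_catl s1 s2 : ok (s1 ++ s2) -> ok s1.
Proof.
by case/andP; rewrite all_cat => /andP[a1 _] /cat_sorted2[st1 _]; rewrite /ok a1.
Qed.

Lemma ok_catr s1 s2 : ok (s1 ++ s2) -> ok s2.
Proof.
by case/andP; rewrite all_cat => /andP[_ a2] /cat_sorted2[_ st2]; rewrite /ok a2.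
Qed.

Lemma acts_wd b s : ok (b :: s) ->
  tgt_state (acts (bst b) (wd (b :: s))) = Btgt (last b s) /\
  (acts (bst b) (wd (b :: s))).2 = btype (last b s).
Proof.
elim: s b => [|c s IHs] b; rewrite ok_cons => /and3P[nb bc oks].
  by rewrite /= cats0 -Btgt_state // acts_nseq; case: b nb {bc}.
have [IH1 IH2] := IHs c oks.
rewrite [wd _]/= acts_cat [te _ _]/= -/(wd (c :: s)).
set q := acts (bst b) _.
have -> : acts q (junc (btype b) (btype c) :: wd (c :: s)) = acts (bst c) (wd (c :: s)).
  rewrite /acts /= -/acts; congr (foldl act _ _).
  rewrite /act -Btgt_state // (eqP bc) /bst; congr (_, _).
  by rewrite /q acts_nseq /junc /=; case: (btype b); case: (btype c).
by rewrite IH1 IH2.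
Qed.

(** * Disk sequences and the gap language *)

Definition quadw : word := [:: Ext; Alt; Alt; Alt; Ext].

Lemma cat_eq_cons (T : Type) (u v U V : seq T) x : u ++ v = U ++ x :: V ->
  (exists2 d, u = U ++ x :: d & V = d ++ v) \/ (exists2 c, U = u ++ c & v = c ++ x :: V).
Proof.
elim: u U => [|y u IHu] [|z U] //=.
- by move=> ->; right; exists [::].
- by move=> ->; right; exists (z :: U).
- by case=> -> <-; left; exists u.
by case=> -> /IHu[[d -> ->]|[c -> ->]]; [left; exists d | right; exists c].
Qed.

Lemma diskw_insert_aux u1 u2 u3 :
  (forall U V, u1 = U ++ Alt :: V -> gapw (U ++ quadw ++ V)) ->
  (forall U V, u2 = U ++ Alt :: V -> gapw (U ++ quadw ++ V)) ->
  (forall U V, u3 = U ++ Alt :: V -> gapw (U ++ quadw ++ V)) ->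
  gapw u1 -> gapw u2 -> gapw u3 ->
  forall U V, u1 ++ u2 ++ u3 = U ++ Alt :: V -> diskw (U ++ quadw ++ V).
Proof.
move=> I1 I2 I3 G1 G2 G3 U V e; have [[d e1 ->]|[c -> e']] := cat_eq_cons e; last first.
  have [[d e1 ->]|[c' -> e1]] := cat_eq_cons e'.
    have -> : (u1 ++ c) ++ quadw ++ d ++ u3 = u1 ++ (c ++ quadw ++ d) ++ u3.
      by rewrite -!catA.
    by constructor=> //; apply: I2.
  have -> : (u1 ++ u2 ++ c') ++ quadw ++ V = u1 ++ u2 ++ (c' ++ quadw ++ V).
    by rewrite -!catA.
  by constructor=> //; apply: I3.
have -> : U ++ quadw ++ d ++ u2 ++ u3 = (U ++ quadw ++ d) ++ u2 ++ u3 by rewrite -!catA.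
by constructor=> //; apply: I1.
Qed.

Lemma gap_disk h : diskw h -> gapw (Ext :: h ++ [:: Ext]).
Proof. by case=> u1 u2 u3; apply: gap_node. Qed.

(** Every [Alt] in a gap is a leaf of its tree, and [quadw] is the tree with one node; a leaf is
    replaced by a node. *)
Lemma gapw_insert w : gapw w -> forall U V, w = U ++ Alt :: V -> gapw (U ++ quadw ++ V).
Proof.
elim=> [|u1 u2 u3 G1 I1 G2 I2 G3 I3] [|a U] V //=.
- case=> <-; exact: (gap_node gap_leaf gap_leaf gap_leaf).
- by case: U.
case=> <- e0; have [[d e ->]|[c _]] := cat_eq_cons e0; last by case: c => [|? []].
have -> : U ++ quadw ++ d ++ [:: Ext] = (U ++ quadw ++ d) ++ [:: Ext] by rewrite -!catA.
by apply: gap_disk; apply: diskw_insert_aux e.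
Qed.

Lemma diskw_insert U V : diskw (U ++ Alt :: V) -> diskw (U ++ quadw ++ V).
Proof.
suff H w : diskw w -> w = U ++ Alt :: V -> diskw (U ++ quadw ++ V) by move=> /H; apply.
case=> u1 u2 u3 G1 G2 G3 e.
by apply: diskw_insert_aux e => // U' V'; apply: gapw_insert.
Qed.

Lemma nseq_shift (T : Type) n (x : T) s : x :: nseq n x ++ s = nseq n x ++ x :: s.
Proof. by elim: n => //= n ->. Qed.

Lemma nseq_rcons (T : Type) n (x : T) : nseq n.+1 x = nseq n x ++ [:: x].
Proof. by rewrite -addn1 nseqD. Qed.

(** A step lengthens [a] and [b] by one arrow each and puts two arrows between them, so the single
    junction [Alt] becomes [Ext, Alt, Alt, Alt, Ext] and the rest of the word is untouched. *)
Lemma disk_step_wd s1 s2 a b t : disk_step a b = Some t -> ok (s1 ++ a :: b :: s2) ->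
  ok (s1 ++ t ++ s2) /\
  exists U V, wd (s1 ++ a :: b :: s2) = U ++ Alt :: V /\ wd (s1 ++ t ++ s2) = U ++ quadw ++ V.
Proof.
move=> ab_t ok_s.
have [okt a_t] : ok (t ++ s2) /\ exists a' t', t = a' :: t' /\ Bsrc a' = Bsrc a.
  move: (ok_catr ok_s); rewrite !ok_cons.
  case: a b ab_t {ok_s} => [v|u k|v k] [v'|w l|w l] //=; case: ifP => // /eqP uw [<-];
    rewrite !ok_cons => /and3P[_ tb oks2]; (split; last by do 2!eexists).
    subst w; rewrite oks2 /= andbT; case: s2 tb {oks2} => [|c s2] /= tb; rewrite -?(eqP tb) ?andbT.
      by case: (u).
    by case: (u); case: (odd l).
  subst w; rewrite oks2 /= andbT; case: s2 tb {oks2} => [|c s2] /= tb; rewrite -?(eqP tb) ?andbT;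
    by case: (v); case: (odd k).
split.
  case: a_t okt => a' [t' [-> a'a]]; case/lastP: s1 ok_s => [|s1 x] //=.
  by rewrite !ok_cat a'a => /and3P[-> -> _] ->.
(* The letter [x] is the junction that [te false] puts in front; dropping it at the end returns to
   [wd]. *)
have : exists U V x, te false (s1 ++ a :: b :: s2) = x :: U ++ Alt :: V /\
         te false (s1 ++ t ++ s2) = x :: U ++ quadw ++ V.
  have [X [V [eX eX' nX]]] : exists X V, [/\ te false (s1 ++ a :: b :: s2) = X ++ Alt :: V,
         te false (s1 ++ t ++ s2) = X ++ quadw ++ V & X != [::]].
    exists (te false (s1 ++ [:: a])), (nseq (blen b) Ext ++ te (btype b) s2).
    rewrite !te_cat; split; last by case: (te false s1).
      by case: a b ab_t {ok_s a_t} => [v|u k|v k] [v'|w l|w l] //= _; rewrite -!catA /= -catA.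
    case: a b ab_t {ok_s a_t} => [v|u k|v k] [v'|w l|w l] //=; case: ifP => // _ [<-] /=;
      rewrite /junc /= !cats0 -!catA /=;
      by rewrite nseq_shift.
  by case: X nX eX eX' => // x U _ eX eX'; exists U, V, x.
by rewrite !(wd_te false) => -[U [V [x [-> ->]]]]; exists U, V.
Qed.

Lemma te_split t c X j Y : te t c = X ++ j :: Y -> j != Ext ->
  exists c1 b c2, [/\ c = c1 ++ b :: c2, te t c1 = X, j = junc (lt t c1) (btype b)
                    & Y = nseq (blen b) Ext ++ te (btype b) c2].
Proof.
move=> + nj; elim: c t X => [|b c IHc] t [|x X] //=.
  by case=> <- <-; exists [::], b, c.
case=> <- e0; have [[d e _]|[d -> /IHc[c1 [b' [c2 [-> <- -> ->]]]]]] := cat_eq_cons e0.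
  have : j \in nseq (blen b) Ext by rewrite e mem_cat inE eqxx orbT.
  by rewrite mem_nseq (negPf nj) andbF.
by exists (b :: c1), b', c2.
Qed.

Lemma te_rcons t s b : te t (rcons s b) = te t s ++ junc (lt t s) (btype b) :: nseq (blen b) Ext.
Proof. by rewrite -cats1 te_cat /= cats0. Qed.

Lemma disk_wd c : disk c -> ok c /\ diskw (wd c).
Proof.
elim=> {c} [i lti|s1 s2 a b t _ [okc Dc] abt].
  have D : diskw [:: Alt; Alt; Alt] by apply: (DiskWord gap_leaf gap_leaf gap_leaf).
  by case: i lti => [|[|[|[|]]]].
have [okt [U [V [e ->]]]] := disk_step_wd abt okc.
by split=> //; apply: diskw_insert; rewrite -e.
Qed.

(** A word forgets its first arrow; quantifying over all lists with this word lets the inductions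
    run on words alone. *)
Definition disk_word (w : word) : Prop := forall c, ok c -> wd c = w -> disk c.

Lemma junc_Alt t t' : Alt = junc t t' -> t' = ~~ t.
Proof. by rewrite /junc; case: eqP => // nt _; case: t t' nt => [] []. Qed.

Lemma count_te t s : count (predC1 Ext) (te t s) = size s.
Proof.
elim: s t => //= b s IHs t; rewrite count_cat IHs count_nseq /= mul0n add0n.
by rewrite /junc; case: ifP.
Qed.

Lemma count_wd s : count (predC1 Ext) (wd s) = (size s).-1.
Proof. by case: s => //= b s; rewrite count_cat count_te count_nseq. Qed.

Lemma disk_word_base : disk_word [:: Alt; Alt; Alt].
Proof.
move=> c okc wc; have := count_wd c; rewrite wc /=.
case: c okc wc => [|a [|b [|c [|d [|? ?]]]]] //.
rewrite !ok_cons => /and5P[na /eqP ab nb /eqP bc /and3P[nc /eqP cd /and3P[nd _ _]]] /=.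
case la: (blen a) => [|//]; case lb: (blen b) => [|] /=; last by rewrite /junc; case: ifP.
case lc: (blen c) => [|] /=; last by rewrite /junc; case: ifP.
case ld: (blen d) => [|] /=; last by rewrite /junc; case: ifP.
case=> /esym/junc_Alt tb /esym/junc_Alt tc /esym/junc_Alt td _.
(* The word leaves open the vertex and the type of the first entry; these four choices give the four
   rotations. *)
have D i : (i < 4)%N -> disk (rot i disk_base) := disk_E4 (i := i).
case: a na la ab tb => [//|[] ?|[] ?] _ /= -> ab tb;
 case: b nb lb ab tb bc tc => [//|? ?|? ?] _ /= -> <- // _ bc tc;
 case: c nc lc bc tc cd td => [//|? ?|? ?] _ /= -> <- // _ cd td;
 case: d nd ld cd td => [//|? ?|? ?] _ /= -> <- // _.
- exact: (D 1%N).
- exact: (D 3%N).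
- exact: (D 2%N).
exact: (D 0%N).
Qed.

Lemma disk_word_step u v : disk_word (u ++ Alt :: v) -> disk_word (u ++ quadw ++ v).
Proof.
move=> Dw c okc wc.
have [x ec] : exists x, te false c = (x :: u ++ [:: Ext]) ++ Alt :: (Alt :: Alt :: Ext :: v).
  case: c okc wc => [|b c] _; first by case: (u).
  by rewrite te_wd => ->; exists (junc false (btype b)); rewrite /= -catA.
have [c1 [b1 [c2 [e ec1 j1]]]] := te_split ec isT.
case l1: (blen b1) => [|//] /=; case: c2 e => [|b2 c3] //= e [j2].
case l2: (blen b2) => [|//] /=; case: c3 e => [|b3 c4] //= e [j3].
case l3: (blen b3) => [|l] /=; first by case: c4 {e} => [|? ?] //= [+ _]; rewrite /junc; case: ifP.
case=> ev; case/lastP: c1 ec1 e j1 => [|c0 b0] //; rewrite te_rcons.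
case l0: (blen b0) => [|k].
  rewrite !cats1 -rcons_cons => /rcons_inj[_]; by rewrite /junc; case: ifP.
rewrite nseq_rcons -cat_cons catA !cats1 -rcons_cons => /rcons_inj[ec0] e j1.
have lt1 : lt false (rcons c0 b0) = btype b0 by rewrite /lt map_rcons last_rcons.
move: (junc_Alt j1) (junc_Alt j2) (junc_Alt j3); rewrite lt1 => t1 t2 t3.
move: okc; rewrite e cat_rcons => okc.
have := ok_catr okc; rewrite !ok_cons.
case/and5P=> n0 /eqP v1 n1 /eqP v2 /and4P[n2 /eqP v3 n3 /andP[v4 okc4]].
(* The step is undone: [b0] and [b3] lose the arrow next to the removed pair. This may move the
   start of [b3], so [b] starts where [a] ends. *)
pose a := letter (bst b0) k; pose b := letter (Btgt a, btype b3) l.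
have [t [abt et vb]] : exists t, [/\ disk_step a b = Some t, t = [:: b0; b1; b2; b3] & Btgt b = Btgt b3].
  rewrite /b /a {a b v4 okc4 e j1 j2 j3 ec0 lt1 okc ev}.
  case: b0 n0 l0 v1 t1 => [//|? ?|? ?] _ /= -> v1 t1;
  case: b1 n1 l1 t1 v1 v2 t2 => [//|? ?|? ?] _ /= -> // _ v1 v2 t2;
  case: b2 n2 l2 t2 v2 v3 t3 => [//|? ?|? ?] _ /= -> // _ v2 v3 t3;
  case: b3 n3 l3 t3 v3 => [//|? ?|? ?] _ /= -> // _ v3;
  rewrite -v3 -v2 -v1 /= ?eqxx ?negbK; (eexists; split; [|reflexivity|]) => //.
  - by case: (odd l).
  - by case: (odd k); rewrite /= ?negbK ?eqxx.
  by case: (odd k); rewrite /= ?negbK.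
have ba : bst a = bst b0 by case: (letterK (bst b0) k).
have la : blen a = k by case: (letterK (bst b0) k) => _ [].
have na : nonidem a by case: (letterK (bst b0) k) => _ [].
have bb : btype b = btype b3 by rewrite btype_letter.
have lb : blen b = l by case: (letterK (Btgt a, btype b3) l) => _ [].
have nb : nonidem b by case: (letterK (Btgt a, btype b3) l) => _ [].
rewrite -[_ :: _ :: _ :: _ :: _]/([:: b0; b1; b2; b3] ++ c4) -et; apply: (disk_next _ abt); apply: Dw.
  have ok4 : ok (a :: b :: c4) by rewrite !ok_cons na nb vb v4 okc4 Bsrc_letter eqxx.
  case/lastP: c0 {e lt1 j1 ec0} okc => [|c0 y] //; rewrite !ok_cat => /and3P[-> + _].
  by case: ba => -> _ ->.
have ta : btype a = btype b0 by case: ba.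
rewrite (wd_te false) te_cat /= la lb ta bb ev t3 t2 t1 negbK.
have -> : junc (btype b0) (~~ btype b0) = Alt by rewrite /junc; case: (btype b0).
by rewrite -cat_cons catA ec0.
Qed.

(** The tree is grown from its root: [Alt] first becomes a single quadrilateral, whose three inner
    [Alt] are then replaced by the subtrees from left to right. *)
Lemma disk_word_gap g : gapw g -> forall u v, disk_word (u ++ Alt :: v) -> disk_word (u ++ g ++ v).
Proof.
elim=> {g} [|u1 u2 u3 _ I1 _ I2 _ I3] u v Dw //.
have D1 := disk_word_step Dw.
have {}D1 : disk_word ((u ++ [:: Ext]) ++ u1 ++ [:: Alt; Alt; Ext] ++ v).
  by apply: I1; rewrite -?catA.
have {}D1 : disk_word ((u ++ [:: Ext] ++ u1) ++ u2 ++ [:: Alt; Ext] ++ v).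
  by apply: I2; move: D1; rewrite -?catA.
have : disk_word ((u ++ [:: Ext] ++ u1 ++ u2) ++ u3 ++ [:: Ext] ++ v).
  by apply: I3; move: D1; rewrite -?catA.
by rewrite -?catA /= -?catA.
Qed.

Lemma wd_disk c : ok c -> diskw (wd c) -> disk c.
Proof.
move=> okc Dc; suff H w : diskw w -> disk_word w by apply: (H _ Dc).
case=> u1 u2 u3 G1 G2 G3.
have D1 : disk_word ([::] ++ u1 ++ [:: Alt; Alt]) by apply: disk_word_gap => //; apply: disk_word_base.
have D2 : disk_word (u1 ++ u2 ++ [:: Alt]) by apply: disk_word_gap.
have : disk_word ((u1 ++ u2) ++ u3 ++ [::]) by apply: disk_word_gap; rewrite -?catA.
by rewrite cats0 -catA.
Qed.

(** * The products of B^oo on basis elements *)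

(* Counts elementary arrows with signs: [s] is the sign of the type of the
   arrow before the word. *)
Fixpoint signed_count (s : int) (w : word) : int :=
  if w is a :: w' then
    let s' := if a is Alt then - s else s in s' + signed_count s' w'
  else 0.

Fixpoint last_sign (s : int) (w : word) : int :=
  if w is a :: w' then last_sign (if a is Alt then - s else s) w' else s.

Lemma signed_count_cat s u v :
  signed_count s (u ++ v) = signed_count s u + signed_count (last_sign s u) v.
Proof. by elim: u s => [|a u IHu] s /=; rewrite ?add0r // IHu addrA. Qed.

Lemma last_sign_cat s u v : last_sign s (u ++ v) = last_sign (last_sign s u) v.
Proof. by elim: u s => //=. Qed.

Lemma signed_count_nseq s n : signed_count s (nseq n Ext) = s *+ n /\ last_sign s (nseq n Ext) = s.
Proof. by elim: n => //= n [-> ->]; rewrite mulrS. Qed.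

Lemma signed_count_gapw w s : gapw w -> signed_count s w = - s /\ last_sign s w = - s.
Proof.
move=> Gw; elim: Gw s => [|u1 u2 u3 _ I1 _ I2 _ I3] s /=; first by rewrite addr0.
rewrite !signed_count_cat !last_sign_cat /=.
have [-> ->] := I1 s; have [-> ->] := I2 (- s); have [-> ->] := I3 (- - s).
by split; lia.
Qed.

Lemma signed_count_diskw w s : diskw w -> signed_count s w = - s /\ last_sign s w = - s.
Proof.
case=> u1 u2 u3 G1 G2 G3; rewrite !signed_count_cat !last_sign_cat.
have [-> ->] := signed_count_gapw s G1; have [-> ->] := signed_count_gapw (- s) G2.
by have [-> ->] := signed_count_gapw (- - s) G3; split; lia.
Qed.

(** Words with a nonzero higher product. A factor [b] with length code [k] has [k.+1] arrows and
    adds as many [Ext] at one end of a disk; an idempotent factor adds none. *)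
Definition lang (w : word) : Prop :=
  exists2 h, diskw h & [\/ w = h, exists k, w = nseq k.+1 Ext ++ h | exists k, w = h ++ nseq k.+1 Ext].

(** The three forms of a word in [lang] have signed counts [k], [-(k+2)] and [-1]. The count
    therefore tells the form and [k], and the value of a higher product is unique. *)
Lemma signed_count_prefix k h : diskw h -> signed_count 1 (nseq k.+1 Ext ++ h) = Posz k.
Proof.
move=> Dh; rewrite signed_count_cat; have [-> ->] := signed_count_nseq 1 k.+1.
by have [-> _] := signed_count_diskw 1 Dh; lia.
Qed.

Lemma signed_count_suffix k h : diskw h -> signed_count 1 (h ++ nseq k.+1 Ext) = Negz k.+1.
Proof.
move=> Dh; rewrite signed_count_cat; have [-> ->] := signed_count_diskw 1 Dh.
by have [-> _] := signed_count_nseq (-1) k.+1; lia.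
Qed.

Lemma signed_count_disk h : diskw h -> signed_count 1 h = Negz 0.
Proof. by move=> /(signed_count_diskw 1)[]. Qed.

(* The only candidate for the value of a higher product. *)
Definition bof (c : seq Bbasis) : Bbasis :=
  let q := if c is b :: _ then bst b else (false, false) in
  match signed_count 1 (wd c) with
  | Posz k => letter q k
  | Negz 0 => Be q.1
  | Negz k.+1 => letter (q.1, ~~ q.2) k
  end.

Lemma disk_ends b s : ok (b :: s) -> diskw (wd (b :: s)) ->
  Btgt (last b s) = Bsrc b /\ btype (last b s) = ~~ btype b.
Proof.
move=> okbs Dw; have [<- <-] := acts_wd okbs; rewrite (acts_diskw _ Dw).
by rewrite /bst; case: (Bsrc b); case: (btype b).
Qed.

Lemma BmulP a b p : nonidem a -> nonidem b ->
  Bmul a b = Some p <-> [/\ Btgt a = Bsrc b, btype a = btype b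
                          & p = letter (bst a) (blen a + blen b).+1].
Proof.
rewrite /Bmul; case: a => [//|v n|v n] _; case: b => [//|u m|u m] _;
  case: eqP => [e|ne] /=; split=> // -[] //; by [move<- | move=> _ _ ->].
Qed.

Lemma diskw_count h : diskw h -> (3 <= count (predC1 Ext) h)%N.
Proof.
have cg w : gapw w -> (0 < count (predC1 Ext) w)%N.
  by move/gapw_Alt => A; rewrite -has_count; apply/hasP; exists Alt.
case=> u1 u2 u3 /cg G1 /cg G2 /cg G3; rewrite !count_cat.
by rewrite (@leq_add 1 2) // (@leq_add 1 1).
Qed.

Lemma lang_size c : lang (wd c) -> (3 < size c)%N.
Proof.
have H : (3 <= count (predC1 Ext) (wd c))%N -> (3 < size c)%N.
  by rewrite count_wd; case: (size c).
case=> h /diskw_count lh [e|[k e]|[k e]]; apply: H; rewrite e //;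
  by rewrite count_cat count_nseq /= ?add0n ?addn0.
Qed.

Lemma wd_rcons_ext s a b n : bst a = bst b -> blen b = (blen a + n)%N ->
  wd (rcons s b) = wd (rcons s a) ++ nseq n Ext.
Proof.
move=> [_ tab] lab; rewrite !(wd_te false) !te_rcons tab lab nseqD.
by case: (te false s) => [|x w] /=; rewrite ?catA // -catA.
Qed.

Lemma ok_rcons s a b : bst a = bst b -> nonidem b -> ok (rcons s a) -> ok (rcons s b).
Proof.
move=> [sab _] nb; case/lastP: s => [|s x]; first by rewrite !ok_cons nb.
by rewrite -[rcons _ a]cats1 -[rcons _ b]cats1 !ok_cat sab !ok_cons nb => /and3P[-> -> _].
Qed.

Lemma higher_rel_bof c b : higher_rel c b -> [/\ ok c, lang (wd c) & b = bof c].
Proof.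
(* The case of an idempotent factor, common to both alternatives of the relation: the list is then
   the disk sequence itself. *)
have whole a s v : disk (a :: s) -> v = Bsrc a ->
    [/\ ok (a :: s), lang (wd (a :: s)) & Be v = bof (a :: s)].
  move=> /disk_wd[oks Ds] ->; split=> //; first by exists (wd (a :: s)) => //; constructor.
  by rewrite /bof signed_count_disk.
case=> [[a [al [p [D [albp ->]]]]]|[a1 [a [p [D [ba1p ->]]]]]].
  have [oks Ds] := disk_wd D.
  have [x [a' ea]] : exists x a', a = x :: a'.
    case: a {D oks albp} Ds => [/diskw_count|x a' _]; last by exists x, a'.
    by rewrite count_wd.
  have [ends1 ends2] : Btgt al = Bsrc x /\ btype al = ~~ btype x.
    by move: oks Ds; rewrite ea => /= oks /(disk_ends oks); rewrite last_rcons.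
  have nal : nonidem al by have /andP[] := oks; rewrite all_rcons => /andP[].
  case nb : (nonidem b); last first.
    case: b nb albp => // v _ albp.
    have [<- ev] : al = p /\ Btgt al = v.
      by move: albp; rewrite /Bmul; case: eqP => //; case: (al) nal => //= ? ? _ e [<-].
    by rewrite ea rcons_cons; apply: whole; [rewrite -rcons_cons -ea | rewrite -ev].
  move/(BmulP _ nal nb): albp => [ab tab ep]; rewrite {}ep {p}.
  set p := letter _ _; have [bp [lp np]] := letterK (bst al) (blen al + blen b).+1.
  have wp : wd (rcons a p) = wd (rcons a al) ++ nseq (blen b).+1 Ext.
    by apply: wd_rcons_ext; rewrite ?bp ?lp ?addnS.
  split; first by apply: (@ok_rcons a al).
    by rewrite wp; exists (wd (rcons a al)) => //; constructor; exists (blen b).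
  rewrite /bof wp signed_count_suffix // ea /=.
  by rewrite -[X in (X, _)]ends1 -ends2 ab tab -/(bst b) -letter_bst.
have [oks Ds] := disk_wd D.
have na1 : nonidem a1 by have /andP[/andP[]] := oks.
case nb : (nonidem b); last first.
  case: b nb ba1p => // v _; rewrite /Bmul; case: eqP => //= e [<-].
  exact: whole.
move/(BmulP _ nb na1): ba1p => [ab tab ep]; rewrite {}ep {p}.
set p := letter _ _; have [bp [lp np]] := letterK (bst b) (blen b + blen a1).+1; have [bp1 bp2] := bp.
have wp : wd (p :: a) = nseq (blen b).+1 Ext ++ wd (a1 :: a).
  by rewrite /= lp bp2 tab -addSn nseqD -catA.
split; last by rewrite /bof wp signed_count_prefix // bp -letter_bst.
  move: oks; rewrite !ok_cons np na1 => /and3P[_ + ->]; rewrite andbT.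
  suff -> : Btgt p = Btgt a1 by [].
  rewrite (Btgt_state np) (Btgt_state na1) lp -addSn nseqD acts_cat.
  congr (tgt_state (acts _ _)); rewrite nseq_rcons acts_cat /= /bst bp1 bp2 -/(bst b).
  by rewrite /act -(Btgt_state nb) ab acts_nseq /= tab.
by exists (wd (a1 :: a)) => //; constructor 2; exists (blen b).
Qed.

Lemma nseq_te_prefix n m t a h : nseq n Ext ++ te t a = nseq m Ext ++ h ->
  (m <= n)%N /\ h = nseq (n - m) Ext ++ te t a.
Proof.
elim: m n => [|m IHm] [|n] //=.
- by case: a {IHm} => //= b a []; rewrite /junc; case: ifP.
by case=> /IHm[].
Qed.

Lemma nseq_te_suffix n m X j Y : j != Ext -> X ++ j :: nseq n Ext = Y ++ nseq m Ext ->
  (m <= n)%N /\ Y = X ++ j :: nseq (n - m) Ext.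
Proof.
move=> nj; elim: m n => [|m IHm] n; first by rewrite cats0 subn0 => <-.
case: n => [|n]; rewrite (nseq_rcons m) catA cats1.
  by rewrite cats1 => /rcons_inj[_ ej]; rewrite ej in nj.
by rewrite (nseq_rcons n) -cat_cons catA cats1 => /rcons_inj[/IHm].
Qed.

(** A run at an end of the word cannot cross a junction, so it lies inside the first or last entry.
    Cutting it off factors that entry, and at least one arrow remains for the disk sequence. *)
Lemma lang_higher_rel c : ok c -> lang (wd c) -> exists b, higher_rel c b.
Proof.
move=> okc Lc; have := lang_size Lc; case: Lc => h Dh Lc.
case: Lc => [e|[k e]|[k e]] sz.
- case: c okc e sz => // a1 a okc e _; exists (Be (Bsrc a1)); right.
  exists a1, a, a1; split; first by apply: wd_disk; rewrite ?e.
  by rewrite /Bmul /= eqxx.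
- case: c okc e sz => // p a okc /nseq_te_prefix[lekp eh] _.
  have [np pa oka] : [/\ nonidem p, is_true (if a is x :: _ then Btgt p == Bsrc x else true) & ok a].
    by move: okc; rewrite ok_cons => /and3P[].
  pose b := letter (bst p) k.
  have [bb [lb nb]] := letterK (bst p) k; rewrite -/b in bb lb nb.
  pose a1 := letter (Btgt b, btype p) (blen p - k.+1).
  have [ba1 [la1 na1]] := letterK (Btgt b, btype p) (blen p - k.+1).
  rewrite -/a1 in ba1 la1 na1.
  have Bba : Bmul b a1 = Some p.
    apply/(BmulP _ nb na1); split; first by rewrite Bsrc_letter.
      by rewrite !btype_letter.
    by rewrite bb lb la1 -addSn subnKC // -letter_bst.
  have Ba1p : Btgt a1 = Btgt p.
    rewrite (Btgt_state na1) (Btgt_state np) ba1 la1 -{2}(subnKC lekp) nseqD acts_cat.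
    congr (tgt_state (acts _ _)); rewrite (Btgt_state nb) bb lb nseq_rcons acts_cat /= /act /=.
    by rewrite acts_nseq.
  exists b; right; exists a1, a, p; split=> //; apply: wd_disk.
    by rewrite ok_cons na1 Ba1p pa.
  by rewrite /= la1 btype_letter -eh.
case/lastP: c okc e sz => // a p okc e _.
have np : nonidem p by have /andP[] := okc; rewrite all_rcons => /andP[].
have [x ex] : exists x, te false (rcons a p) = (x :: h) ++ nseq k.+1 Ext.
  by case: (rcons a p) e => [|y s]; [case: (h) | rewrite te_wd => ->; exists (junc false (btype y))].
have nj : junc (lt false a) (btype p) != Ext by rewrite /junc; case: ifP.
rewrite te_rcons in ex; have [lekp eh] := nseq_te_suffix nj ex.
pose al := letter (bst p) (blen p - k.+1).
have [bal [lal nal]] := letterK (bst p) (blen p - k.+1); rewrite -/al in bal lal nal.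
pose b := letter (Btgt al, btype p) k.
have [bb [lb nb]] := letterK (Btgt al, btype p) k; rewrite -/b in bb lb nb.
exists b; left; exists a, al, p; split; last split=> //.
  apply: wd_disk; first by apply: ok_rcons okc.
  by rewrite (wd_te false) te_rcons btype_letter lal -eh.
apply/(BmulP _ nal nb); split; first by rewrite Bsrc_letter.
  by rewrite !btype_letter.
by rewrite bal lb lal addnC -addSn subnKC // -letter_bst.
Qed.

Definition muo (c : seq Bbasis) : option Bbasis :=
  if c is [:: a; b] then Bmul a b else
  if excluded_middle_informative (ok c /\ lang (wd c)) then Some (bof c) else None.

Lemma muB_basisE c : muB_basis c = oapp (fun b => << b >> : Bv) 0 (muo c).
Proof.
have small : (size c <= 3)%N -> ~ lang (wd c) by move=> + /lang_size; rewrite ltnNge => ->.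
case: c small => [|a [|b [|d c]]] small /=.
- by rewrite /muo; case: excluded_middle_informative => [[okc Lc]|] //; case: (small isT Lc).
- by rewrite /muo; case: excluded_middle_informative => [[okc Lc]|] //; case: (small isT Lc).
- by case: Bmul.
rewrite /higher_basis /muo; case: excluded_middle_informative => [H|nH].
  case: constructive_indefinite_description => b' /= /higher_rel_bof[okc Lc ->].
  by case: excluded_middle_informative => // nok; case: nok.
case: excluded_middle_informative => // -[okc Lc].
by case: nH; apply: lang_higher_rel.
Qed.

(** * Sums over windows *)

Definition run (x : word) : bool := (x != [::]) && all (pred1 Ext) x.

(** Recognizes the cuts of a word that come from cuts of the list, the final cut included. *)
Definition bd (y : word) : bool := if y is Ext :: _ then false else true.

(** Changing the type of the element on one side of a junction exchanges [Alt] and [Rep] there.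
    Letters are relative, so no other letter changes. *)
Definition flip_sym (a : sym) : sym :=
  match a with Ext => Ext | Alt => Rep | Rep => Alt end.

Definition flip (y : word) : word := if y is a :: y' then flip_sym a :: y' else [::].

Lemma runP x : reflect (exists k, x = nseq k.+1 Ext) (run x).
Proof.
apply: (iffP andP) => [[nx /all_pred1P ex]|[k ->]].
  by exists (size x).-1; case: x nx ex => // a x _ {1}->.
by split=> //; apply/all_pred1P; rewrite size_nseq.
Qed.

Lemma bd_te t s : bd (te t s).
Proof. by case: s => //= b s; rewrite /junc; case: ifP. Qed.

Section Windows.
Variable R : pzRingType.
Implicit Types (p : word -> R) (x y w h : word) (s u v m : seq Bbasis) (t : bool).

Lemma ssum_nseq_bd n w (Phi : word -> word -> R) :
  ssum (nseq n Ext ++ w) (fun x y => if bd y then Phi x y else 0) =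
  ssum w (fun x y => if bd y then Phi (nseq n Ext ++ x) y else 0).
Proof.
elim: n Phi => [//|n IHn] Phi /=; rewrite IHn add0r //.
Qed.

Lemma ssum_te_bd t s (Phi : word -> word -> R) :
  ssum (te t s) (fun x y => if bd y then Phi x y else 0) =
  ssum s (fun u v => Phi (te t u) (te (lt t u) v)).
Proof.
elim: s t Phi => [//|b s IHs] t Phi /=.
have -> : (if junc t (btype b) is Ext then false else true) = true by rewrite /junc; case: ifP.
by rewrite (ssum_nseq_bd _ _ (fun x y => Phi (_ :: x) y)) IHs.
Qed.

Lemma ssum_wd_bd b s (Phi : word -> word -> R) :
  ssum (wd (b :: s)) (fun x y => if bd y then Phi x y else 0) =
  ssum s (fun u v => Phi (wd (b :: u)) (te (lt (btype b) u) v)).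
Proof. by rewrite /= ssum_nseq_bd (ssum_te_bd _ _ (fun x y => Phi (_ ++ x) y)). Qed.

(** [K1] and [K2] express the two families of products as sums over cuts, which can be interchanged
    with the sum over windows. At most one cut contributes: by the signed count for [K1], by
    prefix-freeness for [K2]. *)
Definition K1 w (X : nat -> R) : R :=
  ssum w (fun x h => if run x then ind R diskw h * X (size x).-1 else 0).

Definition K2 w (X : nat -> R) : R :=
  ssum w (fun h x => if run x then ind R diskw h * X (size x).-1 else 0).

Lemma K1_prefix k h X : diskw h -> K1 (nseq k.+1 Ext ++ h) X = X k.
Proof.
move=> Dh; rewrite /K1 (ssum_unique (u0 := nseq k.+1 Ext) (v0 := h)) //.
  have -> : run (nseq k.+1 Ext) by apply/runP; exists k.
  by rewrite ind1 // mul1r size_nseq.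
move=> x h' e nx; case: runP => // -[k' ex]; case: (indP R diskw h') => [[Dh' _]|[_ ->]]; last by rewrite mul0r.
case: nx; have := signed_count_prefix k' Dh'; rewrite -ex e signed_count_prefix // => -[ekk].
by rewrite ex ekk.
Qed.

Lemma K2_suffix k h X : diskw h -> K2 (h ++ nseq k.+1 Ext) X = X k.
Proof.
move=> Dh; rewrite /K2 (ssum_unique (u0 := h) (v0 := nseq k.+1 Ext)) //.
  have -> : run (nseq k.+1 Ext) by apply/runP; exists k.
  by rewrite ind1 // mul1r size_nseq.
move=> h' x e nx; case: runP => // -[k' ex]; case: (indP R diskw h') => [[Dh' _]|[_ ->]]; last by rewrite mul0r.
by case: nx; have [] := diskw_prefix_free Dh' Dh e.
Qed.

Lemma K1_0 w X : (forall k h, diskw h -> w <> nseq k.+1 Ext ++ h) -> K1 w X = 0.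
Proof.
move=> nw; apply: ssum0 => x h e; case: runP => // -[k ex].
case: (indP R diskw h) => [[Dh _]|[_ ->]]; last by rewrite mul0r.
by case: (nw k h Dh); rewrite -ex e.
Qed.

Lemma K2_0 w X : (forall k h, diskw h -> w <> h ++ nseq k.+1 Ext) -> K2 w X = 0.
Proof.
move=> nw; apply: ssum0 => h x e; case: runP => // -[k ex].
case: (indP R diskw h) => [[Dh _]|[_ ->]]; last by rewrite mul0r.
by case: (nw k h Dh); rewrite -ex e.
Qed.

Lemma K_sum w X Y (z : R) :
  K1 w X + K2 w Y + ind R diskw w * z =
  if excluded_middle_informative (lang w) then
    match signed_count 1 w with Posz k => X k | Negz 0 => z | Negz k.+1 => Y k end
  else 0.
Proof.
case: excluded_middle_informative => [L|nL] /=; first case: L => h Dh [e|[k e]|[k e]].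
- have sc := signed_count_disk Dh; rewrite e sc K1_0 => [|k h' Dh' e'].
    rewrite K2_0 ?add0r => [|k h' Dh' e']; first by rewrite ind1 ?mul1r.
    by move: sc; rewrite e' signed_count_suffix.
  by move: sc; rewrite e' signed_count_prefix.
- have sc := signed_count_prefix k Dh; rewrite e sc K1_prefix // K2_0 => [|k' h' Dh' e'].
    rewrite ind0 ?mul0r ?addr0 // => Dw; by move: (signed_count_disk Dw); rewrite sc.
  by move: sc; rewrite e' signed_count_suffix.
- have sc := signed_count_suffix k Dh; rewrite e sc K2_suffix // K1_0 => [|k' h' Dh' e'].
    rewrite ind0 ?mul0r ?add0r ?addr0 // => Dw; by move: (signed_count_disk Dw); rewrite sc.
  by move: sc; rewrite e' signed_count_prefix.
rewrite K1_0 => [|k h Dh e]; last by apply: nL; exists h => //; constructor 2; exists k.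
rewrite K2_0 => [|k h Dh e]; last by apply: nL; exists h => //; constructor 3; exists k.
by rewrite ind0 ?mul0r ?addr0 // => Dw; apply: nL; exists w => //; constructor.
Qed.

Definition join_sum m (g : Bbasis -> R) : R :=
  if m is [:: a; c] then
    if btype a == btype c then g (letter (bst a) (blen a + blen c).+1) else 0
  else 0.

Lemma muo_sum b m (g : Bbasis -> R) : ok (b :: m) ->
  oapp g 0 (muo (b :: m)) =
  join_sum (b :: m) g + K1 (wd (b :: m)) (fun k => g (letter (bst b) k)) +
  K2 (wd (b :: m)) (fun k => g (letter (Bsrc b, ~~ btype b) k)) +
  ind R diskw (wd (b :: m)) * g (Be (Bsrc b)).
Proof.
move=> okm; rewrite -!addrA (addrA (K1 _ _)) K_sum.
case: m okm => [|c [|d m]] okm.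
- case: excluded_middle_informative => [/lang_size //|nL]; rewrite addr0 /muo.
  by case: excluded_middle_informative => [[_ Lm]|] //; have := lang_size Lm.
- case: excluded_middle_informative => [/lang_size //|nL]; rewrite addr0 /=.
  move: okm; rewrite !ok_cons => /and5P[nb bc nc _ _].
  case: eqP => [tbc|ntbc].
    suff -> : Bmul b c = Some (letter (bst b) (blen b + blen c).+1) by [].
    by apply/BmulP => //; split=> //; apply/eqP.
  by case e : Bmul => [q|] //; have [] := (BmulP q nb nc).1 e.
rewrite /= add0r /muo; case: excluded_middle_informative => [L1|nL] /=;
    case: excluded_middle_informative => //= L; [|by case: L1 | by case: nL].
rewrite /= /bof -/(wd (b :: c :: d :: m)).
by case: signed_count => [k|[|k]].
Qed.

Definition bsum1 a p w : R :=
  ssum w (fun x z => ssum z (fun w0 y => ind R (delw a) w0 * p (x ++ a :: y))).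

Definition end_sum p w : R :=
  ssum w (fun x z => if z is Ext :: h then ind R diskw h * p x else 0).

Definition Wmerge p t s : R :=
  ssum s (fun u z => ssum z (fun m v => join_sum m (fun b => p (te t (u ++ b :: v))))).

Definition W1 p t s : R :=
  ssum s (fun u z => ssum z (fun m v =>
    if m is b :: _ then K1 (wd m) (fun k => p (te t (u ++ letter (bst b) k :: v))) else 0)).

Definition W2 p t s : R :=
  ssum s (fun u z => ssum z (fun m v =>
    if m is b :: _ then K2 (wd m) (fun k => p (te t (u ++ letter (Bsrc b, ~~ btype b) k :: v))) else 0)).

Lemma te_letter t q k v : te t (letter q k :: v) = junc t q.2 :: nseq k Ext ++ te q.2 v.
Proof. by have [bl [ll _]] := letterK q k; rewrite /= btype_letter ll. Qed.

Lemma delExt_sum z (Phi : word -> R) :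
  ssum z (fun w0 y => ind R (delw Ext) w0 * Phi y) = if z is Rep :: y then Phi y else 0.
Proof.
case: z => [|c z] /=; first by rewrite ind0 ?mul0r // => D; inversion D.
rewrite ind0 ?mul0r ?add0r => [|D]; last by inversion D.
rewrite ssum_nil => [|x w0 y]; last by rewrite ind0 ?mul0r // => D; inversion D.
case: c; last by rewrite ind1 ?mul1r //; constructor.
all: by rewrite ind0 ?mul0r // => D; inversion D.
Qed.

Lemma bsum1_Ext p w :
  bsum1 Ext p w = ssum w (fun x z => if z is Rep :: y then p (x ++ Ext :: y) else 0).
Proof. by apply: eq_ssum => x z; rewrite delExt_sum. Qed.

Lemma ssum_nseq_nd n w (Phi : word -> word -> R) :
  (forall x y, Phi x (Ext :: y) = 0) ->
  ssum (nseq n Ext ++ w) Phi = ssum w (fun x y => Phi (nseq n Ext ++ x) y).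
Proof. by elim: n Phi => [//|n IHn] Phi Phi0 /=; rewrite Phi0 add0r IHn. Qed.

(** The extra term belongs to a [Rep] between the virtual element of type [t] and the head of the
    list, a junction that no window contains. *)
Lemma Wmerge_bsum p t s :
  Wmerge p t s + (if s is b :: s' then
     if btype b == t then p (Ext :: nseq (blen b) Ext ++ te (btype b) s') else 0 else 0) =
  bsum1 Ext p (te t s).
Proof.
rewrite bsum1_Ext; elim: s p t => [|b s IHs] p t /=; first by rewrite addr0.
rewrite (ssum_nseq_nd _ _ (Phi := fun x z => if z is Rep :: y then p (_ :: x ++ Ext :: y) else 0)) //=.
pose p' x := p (junc t (btype b) :: nseq (blen b) Ext ++ x).
rewrite [X in _ = _ + X](@eq_ssum _ _ _ _ (fun x z => if z is Rep :: y then p' (x ++ Ext :: y) else 0));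
  last by move=> x [|[] y] //; rewrite /p' -catA.
rewrite -IHs addrC.
rewrite {1}/Wmerge /= add0r; congr (_ + _).
  by rewrite /junc eq_sym; case: eqP.
rewrite addrC; congr (_ + _); first last.
  case: s {IHs} => [|c s] //=; rewrite add0r ssum_nil //.
  have [_ [-> _]] := letterK (bst b) (blen b + blen c).+1.
  rewrite btype_letter eq_sym /=; case: eqP => // ->; congr p; congr (_ :: _).
  by rewrite nseqD -catA nseq_shift.
Qed.

Lemma last_sign_te (z : int) t s : last_sign z (te t s) = if lt t s == t then z else - z.
Proof.
elim: s z t => [|b s IHs] z t /=; first by rewrite eqxx.
rewrite last_sign_cat; have [_ ->] := signed_count_nseq (if junc t (btype b) is Alt then - z else z) (blen b).
rewrite IHs /junc {IHs}; rewrite -[lt t (b :: s)]/(lt (btype b) s).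
by case: t; case: (btype b); case: lt => //=; rewrite ?opprK.
Qed.

Lemma lt_disk b s k h : wd (b :: s) = nseq k Ext ++ h -> diskw h ->
  lt (btype b) s = ~~ btype b.
Proof.
move=> e Dh; have := congr1 (last_sign 1) e; rewrite !last_sign_cat.
have [_ ->] := signed_count_nseq 1 (blen b); have [_ ->] := signed_count_nseq 1 k.
have [_ ->] := signed_count_diskw 1 Dh; rewrite last_sign_te.
by case: eqP => //; case: lt; case: (btype b).
Qed.

Lemma flip_te t s : flip (te t s) = te (~~ t) s.
Proof. by case: s => //= b s; rewrite /junc; case: t; case: (btype b). Qed.

(** An [Ext] of the initial run is encoded by the nonempty run [x] that ends with it, hence the
    predecessor of [size x]; any other [Ext] lies in [w]. *)
Lemma ssum_nseq_Ext n w (Psi : word -> word -> R) : bd w ->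
  ssum (nseq n Ext ++ w) (fun x z => if z is Ext :: z' then Psi x z' else 0) =
  ssum (nseq n Ext ++ w) (fun x z => if run x then Psi (nseq (size x).-1 Ext) z else 0) +
  ssum w (fun x z => if z is Ext :: z' then Psi (nseq n Ext ++ x) z' else 0).
Proof.
move=> bw; elim: n Psi => [|n IHn] Psi /=.
  rewrite [X in X + _]ssum0 ?add0r // => x z e; case: runP => // -[k ex].
  by move: bw; rewrite -e ex.
rewrite IHn add0r addrA; congr (_ + _).
rewrite [RHS](@eq_ssum _ _ _ _ (fun x z =>
   (if x is [::] then Psi [::] z else 0) + (if run x then Psi (Ext :: nseq (size x).-1 Ext) z else 0))).
  by rewrite ssumD [X in _ = X + _]ssum_nil.
by case=> [|a x] z; rewrite /run /= ?addr0 ?add0r //; case: a => /=; case: all.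
Qed.

(** The effect of a product of the form [(b a1, ...)]: [Ext :: h] is deleted and [b] remains. The
    last entry of the window had the opposite type, so the next junction is flipped. *)
Definition rhs1 p w : R :=
  ssum w (fun x z => if z is Ext :: z' then
     ssum z' (fun h y => ind R diskw h * (if bd y then p (x ++ flip y) else 0)) else 0).

Lemma W1_rhs p t s : W1 p t s = rhs1 p (te t s).
Proof.
elim: s p t => [|b s IHs] p t //=.
rewrite /W1 /= add0r -/(W1 _ _ _) /rhs1 [RHS]/= [X in _ = X + _](_ : _ = 0); last first.
  by rewrite /junc; case: ifP.
rewrite add0r (@ssum_nseq_Ext (blen b) (te (btype b) s) (fun x z' =>
     ssum z' (fun h y => ind R diskw h * (if bd y then p (junc t (btype b) :: x ++ flip y) else 0)))) ?bd_te //.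
congr (_ + _); last first.
  rewrite -[LHS]/(W1 (fun x => p (junc t (btype b) :: nseq (blen b) Ext ++ x)) (btype b) s) IHs.
  by apply: eq_ssum => x [|[] z] //; apply: eq_ssum => h y; rewrite -!catA.
transitivity (ssum (wd (b :: s)) (fun w y => if bd y then
   K1 w (fun k => p (junc t (btype b) :: nseq k Ext ++ flip y)) else 0)).
  rewrite ssum_wd_bd; apply: eq_ssum => u v; rewrite -/(wd (b :: u)).
  apply: eq_ssum_cat => x h e; case: runP => // -[k ex].
  case: (indP R diskw h) => [[Dh _]|[_ ->]]; last by rewrite !mul0r.
  rewrite -/(te t (letter (bst b) (size x).-1 :: v)) te_letter flip_te.
  by rewrite (@lt_disk b u k.+1 h) ?negbK // -ex.
transitivity (ssum (wd (b :: s)) (fun y' y => ssum y' (fun x h => if bd y then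
   if run x then ind R diskw h * p (junc t (btype b) :: nseq (size x).-1 Ext ++ flip y) else 0 else 0))).
  by apply: eq_ssum => w y; case: bd => //; rewrite ssum0.
rewrite -ssum_assoc; apply: eq_ssum => x z; case: run => //; last first.
  by apply: ssum0 => h y _; case: bd.
by apply: eq_ssum => h y; case: bd => //; rewrite mulr0.
Qed.

(** The effect of a product of the form [(..., a b)]: the disk [h] is deleted, the first [Ext]
    behind it turns into the first arrow of [b], and [b] has the type opposite to the first entry,
    so the junction [a] in front is flipped. *)
Definition rhs2 p w : R :=
  ssum w (fun x z => if z is a :: z' then if a is Ext then 0 else
     ssum z' (fun h y => ind R diskw h *
       (if y is Ext :: y' then p (x ++ flip_sym a :: y') else 0)) else 0).

Lemma lt_disk_suffix b s k h : wd (b :: s) = h ++ nseq k Ext -> diskw h ->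
  lt (btype b) s = ~~ btype b.
Proof.
move=> e Dh; have := congr1 (last_sign 1) e; rewrite !last_sign_cat.
have [_ ->] := signed_count_nseq 1 (blen b); have [_ ->] := signed_count_diskw 1 Dh.
have [_ ->] := signed_count_nseq (-1) k; rewrite last_sign_te.
by case: eqP => //; case: lt; case: (btype b).
Qed.

Lemma ssum_strip_run z p :
  ssum z (fun x y => if run x then if bd y then p (nseq (size x).-1 Ext ++ y) else 0 else 0) =
  if z is Ext :: y then p y else 0.
Proof.
have strip w (q : word -> R) : ssum w (fun x y => if all (pred1 Ext) x then if bd y then q (nseq (size x) Ext ++ y) else 0 else 0) = q w.
  elim: w q => [|a w IHw] q //=; case: a => /=.
  - by rewrite add0r (IHw (fun x => q (Ext :: x))).
  - by rewrite ssum0 ?addr0.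
  by rewrite ssum0 ?addr0.
case: z => [|a z] /=; first by [].
rewrite add0r; case: a => /=; last 2 first.
- by rewrite ssum0.
- by rewrite ssum0.
by rewrite -[RHS]strip; apply: eq_ssum => x y; rewrite /run /=.
Qed.

Lemma W2_rhs p t s : W2 p t s = rhs2 p (te t s).
Proof.
elim: s p t => [|b s IHs] p t //=.
pose p' x := p (junc t (btype b) :: nseq (blen b) Ext ++ x).
have -> : W2 p t (b :: s) = ssum s (fun u v => K2 (wd (b :: u)) (fun k =>
    p (te t (letter (Bsrc b, ~~ btype b) k :: v)))) + W2 p' (btype b) s.
  by rewrite {1}/W2 /= add0r.
rewrite IHs /rhs2 [RHS]/=; congr (_ + _); last first.
  rewrite [RHS]ssum_nseq_nd //; apply: eq_ssum => x [|a z] //; case: a => //;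
    by apply: eq_ssum => h [|[] y] //; rewrite /p' -!catA.
have nj : junc t (btype b) != Ext by rewrite /junc; case: ifP.
transitivity (ssum (wd (b :: s)) (fun h z => ind R diskw h *
   (if z is Ext :: y then p (flip_sym (junc t (btype b)) :: y) else 0))); last first.
  by case: (junc t (btype b)) nj.
transitivity (ssum (wd (b :: s)) (fun w y => if bd y then
   K2 w (fun k => p (flip_sym (junc t (btype b)) :: nseq k Ext ++ y)) else 0)).
  rewrite ssum_wd_bd; apply: eq_ssum => u v; rewrite -/(wd (b :: u)).
  apply: eq_ssum_cat => h x e; case: runP => // -[k ex].
  case: (indP R diskw h) => [[Dh _]|[_ ->]]; last by rewrite !mul0r.
  rewrite te_letter (@lt_disk_suffix b u k.+1 h) // -?ex //.
  by rewrite /junc; case: (t); case: (btype b).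
transitivity (ssum (wd (b :: s)) (fun y' y => ssum y' (fun h x => ind R diskw h * (if run x then if bd y then
   p (flip_sym (junc t (btype b)) :: nseq (size x).-1 Ext ++ y) else 0 else 0)))).
  apply: eq_ssum => w y; case: bd; first by apply: eq_ssum => h x; case: run; rewrite ?mulr0.
  by rewrite ssum0 // => h x _; case: run; rewrite mulr0.
rewrite -ssum_assoc; apply: eq_ssum => h z; rewrite -ssum_mulrl.
by rewrite (ssum_strip_run z (fun y => p (_ :: y))).
Qed.

Lemma sandwich_sum a b z (Phi : word -> R) :
  ssum z (fun w0 y => ind R (fun x => exists2 h, diskw h & x = a :: h ++ [:: b]) w0 * Phi y) =
  if z is c :: z' then if c == a then
    ssum z' (fun h y => ind R diskw h * (if y is c' :: y' then if c' == b then Phi y' else 0 else 0))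
  else 0 else 0.
Proof.
(* The sum is read as a coefficient of a product of series; the state is arbitrary because [P]
   ignores it. *)
pose P : series R := fun _ => Phi; pose q : state := (false, false).
pose g3 := gap R * gap R * gap R.
transitivity ((arrow R a * g3 * arrow R b * P) q z).
  by rewrite seriesM; apply: eq_ssum => w0 y; rewrite (sandwichE _ _ _ _ (p := diskw) (@gap3E R)).
rewrite -!mulrA arrowM; case: z => // c z; case: eqP => // _.
rewrite !mulrA -mulrA seriesM; apply: eq_ssum => h y.
by rewrite gap3E arrowM.
Qed.

Lemma delAlt_sum z (Phi : word -> R) :
  ssum z (fun w0 y => ind R (delw Alt) w0 * Phi y) =
  (if z is Ext :: z' then ssum z' (fun h y => ind R diskw h * (if y is Rep :: y' then Phi y' else 0)) else 0) +
  (if z is Rep :: z' then ssum z' (fun h y => ind R diskw h * (if y is Ext :: y' then Phi y' else 0)) else 0).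
Proof.
under eq_ssum => w0 y.
  rewrite (@delw_split R Alt Rep) //; try by constructor.
    rewrite mulrDl; over.
  by move=> m Dm; inversion Dm; subst; [left | right]; eexists; eauto.
by rewrite ssumD !sandwich_sum; congr (_ + _); case: z => [|[] z] //=; apply: eq_ssum => h [|[] y].
Qed.

Lemma delRep_sum z (Phi : word -> R) :
  ssum z (fun w0 y => ind R (delw Rep) w0 * Phi y) =
  (if z is Ext :: z' then ssum z' (fun h y => ind R diskw h * (if y is Alt :: y' then Phi y' else 0)) else 0) +
  (if z is Alt :: z' then ssum z' (fun h y => ind R diskw h * (if y is Ext :: y' then Phi y' else 0)) else 0).
Proof.
under eq_ssum => w0 y.
  rewrite (@delw_split R Rep Alt) //; try by constructor.
    rewrite mulrDl; over.
  by move=> m Dm; inversion Dm; subst; [left | right]; eexists; eauto.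
by rewrite ssumD !sandwich_sum; congr (_ + _); case: z => [|[] z] //=; apply: eq_ssum => h [|[] y].
Qed.

(** In [rhs1] the letter behind the disk is [Rep], [Alt] or absent: two forms of [delw] and
    [end_sum]. In [rhs2] the letter before the disk is [Rep] or [Alt]: the two mirrored forms. *)
Lemma bsum1_rhs p w :
  bsum1 Alt p w + bsum1 Rep p w + end_sum p w = rhs1 p w + rhs2 p w.
Proof.
rewrite /bsum1 /end_sum /rhs1 /rhs2 -!ssumD; apply: eq_ssum => x z.
rewrite (delAlt_sum z (fun y => p (x ++ Alt :: y))) (delRep_sum z (fun y => p (x ++ Rep :: y))).
case: z => [|[] z]; rewrite ?addr0 ?add0r //.
have -> : ind R diskw z * p x = ssum z (fun h y => ind R diskw h * (if y is [::] then p x else 0)).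
  by rewrite ssum_rnil // => u a v; rewrite mulr0.
rewrite -!ssumD; apply: eq_ssum => h [|[] y]; rewrite -!mulrDr ?addr0 ?add0r //.
by rewrite cats0.
Qed.

(* The windows of a composable list on which the products are nonzero,
   summed, are the reductions of its word. *)
Lemma windows_sum p t s :
  Wmerge p t s + W1 p t s + W2 p t s +
    (if s is b :: s' then
     if btype b == t then p (Ext :: nseq (blen b) Ext ++ te (btype b) s') else 0 else 0) =
  bsum1 Ext p (te t s) + bsum1 Alt p (te t s) + bsum1 Rep p (te t s) + end_sum p (te t s).
Proof.
rewrite -Wmerge_bsum W1_rhs W2_rhs -!addrA (addrA (bsum1 Alt _ _)) bsum1_rhs.
by congr (_ + _); rewrite addrC -addrA addrC -addrA addrCA.
Qed.
End Windows.

(** * The morphism equation on basis elements *)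

Lemma ssum_cons (T : Type) (V : nmodType) (x : T) s (Phi : seq T -> seq T -> V) :
  ssum (x :: s) Phi = Phi [::] (x :: s) + ssum s (fun u v => Phi (x :: u) v).
Proof. by []. Qed.

Lemma muo_none m : size m != 2%N -> ~ (ok m /\ lang (wd m)) -> muo m = None.
Proof.
by move=> sz nm; case: m sz nm => [|a [|b [|c m]]] // _ nm;
  rewrite /muo; case: excluded_middle_informative.
Qed.

Lemma muo_small m : (size m < 2)%N -> muo m = None.
Proof.
move=> sz; apply: muo_none => [|[_ /lang_size]]; first by case: (size m) sz => [|[|]].
by rewrite ltnNge (leq_trans (ltnW sz)).
Qed.

Lemma muo_idem m1 e m2 : size m1 + size m2 != 1%N -> muo (m1 ++ Be e :: m2) = None.
Proof.
move=> sz; apply: muo_none => [|[]]; first by rewrite size_cat /= addnS eqSS.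
by rewrite /ok all_cat /= andbF.
Qed.

Lemma muo_ends b m b' : all nonidem (b :: m) -> muo (b :: m) = Some b' ->
  [/\ ok (b :: m), Bsrc b' = Bsrc b & Btgt b' = Btgt (last b m)].
Proof.
move=> nm; have letterT q k (n : nonidem (letter q k)) : Btgt (letter q k) = tgt_state (acts q (nseq k Ext)).
  by rewrite Btgt_letter.
have gen : (if excluded_middle_informative (ok (b :: m) /\ lang (wd (b :: m)))
            then Some (bof (b :: m)) else None) = Some b' ->
  [/\ ok (b :: m), Bsrc b' = Bsrc b & Btgt b' = Btgt (last b m)].
  case: excluded_middle_informative => // -[okm Lm] [<-].
  have [<- _] := acts_wd okm.
  case: Lm => h Dh [e|[k e]|[k e]]; rewrite /bof e.
  - rewrite (signed_count_disk Dh) (acts_diskw _ Dh).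
    by rewrite /tgt_state /act /= /tgt_state /=; case: (Bsrc b); case: (btype b).
  - rewrite signed_count_prefix // Bsrc_letter Btgt_letter acts_cat (acts_diskw _ Dh).
    rewrite nseq_rcons acts_cat; split=> //; case: (acts _ _) => v [];
    by rewrite /tgt_state /act /= /tgt_state /=; case: v.
  rewrite signed_count_suffix // Bsrc_letter Btgt_letter acts_cat (acts_diskw _ Dh).
  split=> //=; congr (tgt_state (acts _ _)).
  by rewrite /tgt_state /act /= /tgt_state /=; case: (Bsrc b); case: (btype b).
case: m nm gen => [|c [|d m]] nm gen; [exact: gen| | exact: gen].
move: nm => /and3P[nb nc _] /(BmulP _ nb nc)[bc tbc ->]; split.
- by rewrite !ok_cons nb nc bc eqxx.
- by rewrite Bsrc_letter.
rewrite Btgt_letter (Btgt_state nc) -addSn nseqD acts_cat; congr (tgt_state (acts _ _)).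
by rewrite nseq_rcons acts_cat /= /act -(Btgt_state nb) bc acts_nseq /= tbc.
Qed.

Lemma ok_replace u b m v b' : ok (u ++ (b :: m) ++ v) -> nonidem b' -> Bsrc b' = Bsrc b ->
  Btgt b' = Btgt (last b m) -> ok (u ++ b' :: v).
Proof.
move=> oks nb' sb' tb'.
have okv : ok (b' :: v).
  move: (ok_catr oks); case: v {oks} => [|c v]; first by rewrite ok_cons nb'.
  by rewrite lastI ok_cat => /and3P[_ tc okc]; rewrite ok_cons nb' tb' tc.
by case/lastP: u oks => [|u a] //; rewrite !ok_cat okv sb' => /and3P[-> -> _].
Qed.

Lemma muo_nonidem_ok u b m v b' : all nonidem (b :: m) -> muo (b :: m) = Some b' ->
  ok (u ++ b' :: v) -> ok (u ++ (b :: m) ++ v).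
Proof.
move=> nm mum oku; have [okm sb' tb'] := muo_ends nm mum.
have okv : ok ((b :: m) ++ v).
  move: (ok_catr oku); case: v {oku} => [|c v]; first by rewrite cats0.
  by rewrite [b :: m]lastI ok_cat -lastI okm -tb' ok_cons => /and3P[_ -> ->].
by case/lastP: u oku => [|u a] //; rewrite !ok_cat sb' okv => /and3P[-> -> _].
Qed.

Section FunctorEquation.
Variables (R : pzRingType) (char2 : forall x : R, x + x = 0).
Variables (F : series R) (D0 : R) (ev : bool -> R).
Hypothesis masterF :
  bder F + gap _ * gap _ * gap _ * arrow _ Ext * F
        + F * arrow _ Ext * gap _ * gap _ * gap _
        + cst (fun q => ev q.1) * (gap _ * gap _ * gap _) =
  F * cst (fun _ => D0) + cst (fun _ => D0) * F + F * (arrow _ Alt + arrow _ Rep) * F.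
Hypothesis evF : cst (fun q => ev q.1) * F = F.
Hypothesis Fev : F * cst (fun q => ev (tgt_state q)) = F.
Hypothesis evM : forall v v', ev v * ev v' = if v == v' then ev v else 0.
Hypothesis ev_cycle : forall v, ev v * D0 + D0 * ev v = 0.

Let evFE q w : ev q.1 * F q w = F q w.
Proof. by rewrite -{2}evF cstME. Qed.

Let FevE q w : F q w * ev (tgt_state (acts q w)) = F q w.
Proof. by rewrite -{2}Fev McstE. Qed.

(** Strictly unital: an idempotent alone goes to [ev], and a longer list that contains one goes to
    zero. *)
Definition fb (s : seq Bbasis) : R :=
  match s with
  | [::] => 0
  | [:: Be v] => ev v
  | b :: _ => if ok s then F (bst b) (wd s) else 0
  end.

Lemma fb_ok b s : ok (b :: s) -> fb (b :: s) = F (bst b) (wd (b :: s)).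
Proof. by move=> oks; rewrite /fb oks; case: b s oks => [v|v n|v n] []. Qed.

Lemma fb_not_ok s : (1 < size s)%N -> ~~ ok s -> fb s = 0.
Proof. by case: s => // b [|c s] // _ /negbTE nok; rewrite /fb nok; case: b nok. Qed.

Lemma fb_idem s1 e s2 : (s1 != [::]) || (s2 != [::]) -> fb (s1 ++ Be e :: s2) = 0.
Proof.
move=> ne; apply: fb_not_ok; last by rewrite /ok all_cat /= andbF.
by rewrite size_cat /= addnS; case: s1 s2 ne => [|? ?] [|? ?] //= _; rewrite ltnS addnC.
Qed.

Lemma ev_fb e b s : ev e * fb (b :: s) = if e == Bsrc b then fb (b :: s) else 0.
Proof.
have nil : 0 = if e == Bsrc b then 0 else 0 :> R by case: ifP.
case oks : (ok (b :: s)).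
  rewrite fb_ok // -(evFE (bst b)) mulrA evM.
  by case: eqP => [->|]; rewrite ?mul0r.
case: s oks => [|c s] oks; last by rewrite !fb_not_ok ?oks // mulr0.
by case: b oks {nil} => [v|v n|v n] // _; rewrite [LHS]evM; case: eqP => [->|].
Qed.

Lemma fb_ev e s b : fb (rcons s b) * ev e = if Btgt b == e then fb (rcons s b) else 0.
Proof.
have nil : 0 = if Btgt b == e then 0 else 0 :> R by case: ifP.
case oks : (ok (rcons s b)).
  case es: (rcons s b) oks => [|a s'] oks; first by case: s es.
  rewrite fb_ok // -(FevE (bst a)) -mulrA evM.
  have [-> _] := acts_wd oks.
  have -> : last a s' = b by have := last_rcons a s b; rewrite es.
  by case: eqP => [->|]; rewrite ?mulr0.
case: s oks => [|c s] oks; last by rewrite !fb_not_ok ?oks ?mul0r //= size_rcons.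
case: b oks {nil} => [v|v n|v n] // _; rewrite [LHS]evM.
by case: eqP.
Qed.

Definition window_sum (s : seq Bbasis) : R :=
  ssum s (fun u z => ssum z (fun m v => oapp (fun b => fb (u ++ b :: v)) 0 (muo m))).

Section ComposableLists.
Variables (b0 : Bbasis) (s0 : seq Bbasis).
Hypothesis oks : ok (b0 :: s0).
Let s := b0 :: s0.
Let q := bst b0.
(** A D-loop ends where it starts, so it can precede [s] without moving the vertex, and its type is
    the one used in [te false]. *)
Let q0 : state := (q.1, false).
Let w := wd s.
Let j := junc false (btype b0).

(* The value of [fb] in terms of the word that includes a first junction;
   the virtual arrow before it is [q0]. *)
Let p (x : word) : R :=
  match x with [::] | Ext :: _ => 0 | a :: y => F (act q0 a) y end.

Let fb_te b v : ok (b :: v) -> Bsrc b = q.1 -> fb (b :: v) = p (te false (b :: v)).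
Proof.
move=> okb sb; rewrite fb_ok // te_wd /p.
have -> : bst b = act q0 (junc false (btype b)).
  by rewrite /bst sb /act /junc /tgt_state /= addbF; case: (btype b).
by rewrite /junc; case: ifP.
Qed.

Let g u v b : R :=
  if b is Be e then if (u == [::]) && (v == [::]) then ev e else 0
  else p (te false (u ++ b :: v)).

Let window_sumE : window_sum s = Wmerge p false s + W1 p false s + W2 p false s +
  ind _ diskw w * ev q.1.
Proof.
have -> : ind _ diskw w * ev q.1 = ssum s (fun u z => ssum z (fun m v =>
    if m is b :: _ then ind _ diskw (wd m) * g u v (Be (Bsrc b)) else 0)) :> R.
  rewrite ssum_nil => [|a u v]; last first.
    by apply: ssum0 => -[|b m] v' _ //; rewrite /g /= mulr0.
  by rewrite ssum_rnil /g //= => [[|b m] c v] //; rewrite mulr0.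
rewrite /Wmerge /W1 /W2 -!ssumD; apply: eq_ssum_cat => u z uz.
rewrite -!ssumD; apply: eq_ssum_cat => -[|b m] v mv; first by rewrite muo_small //= !addr0.
have okm : ok (b :: m) by move: oks; rewrite -/s -uz -mv => /ok_catr/ok_catl.
have nm : all nonidem (b :: m) by case/andP: okm.
have gl qq k : g u v (letter qq k) = p (te false (u ++ letter qq k :: v)).
  by rewrite /g; have [_ [_]] := letterK qq k; case: letter.
have -> : oapp (fun b' => fb (u ++ b' :: v)) 0 (muo (b :: m)) = oapp (g u v) 0 (muo (b :: m)).
  case em: (muo (b :: m)) => [b'|] //=; have [_ sb' tb'] := muo_ends nm em.
  case nb': (nonidem b').
    have oku : ok (u ++ b' :: v) by apply: (ok_replace (m := m) (b := b)); rewrite ?mv ?uz.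
    have -> : g u v b' = p (te false (u ++ b' :: v)) by case: (b') nb'.
    case: u oku uz {gl} => [|a u] oku uz; apply: fb_te => //.
      by rewrite sb'; case: uz; rewrite -mv => -[->].
    by case: uz => ->.
  case: b' nb' {em sb' tb'} => // e _; rewrite /g.
  case: ifP => [/andP[/eqP-> /eqP->]//|/negbT]; rewrite negb_and => ne; rewrite (fb_idem _ ne) //.
apply: etrans (muo_sum (g u v) okm) _; congr (_ + _ + _ + _).
- rewrite /join_sum; case: (m) => [|c [|? ?]] //; by rewrite gl.
- by apply: eq_ssum => x h; rewrite gl.
by apply: eq_ssum => x h; rewrite gl.
Qed.

Let g3 : series R := gap R * gap R * gap R.

Let act_q0 : act q0 j = q.
Proof. by rewrite /q0 /j /q /bst /act /junc /tgt_state /= addbF; case: (btype b0). Qed.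

Let nj : j != Ext.
Proof. by rewrite /j /junc; case: ifP. Qed.

Let p_cons y : p (j :: y) = F q y.
Proof. by rewrite -act_q0 /p; case: j nj. Qed.

Let bsum1_te a : bsum1 a p (te false s) =
  ssum (te false s) (fun m y => ind _ (delw a) m * p (a :: y)) + bder1 a F q w.
Proof.
rewrite /bsum1 te_wd -/j ssum_cons; congr (_ + _).
by apply: eq_ssum => x z; apply: eq_ssum => m y; rewrite cat_cons p_cons.
Qed.

Let acts_flip h : diskw h -> act (acts q h) Ext = act q0 (flip_sym j).
Proof.
move=> Dh; rewrite (acts_diskw _ Dh) /q /q0 /j /bst /junc /act /tgt_state /=.
by case: (Bsrc b0); case: (btype b0).
Qed.

Let g3EF : (g3 * arrow R Ext * F) q w =
  ssum w (fun h y => ind _ diskw h * (if y is Ext :: y' then F (act q0 (flip_sym j)) y' else 0)).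
Proof.
rewrite -mulrA seriesM; apply: eq_ssum => h y; rewrite /g3 gap3E arrowM.
case: (indP R diskw h) => [[Dh _]|[_ ->]]; last by rewrite !mul0r.
by case: y => // -[] y //=; rewrite acts_flip.
Qed.

(** Contractions that involve the virtual junction are those of windows with an initial disk; they
    make up the term with the disk on the left in the master equation. *)
Let first_junction :
  ssum (te false s) (fun m y => ind _ (delw Ext) m * p (Ext :: y)) +
  ssum (te false s) (fun m y => ind _ (delw Alt) m * p (Alt :: y)) +
  ssum (te false s) (fun m y => ind _ (delw Rep) m * p (Rep :: y)) =
  (g3 * arrow R Ext * F) q w.
Proof.
rewrite [X in X + _ + _]ssum0 ?add0r => [|m y _]; last by rewrite mulr0.
rewrite (delAlt_sum _ (fun y => p (Alt :: y))) (delRep_sum _ (fun y => p (Rep :: y))).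
by rewrite g3EF te_wd -/j -/w; case: j nj => //= _; rewrite ?addr0 ?add0r.
Qed.

Let end_sum_te : end_sum p (te false s) = (F * arrow R Ext * g3) q w.
Proof.
rewrite /end_sum te_wd -/j -mulrA seriesM ssum_cons.
rewrite [X in X + _](_ : _ = 0) ?add0r; last by case: j nj.
apply: eq_ssum => x z; rewrite arrowM p_cons.
by case: z => [|[] z]; rewrite ?mulr0 //= /g3 gap3E indC.
Qed.

Let split_sumE : ssum s (fun u v => fb u * fb v) = (F * (arrow R Alt + arrow R Rep) * F) q w.
Proof.
rewrite -mulrA seriesM.
transitivity (ssum w (fun x z => if bd z then
  (if z is a :: z' then F q x * F (act (acts q x) a) z' else 0) else 0)); last first.
  apply: eq_ssum => x z; rewrite mulrDl seriesD !arrowM.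
  by case: z => [|[] z] /=; rewrite ?addr0 ?add0r ?mulr0.
rewrite /w ssum_wd_bd /s ssum_cons -[fb [::]]/0 mul0r add0r; apply: eq_ssum_cat => u v uv.
case: v uv => [|c v] uv; first by rewrite mulr0.
rewrite te_wd.
have oku : ok ((b0 :: u) ++ c :: v) by rewrite cat_cons uv.
have okb : ok (b0 :: u) := ok_catl oku; have okc : ok (c :: v) := ok_catr oku.
rewrite (fb_ok okb) (fb_ok okc) -/(wd (b0 :: u)) -/(wd (c :: v)).
congr (_ * F _ _); have [tu bu] := acts_wd okb.
have chain : Btgt (last b0 u) = Bsrc c by move: oku; rewrite lastI ok_cat => /and3P[_ /eqP].
rewrite /act /q tu chain bu /bst /lt /junc last_map.
by case: (btype (last b0 u)); case: (btype c).
Qed.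

Lemma functor_eq_ok : window_sum s = fb s * D0 + D0 * fb s + ssum s (fun u v => fb u * fb v).
Proof.
have first0 : (if btype b0 == false then p (Ext :: nseq (blen b0) Ext ++ te (btype b0) s0) else 0) = 0.
  by case: eqP.
have W := windows_sum p false s; rewrite [X in _ + X = _]first0 addr0 in W.
rewrite window_sumE W split_sumE (fb_ok oks) -/q -/w !bsum1_te end_sum_te.
have M := congr1 (fun P : series R => P q w) masterF; move: M.
have -> : F * arrow R Ext * gap R * gap R * gap R = F * arrow R Ext * g3 by rewrite /g3 !mulrA.
move=> M; rewrite /= !seriesD !McstE !cstME -/g3 in M; rewrite -{}M.
rewrite -first_junction /bder !seriesD /g3 gap3E indC.
have regroup (a b c d e f x y : R) :
    a + b + (c + d) + (e + f) + x + y = b + d + f + (a + c + e) + x + y.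
  by rewrite (addrACA a) (addrACA (a + c)) (addrC (b + d + f)).
exact: regroup.
Qed.
End ComposableLists.

(** Products preserve the end vertices of a window, so no contraction repairs a broken list; on the
    right the orthogonality of the idempotents kills a product across the break. *)
Lemma functor_eq_not_ok s : all nonidem s -> ~~ ok s ->
  window_sum s = fb s * D0 + D0 * fb s + ssum s (fun u v => fb u * fb v).
Proof.
move=> ns nok.
have sz : (1 < size s)%N.
  by case: s ns nok => [|b [|c s]] //=; rewrite ok_cons /= => ->.
rewrite (fb_not_ok sz nok) mul0r mulr0 add0r add0r.
rewrite [LHS]ssum0 => [|u z uz]; last first.
  apply: ssum0 => -[|b m] v mv; first by rewrite muo_small.
  have nm : all nonidem (b :: m) by move: ns; rewrite -uz -mv !all_cat => /and3P[].
  case em : (muo (b :: m)) => [b'|] //=.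
  case oku : (ok (u ++ b' :: v)).
    by case/negP: nok; rewrite -uz -mv; apply: muo_nonidem_ok oku.
  case: u v mv uz oku => [|a u] [|c v] mv uz oku; try by rewrite fb_not_ok ?oku // size_cat /= addnS.
  have [okm _ _] := muo_ends nm em.
  by case/negP: nok; rewrite -uz -mv cats0.
symmetry; apply: ssum0 => u v uv.
case okv : (ok v) => /=; last first.
  case: v uv okv => [|c v] uv okv; first by rewrite mulr0.
  rewrite [fb (c :: v)]fb_not_ok ?okv ?mulr0 //; case: v uv okv => // uv.
  by rewrite ok_cons /= andbT; move: ns; rewrite -uv all_cat /= => /and3P[_ -> _].
case/lastP: u uv => [|u a] uv; first by rewrite mul0r.
case: v uv okv => [|c v] uv okv; first by rewrite mulr0.
rewrite (fb_ok okv) -evFE mulrA fb_ev.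
case: eqP => [ac|_]; last by rewrite mul0r.
case oku : (ok (rcons u a)).
  by case/negP: nok; rewrite -uv ok_cat oku okv ac /= eqxx.
rewrite fb_not_ok ?oku ?mul0r // size_rcons; case: u uv oku => // uv.
by rewrite ok_cons /= andbT; move: ns; rewrite -uv /= => /andP[-> _].
Qed.

(** Only the windows that multiply [e] with a neighbour matter. In the interior the left and the
    right one give the same list and cancel; at an end the single one matches the product with
    [ev e] on the right. *)
Lemma functor_eq_idem x e y : let s := x ++ Be e :: y in
  window_sum s = fb s * D0 + D0 * fb s + ssum s (fun u v => fb u * fb v).
Proof.
move=> s.
pose H u m v := oapp (fun b => fb (u ++ b :: v)) 0 (muo m).
have LHS1 : window_sum s = ssum x (fun u1 u2 => ssum y (fun v1 v2 => H u1 (u2 ++ Be e :: v1) v2)).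
  rewrite /window_sum ssum_insert [X in _ + X]ssum0 ?addr0 => [|v1 v2 _]; last first.
    apply: ssum0 => m v _; case: (muo m) => //= b; rewrite -catA /= fb_idem //.
    by rewrite orbC; case: v1.
  apply: eq_ssum => u1 u2; rewrite ssum_insert [X in X + _]ssum0 ?add0r // => m b _.
  case: (muo m) => //= c; rewrite -cat_cons -cat_rcons catA.
  by rewrite -cats1 -!catA /= -cat_rcons catA fb_idem //; case: u1.
have Hbig u1 u2 v1 v2 : size u2 + size v1 != 1%N -> H u1 (u2 ++ Be e :: v1) v2 = 0.
  by move=> sz; rewrite /H muo_idem.
have RHS1 : ssum s (fun u v => fb u * fb v) =
    (if y is [::] then fb x * ev e else 0) + (if x is [::] then ev e * fb y else 0).
  rewrite ssum_insert; congr (_ + _).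
    rewrite ssum_rnil => [|u1 a u2]; last by rewrite fb_idem ?mulr0.
    by case: (y) => [|c y'] //; rewrite -[_ ++ _]/([::] ++ Be e :: c :: y') fb_idem ?mulr0.
  rewrite ssum_nil => [|a v1 v2]; last by rewrite fb_idem ?mul0r // orbC.
  by case: (x) => // a x'; rewrite fb_idem ?mul0r.
pose G u1 u2 v1 v2 := H u1 (u2 ++ Be e :: v1) v2.
have Gbig u1 u2 v1 v2 : size u2 + size v1 != 1%N -> G u1 u2 v1 v2 = 0 by exact: Hbig.
have Gbig2 u1 a u2 b v1 v2 : G u1 ((a :: u2) ++ [:: b]) v1 v2 = 0.
  by apply: Gbig; rewrite size_cat /= addnS addSn.
have Gr u1 c v2 : G u1 [::] [:: c] v2 = if e == Bsrc c then fb (u1 ++ c :: v2) else 0.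
  by rewrite /G /H /= /Bmul /=; case: eqP.
have Gl u1 b v2 : G u1 [:: b] [::] v2 = if Btgt b == e then fb (u1 ++ b :: v2) else 0.
  rewrite /G /H /= /Bmul /=; case: eqP => //= e1.
  by case: b e1 => //= v ->.
have -> : window_sum s = ssum x (fun u1 u2 => ssum y (G u1 u2)) by exact: LHS1.
rewrite {}RHS1 /s {LHS1 s}; clearbody G.
have fbs : fb (x ++ Be e :: y) * D0 + D0 * fb (x ++ Be e :: y) = 0.
  case: x y => [|a x] [|c y]; first exact: ev_cycle;
    by rewrite fb_idem // mul0r mulr0 addr0.
rewrite fbs add0r.
case/lastP: x {fbs} => [|x b]; case: y => [|c y].
- by rewrite /= Gbig // mul0r mulr0 addr0.
- rewrite add0r ev_fb [LHS]/= Gbig // add0r ssum_nil => [|a v1 v2]; last exact: Gbig.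
  by rewrite Gr.
- rewrite [X in _ = _ + X](_ : _ = 0) ?addr0 ?fb_ev; last by case: (x).
  rewrite -{1}cats1 ssum_insert ssum_rnil => [|u1 a u2]; last first.
    exact: Gbig2.
  by rewrite /= Gl (Gbig _ [::] [::]) // addr0 cats1.
rewrite [RHS](_ : _ = 0); last by rewrite add0r; case: (x).
rewrite -{1}cats1 ssum_insert ssum_rnil => [|u1 a u2]; last first.
  by rewrite ssum0 // => v1 v2 _; apply: Gbig2.
have e1 : ssum (c :: y) (G x [:: b]) = G x [:: b] [::] (c :: y).
  by rewrite ssum_nil // => a v1 v2; apply: Gbig.
have e2 : ssum (c :: y) (G (x ++ [:: b]) [::]) = G (x ++ [:: b]) [::] [:: c] y.
  by rewrite ssum_cons Gbig // add0r ssum_nil // => a v1 v2; apply: Gbig.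
apply: (etrans (congr2 +%R e1 e2)); rewrite Gl Gr -catA cat1s.
have nok : Btgt b <> Bsrc c -> fb (x ++ b :: c :: y) = 0.
  move=> bc; rewrite fb_not_ok //; first by rewrite size_cat /= !addnS.
  by rewrite -cat_rcons ok_cat; case: eqP bc => //; rewrite andbF.
case: (Btgt b =P Bsrc c) nok => [<- _|_ ->] //; last by do 2!case: ifP => _; rewrite addr0.
by rewrite eq_sym; case: eqP => _; rewrite ?char2 ?addr0.
Qed.

Theorem functor_eq s :
  window_sum s = fb s * D0 + D0 * fb s + ssum s (fun u v => fb u * fb v).
Proof.
case ns : (all nonidem s).
  case oks : (ok s); last by apply: functor_eq_not_ok; rewrite ?oks.
  case: s {ns} oks => [|b s] oks; last exact: functor_eq_ok.
  have e0 : muo [::] = None by apply: muo_small.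
  by rewrite /window_sum /ssum e0 /= !mul0r mulr0 !addr0.
have [x [e [y ->]]] : exists x e y, s = x ++ Be e :: y.
  elim: s ns => [//|b s IHs]; case: b => [e _|v n|v n]; first by exists [::], e, s.
    by case/IHs => x [e [y ->]]; exists (BD v n :: x), e, y.
  by case/IHs => x [e [y ->]]; exists (BS v n :: x), e, y.
exact: functor_eq_idem.
Qed.
End FunctorEquation.

(** * Multilinear maps and window sums *)

Section Multilinear.
Variables (V W : lmodType 'F_2).
Implicit Types (f G : seq V -> W) (s u v : seq V).

Lemma lmod_char2 (U : lmodType 'F_2) (x : U) : x + x = 0.
Proof. by rewrite -[x]scale1r -scalerDl (_ : 1 + 1 = 0 :> 'F_2) ?scale0r //; apply/val_inj. Qed.

Lemma multilinear_cons f x : multilinear f -> multilinear (fun s => f (x :: s)).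
Proof. by move=> fL s1 s2; apply: (fL (x :: s1)). Qed.

Lemma multilinear_catr f v : multilinear f -> multilinear (fun s => f (s ++ v)).
Proof. by move=> fL s1 s2 a x y; rewrite -!catA; apply: fL. Qed.

Lemma multilinearD f s1 x y s2 : multilinear f ->
  f (s1 ++ (x + y) :: s2) = f (s1 ++ x :: s2) + f (s1 ++ y :: s2).
Proof. by move=> fL; have := fL s1 s2 1 x y; rewrite !scale1r. Qed.

Lemma multilinear0 f s1 s2 : multilinear f -> f (s1 ++ 0 :: s2) = 0.
Proof. by move=> fL; have := fL s1 s2 1 0 0; rewrite scale1r add0r scale1r lmod_char2. Qed.

Lemma ssumZ (T : Type) (t : seq T) (Phi : seq T -> seq T -> W) (a : 'F_2) :
  a *: ssum t Phi = ssum t (fun p q => a *: Phi p q).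
Proof. by elim: t Phi => //= x t IHt Phi; rewrite scalerDr IHt. Qed.

Lemma multilinear_ssum_param (T : Type) (z : seq T) (K : seq T -> seq T -> seq V -> W) :
  (forall p q, multilinear (K p q)) -> multilinear (fun u => ssum z (fun p q => K p q u)).
Proof.
by move=> KL s1 s2 a x y; rewrite ssumZ -ssumD; apply: eq_ssum => p q; apply: KL.
Qed.

Lemma multilinear_ssum (K : seq V -> seq V -> W) :
  (forall v, multilinear (K^~ v)) -> (forall u, multilinear (K u)) ->
  multilinear (fun s => ssum s K).
Proof.
move=> KL KR s1; elim: s1 K KL KR => [|z s1 IHs] K KL KR s2 a x y /=.
  rewrite (KR [::] [::]) scalerDr addrACA; congr (_ + _).
  rewrite ssumZ -ssumD; apply: eq_ssum => u v; exact: (KL v [::] u).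
rewrite (KR [::] (z :: s1)) IHs => [|v s3|u]; last exact: KR.
  by rewrite scalerDr addrACA.
exact: (KL v (z :: s3)).
Qed.

Lemma multilinear_eq_add f g : multilinear f -> multilinear g -> multilinear (fun s => f s + g s).
Proof. by move=> fL gL s1 s2 a x y; rewrite fL gL scalerDr addrACA. Qed.

End Multilinear.

Section Insertions.
Variables (V : Type) (mu : seq V -> V).

(** Unlike [insert_sum] this admits empty windows, which vanish because [mu [::] = 0]; in return the
    splitting calculus applies. *)
Definition ins (W : nmodType) (f : seq V -> W) (s : seq V) : W :=
  ssum s (fun u z => ssum z (fun m v => f (u ++ mu m :: v))).

Lemma eq_ins (W : nmodType) (f g : seq V -> W) : f =1 g -> ins f =1 ins g.
Proof. by move=> fg s; apply: eq_ssum => u z; apply: eq_ssum => m v. Qed.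

Lemma insD (W : nmodType) (f g : seq V -> W) s :
  ins (fun s => f s + g s) s = ins f s + ins g s.
Proof. by rewrite -ssumD; apply: eq_ssum => u z; rewrite -ssumD. Qed.

Lemma ins_conv (R : pzRingType) (f g : seq V -> R) s :
  ins (fun t => ssum t (fun u v => f u * g v)) s =
  ssum s (fun u v => ins f u * g v) + ssum s (fun u v => f u * ins g v).
Proof.
transitivity (ssum s (fun u z => ssum z (fun m v =>
    ssum u (fun u1 u2 => f u1 * g (u2 ++ mu m :: v))) +
    ssum z (fun m v => ssum v (fun v1 v2 => f (u ++ mu m :: v1) * g v2)))).
  by apply: eq_ssum => u z; rewrite -ssumD; apply: eq_ssum => m v; rewrite ssum_insert.
rewrite ssumD addrC; congr (_ + _).
  under eq_ssum => u z do rewrite ssum_assoc.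
  rewrite ssum_assoc; apply: eq_ssum => y v2.
  by rewrite ssum_mulrr; apply: eq_ssum => u z; rewrite ssum_mulrr.
under eq_ssum => u z do rewrite ssum_exchange.
rewrite -ssum_assoc; apply: eq_ssum => u1 y.
by rewrite ssum_mulrl; apply: eq_ssum => u2 z; rewrite ssum_mulrl.
Qed.

(* Two disjoint insertions appear in both orders, hence cancel. *)
Lemma ins_ins (W : nmodType) (f : seq V -> W) s : (forall x : W, x + x = 0) ->
  ins (ins f) s = ssum s (fun u1 z => ssum z (fun M v2 =>
    ssum M (fun u2 y => ssum y (fun m v1 => f (u1 ++ mu (u2 ++ mu m :: v1) :: v2))))).
Proof.
move=> char2W.
pose X u1 a b m v := f (u1 ++ mu a :: b ++ mu m :: v).
pose Y u1 u2 m v1 v2 := f (u1 ++ mu (u2 ++ mu m :: v1) :: v2).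
transitivity (ssum s (fun u z => ssum z (fun m v => ssum u (fun u1 u2 => ssum u2 (fun a b => X u1 a b m v)))) +
    ssum s (fun u z => ssum z (fun m v => ssum u (fun u1 u2 => ssum v (fun v1 v2 => Y u1 u2 m v1 v2)))) +
    ssum s (fun u z => ssum z (fun m v => ssum v (fun v1 v2 => ssum v2 (fun m' b => X u m v1 m' b))))).
  rewrite -!ssumD; apply: eq_ssum => u z; rewrite -!ssumD; apply: eq_ssum => m v.
  rewrite /ins ssum_insert -ssumD; congr (_ + _).
    by apply: eq_ssum => u1 u2; rewrite ssum_insert.
  by apply: eq_ssum => v1 v2; apply: eq_ssum => m' b; rewrite -catA.
rewrite addrAC [X in X + _](_ : _ = 0) ?add0r.
  under eq_ssum => u z do rewrite ssum_exchange.
  rewrite -ssum_assoc; apply: eq_ssum => u1 y.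
  under eq_ssum => u2 z do rewrite ssum_assoc.
  by rewrite ssum_assoc.
rewrite -[RHS](char2W (ssum s (fun u z => ssum z (fun m v =>
  ssum v (fun v1 v2 => ssum v2 (fun m' b => X u m v1 m' b)))))); congr (_ + _).
under eq_ssum => u z do rewrite ssum_exchange.
rewrite -ssum_assoc; apply: eq_ssum => u1 y.
under eq_ssum => u2 z do rewrite ssum_exchange.
by rewrite -ssum_assoc.
Qed.

End Insertions.

Lemma multilinear_ins (V W : lmodType 'F_2) (f : seq V -> W) (mu : seq V -> V) :
  multilinear f -> multilinear mu -> multilinear (ins mu f).
Proof.
move=> fL muL; apply: multilinear_ssum => [z|u].
  by apply: multilinear_ssum_param => m v; apply: multilinear_catr.
apply: multilinear_ssum => [v s1 s2 a x y|m]; first by rewrite muL; apply: fL.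
move=> s1 s2 a x y; have := fL (u ++ mu m :: s1) s2 a x y.
by rewrite -!catA.
Qed.

Lemma ssum_index (T : Type) (W : nmodType) (s : seq T) (Phi : seq T -> seq T -> W) :
  ssum s Phi = \sum_(0 <= i < (size s).+1) Phi (take i s) (drop i s).
Proof.
elim: s Phi => [|x s IHs] Phi /=; first by rewrite big_nat1.
by rewrite big_nat_recl // IHs.
Qed.

Lemma insert_sumE (V W : lmodType 'F_2) (f : seq V -> W) (mu : seq V -> V) s :
  multilinear f -> mu [::] = 0 -> insert_sum f mu s = ins mu f s.
Proof.
move=> fL mu0; rewrite /ins ssum_index big_nat_recr //= drop_size /= mu0.
rewrite multilinear0 // addr0; apply: eq_big_nat => i /andP[_ lti].
rewrite ssum_index [RHS]big_nat_recl // take0 mu0 multilinear0 // add0r.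
rewrite -[in LHS](add0n i.+1) big_addn subSS -size_drop; apply: eq_bigr => k _.
by rewrite /slice drop_drop -addSnnS addnK.
Qed.

Lemma eq_big_compositions (T : Type) (W : nmodType) (Phi Psi : seq (seq T) -> W) x (s : seq T) :
  (forall b c, Phi (b :: c) = Psi (b :: c)) ->
  \sum_(c <- compositions (x :: s)) Phi c = \sum_(c <- compositions (x :: s)) Psi c.
Proof.
move=> PP; rewrite /= !big_flatten !big_map; apply: eq_bigr => -[|b c] _;
  by rewrite !big_cons !big_nil !PP.
Qed.

(** For a dg target only compositions into one or two blocks contribute. *)
Lemma big_compositions (T : Type) (W : nmodType) (Phi : seq (seq T) -> W)
    (x : T) (s : seq T) :
  (forall a b c r, Phi [:: a, b, c & r] = 0) ->
  \sum_(c <- compositions (x :: s)) Phi c =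
  Phi [:: x :: s] + ssum s (fun u v => if v is [::] then 0 else Phi [:: x :: u; v]).
Proof.
elim: s x Phi => [|y s IHs] x Phi Phi3.
  by rewrite /= big_cons big_nil addr0.
pose Phi1 c := if c is [:: b] then Phi [:: [:: x]; b] else 0.
pose Phi2 c := if c is b :: c' then Phi ((x :: b) :: c') else 0.
transitivity (\sum_(c <- compositions (y :: s)) (Phi1 c + Phi2 c)).
  transitivity (\sum_(c <- compositions (y :: s)) (Phi ([:: x] :: c) + Phi2 c)).
    rewrite [compositions (x :: _)]/= -/(compositions (y :: s)) big_flatten big_map.
    by apply: eq_bigr => -[|b c] _ /=; rewrite !big_cons !big_nil ?addr0.
  apply: eq_big_compositions => b [|b' c]; by rewrite /Phi1 ?Phi3.
rewrite big_split !IHs //=.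
set z := ssum s (fun _ => _); have -> : z = 0 by apply: ssum0 => u [].
by rewrite addr0 addrCA.
Qed.

(** * Extension from basis elements *)

Fixpoint mlx (W : lmodType 'F_2) (xs : seq Bv) (h : seq Bbasis -> W) : W :=
  if xs is x :: xs' then
    \sum_(b <- msupp x) monalg.mcoeff b x *: mlx xs' (fun bs => h (b :: bs))
  else h [::].

Notation bvec b := (<< b >> : Bv).

Section Extension.
Variable W : lmodType 'F_2.
Implicit Types (h : seq Bbasis -> W) (xs : seq Bv).

Lemma eq_mlx xs h h' : h =1 h' -> mlx xs h = mlx xs h'.
Proof.
elim: xs h h' => [|x xs IHxs] h h' hh' //=.
by apply: eq_bigr => b _; congr (_ *: _); apply: IHxs.
Qed.

Lemma big_msupp_linear (phi : Bbasis -> W) a (x y : Bv) :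
  \sum_(b <- msupp (a *: x + y)) monalg.mcoeff b (a *: x + y) *: phi b =
  a *: (\sum_(b <- msupp x) monalg.mcoeff b x *: phi b) +
  \sum_(b <- msupp y) monalg.mcoeff b y *: phi b.
Proof.
pose d := (msupp x `|` msupp y)%fset.
have wide (z : Bv) : (msupp z `<=` d)%fset ->
    \sum_(b <- msupp z) monalg.mcoeff b z *: phi b = \sum_(b <- d) monalg.mcoeff b z *: phi b.
  move=> zd; rewrite (big_fset_incl _ zd) // => b _ bz.
  by rewrite mcoeff_outdom // scale0r.
rewrite !wide ?fsubsetUl ?fsubsetUr //; last first.
  apply: fsubset_trans (msuppD_le _ _) _; apply: fsetSU.
  exact: msuppZ_le.
rewrite scaler_sumr -big_split; apply: eq_bigr => b _ /=.
by rewrite mcoeffD mcoeffZ scalerDl scalerA.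
Qed.

Lemma multilinear_mlx h : multilinear (fun xs => mlx xs h).
Proof.
move=> s1; elim: s1 h => [|z s1 IHs] h s2 a x y /=.
  exact: big_msupp_linear.
rewrite scaler_sumr -big_split; apply: eq_bigr => b _ /=.
by rewrite IHs scalerDr !scalerA mulrC.
Qed.

Lemma mlx_basis h bs : mlx [seq bvec b | b <- bs] h = h bs.
Proof.
elim: bs h => [|b bs IHbs] h //=.
by rewrite msuppU oner_eq0 big_seq_fset1 mcoeffUU scale1r IHbs.
Qed.

Lemma multilinear_mlxE (G : seq Bv -> W) xs : multilinear G ->
  G xs = mlx xs (fun bs => G [seq bvec b | b <- bs]).
Proof.
elim: xs G => [|x xs IHxs] G GL //=.
have sumG (r : seq Bbasis) (c : Bbasis -> 'F_2) : G ((\sum_(b <- r) c b *: bvec b) :: xs) =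
    \sum_(b <- r) c b *: G (bvec b :: xs).
  elim: r => [|b r IHr]; first by rewrite !big_nil; apply: (multilinear0 [::]).
  by rewrite !big_cons (GL [::]) IHr.
have xE : x = \sum_(b <- msupp x) monalg.mcoeff b x *: bvec b.
  rewrite {1}[x]monalgE; apply: eq_bigr => b _.
  by apply/malgP => k; rewrite mcoeffZ !mcoeffU mulrnAr mulr1.
rewrite {1}xE sumG; apply: eq_bigr => b _; congr (_ *: _).
by apply: (IHxs (fun s => G (bvec b :: s))); apply: multilinear_cons.
Qed.

Lemma multilinear_ext (G H : seq Bv -> W) : multilinear G -> multilinear H ->
  (forall bs, G [seq bvec b | b <- bs] = H [seq bvec b | b <- bs]) -> G =1 H.
Proof.
by move=> GL HL GH xs; rewrite !multilinear_mlxE //; apply: eq_mlx.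
Qed.
End Extension.

Lemma muBE xs : muB xs = mlx xs muB_basis.
Proof. by rewrite /muB; elim: xs muB_basis => //= x xs IHxs h; apply: eq_bigr => b _; rewrite IHxs. Qed.

Lemma multilinear_muB : multilinear muB.
Proof. by move=> s1 s2 a x y; rewrite !muBE; apply: multilinear_mlx. Qed.

Lemma muB_bvec bs : muB [seq bvec b | b <- bs] = oapp (fun b => bvec b) 0 (muo bs).
Proof. by rewrite muBE mlx_basis muB_basisE. Qed.

Lemma ssum_map (T U : Type) (W : nmodType) (g : T -> U) (s : seq T) (Phi : seq U -> seq U -> W) :
  ssum (map g s) Phi = ssum s (fun u v => Phi (map g u) (map g v)).
Proof. by elim: s Phi => //= x s IHs Phi; rewrite IHs. Qed.

Lemma ins_muB_bvec (W : lmodType 'F_2) (h : seq Bbasis -> W) bs :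
  ins muB (fun xs => mlx xs h) [seq bvec b | b <- bs] =
  ssum bs (fun u z => ssum z (fun m v => oapp (fun b => h (u ++ b :: v)) 0 (muo m))).
Proof.
rewrite /ins ssum_map; apply: eq_ssum => u z; rewrite ssum_map; apply: eq_ssum => m v.
rewrite muB_bvec; case: (muo m) => [b|] /=; last exact: (multilinear0 _ _ (@multilinear_mlx W h)).
by rewrite -[_ :: _]/([seq bvec b | b <- b :: v]) -map_cat mlx_basis.
Qed.

(** * A morphism with injective linear part forces the A-infinity relations *)

Section AinfFromMorphism.
Variables (V : lmodType 'F_2) (mu : seq V -> V) (R : pzRingType) (D : R).
Variable M : seq V -> R.
Hypothesis char2 : forall x : R, x + x = 0.
Hypothesis D2 : forall x : R, D * D * x = x * (D * D).
Hypothesis M0 : forall u v, M (u ++ 0 :: v) = 0.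
Hypothesis MD : forall u x y v, M (u ++ (x + y) :: v) = M (u ++ x :: v) + M (u ++ y :: v).
Hypothesis M_inj : forall x, M [:: x] = 0 -> x = 0.
Hypothesis mu_nil : mu [::] = 0.
Hypothesis M_eq : forall s, ins mu M s = M s * D + D * M s + ssum s (fun u v => M u * M v).

Let M_ssum u (s : seq V) (Phi : seq V -> seq V -> V) v :
  M (u ++ ssum s Phi :: v) = ssum s (fun a b => M (u ++ Phi a b :: v)).
Proof. by elim: s Phi => //= x s IHs Phi; rewrite MD IHs. Qed.

(** Using the morphism equation twice expresses the left side through [M], [D] and products. All
    terms cancel in pairs; those with two factors [D] on one side do so because [D * D] is
    central. *)
Let ins_ins0 s : ins mu (ins mu M) s = 0.
Proof.
pose N t := M t * D + D * M t + ssum t (fun u v => M u * M v).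
rewrite (eq_ins mu M_eq) !insD ins_conv.
have -> : ins mu (fun t => M t * D) s = ins mu M s * D.
  by rewrite /ins ssum_mulrr; apply: eq_ssum => u z; rewrite ssum_mulrr.
have -> : ins mu (fun t => D * M t) s = D * ins mu M s.
  by rewrite /ins ssum_mulrl; apply: eq_ssum => u z; rewrite ssum_mulrl.
rewrite M_eq.
have -> : ssum s (fun u v => ins mu M u * M v) = ssum s (fun u v => M u * D * M v)
   + D * ssum s (fun u v => M u * M v) + ssum s (fun u v => ssum u (fun u1 u2 => M u1 * M u2 * M v)).
  rewrite ssum_mulrl -!ssumD; apply: eq_ssum => u v; rewrite M_eq !mulrDl !mulrA.
  by rewrite ssum_mulrr.
have -> : ssum s (fun u v => M u * ins mu M v) = ssum s (fun u v => M u * M v) * D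
   + ssum s (fun u v => M u * D * M v) + ssum s (fun u v => ssum u (fun u1 u2 => M u1 * M u2 * M v)).
  rewrite -ssum_assoc ssum_mulrr -!ssumD; apply: eq_ssum => u v; rewrite M_eq !mulrDr !mulrA.
  by rewrite ssum_mulrl; congr (_ + _); apply: eq_ssum => v1 v2; rewrite mulrA.
set A := ssum s (fun u v => M u * M v); set B := ssum s (fun u v => M u * D * M v).
set C := ssum s _.
rewrite !mulrDl !mulrDr !mulrA D2 -!mulrA.
have cancel (a b c x y z : R) :
    a + b + c + (b + a + x) + (y + x + z + (c + y + z)) = 0.
  rewrite !addrA (ACl ((1*5)*(2*4)*(3*10)*(6*8)*(7*11)*(9*12)))%AC /=.
  by rewrite !char2 ?addr0.
exact: cancel.
Qed.

Let ins_mu_mu_M s : ssum s (fun u z => ssum z (fun m v => M (u ++ ins mu mu m :: v))) = 0.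
Proof.
rewrite -[RHS](ins_ins0 s) ins_ins //; apply: eq_ssum => u z; apply: eq_ssum => m v.
by rewrite M_ssum; apply: eq_ssum => u2 y; rewrite M_ssum.
Qed.

(** By induction on the length the relation holds on proper windows. In the vanishing sum over all
    windows only the full one is left, and the linear part of [M] is injective. *)
Lemma ins_mu_mu0 s : ins mu mu s = 0.
Proof.
elim: {s}(size s).+1 {-2}s (ltnSn (size s)) => // n IHn s ltsn.
have small m u v : (size m < size s)%N -> M (u ++ ins mu mu m :: v) = 0.
  by move=> ltms; rewrite IHn ?M0 // (leq_trans ltms).
apply: M_inj; rewrite -[RHS](ins_mu_mu_M s) (@ssum_unique _ _ _ [::] s) //.
  rewrite (@ssum_unique _ _ _ s [::]) ?cats0 // => m v mv nm; apply: small.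
  by rewrite -mv size_cat; case: v mv => [|x v] mv; [rewrite cats0 in mv | rewrite addnS ltnS leq_addr].
move=> [//|x u] z uz _; apply: ssum0 => m v mv; apply: small.
by rewrite -uz -mv !size_cat /= addSn ltnS addnCA leq_addr.
Qed.
End AinfFromMorphism.

(** * The homology of A *)

Lemma ord4_ind (P : 'I_4 -> Prop) : P o0 -> P o1 -> P o2 -> P o3 -> forall i, P i.
Proof.
move=> P0 P1 P2 P3 [[|[|[|[|//]]]] lti].
- by rewrite (_ : Ordinal lti = o0) //; apply: val_inj.
- by rewrite (_ : Ordinal lti = o1) //; apply: val_inj.
- by rewrite (_ : Ordinal lti = o2) //; apply: val_inj.
by rewrite (_ : Ordinal lti = o3) //; apply: val_inj.
Qed.

Definition mxA (f : Aalg) : mat := \matrix_(i, j) f (i, j).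
Definition toA (M : mat) : Aalg := [ffun ij => M ij.1 ij.2].

Lemma toAK : cancel toA mxA.
Proof. by move=> M; apply/matrixP => i j; rewrite !mxE ffunE. Qed.

Lemma mxAK : cancel mxA toA.
Proof. by move=> f; apply/ffunP => -[i j]; rewrite ffunE mxE. Qed.

Lemma mxA_inj : injective mxA. Proof. exact: can_inj mxAK. Qed.

Lemma mxA0 : mxA 0 = 0.
Proof. by apply/matrixP => i j; rewrite !mxE ffunE. Qed.

Lemma mxAD f g : mxA (f + g) = mxA f + mxA g.
Proof. by apply/matrixP => i j; rewrite !mxE ffunE. Qed.

Lemma mxAM f g : mxA (Acomp f g) = mxA f * mxA g.
Proof. by apply/matrixP => i j; rewrite !mxE ffunE; apply: eq_bigr => k _; rewrite !mxE. Qed.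

Lemma mxA_ssum (T : Type) (s : seq T) (Phi : seq T -> seq T -> Aalg) :
  mxA (ssum s Phi) = ssum s (fun u v => mxA (Phi u v)).
Proof. by elim: s Phi => //= x s IHs Phi; rewrite mxAD IHs. Qed.

(* [md0] maps the basis vector e_j to [dl j] e_(sg j). *)
Definition sg (i : 'I_4) : 'I_4 :=
  if i == o0 then o1 else if i == o1 then o0 else if i == o2 then o3 else o2.

Definition dl (i : 'I_4) : Rd :=
  if i == o0 then px else if i == o1 then py * pz else if i == o2 then py else px * pz.

Lemma md0E k j : md0 k j = if k == sg j then dl j else 0.
Proof.
rewrite /md0 /mx_of /ld0 !big_cons big_nil !mxE /= !expr0 !expr1 !mul1r !mulr1.
elim/ord4_ind: k; elim/ord4_ind: j; rewrite /sg /dl /= ?mulr0 ?mulr1 ?addr0 ?add0r //.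
Qed.

Lemma mxA_d0 : mxA d0 = md0.
Proof.
apply/matrixP => i j; rewrite md0E mxE ffunE /=.
by elim/ord4_ind: i; elim/ord4_ind: j.
Qed.

Lemma sgK : involutive sg.
Proof. by elim/ord4_ind. Qed.

Lemma mul_md0 (N : mat) i j : (N * md0) i j = N i (sg j) * dl j.
Proof.
rewrite mxE (bigD1 (sg j)) //= md0E eqxx big1 ?addr0 // => k /negbTE nk.
by rewrite md0E nk mulr0.
Qed.

Lemma md0_mul (N : mat) i j : (md0 * N) i j = dl (sg i) * N (sg i) j.
Proof.
rewrite mxE (bigD1 (sg i)) //= md0E sgK eqxx big1 ?addr0 // => k nk.
by rewrite md0E eq_sym (inv_eq sgK) (negbTE nk) mul0r.
Qed.

Definition bnd (N : mat) : mat := N * md0 + md0 * N.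

Lemma bndE N i j : bnd N i j = N i (sg j) * dl j + dl (sg i) * N (sg i) j.
Proof. by rewrite mxE mul_md0 md0_mul. Qed.

Lemma bndD M N : bnd (M + N) = bnd M + bnd N.
Proof. by rewrite /bnd mulrDl mulrDr addrACA. Qed.

Lemma AcompDl a (f g h : Aalg) : Acomp (a *: f + g) h = a *: Acomp f h + Acomp g h.
Proof.
apply/ffunP => ij; rewrite !ffunE scaler_sumr -big_split; apply: eq_bigr => k _ /=.
by rewrite !ffunE mulrDl scalerAl.
Qed.

Lemma AcompDr a (f g h : Aalg) : Acomp h (a *: f + g) = a *: Acomp h f + Acomp h g.
Proof.
apply/ffunP => ij; rewrite !ffunE scaler_sumr -big_split; apply: eq_bigr => k _ /=.
by rewrite !ffunE mulrDr scalerAr.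
Qed.

Lemma multilinear_muA : multilinear muA.
Proof.
move=> [|u [|u' [|u'' s1]]] [|v [|v' s2]] a x y //=; rewrite ?scaler0 ?addr0 //.
- by rewrite AcompDl AcompDr scalerDr addrACA.
- exact: AcompDl.
exact: AcompDr.
Qed.

Lemma md0_sqr : md0 * md0 = (px * py * pz)%:M.
Proof.
apply/matrixP => i j; rewrite mul_md0 md0E sgK [RHS]mxE.
case: (i =P j) => [_|_]; last by rewrite mul0r.
rewrite mulr1n; elim/ord4_ind: j; rewrite /sg /dl /=.
- by rewrite mulrC mulrA.
- by rewrite mulrA.
- by rewrite mulrAC.
by rewrite mulrCA mulrA.
Qed.

Lemma md0_sqrC (N : mat) : md0 * md0 * N = N * (md0 * md0).
Proof. by rewrite md0_sqr; exact: esym (@scalar_mxC Rd 4 4 _ N). Qed.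

Lemma mxA_muA1 x : mxA (muA [:: x]) = bnd (mxA x).
Proof. by rewrite mxAD !mxAM mxA_d0. Qed.

Lemma ssum_eq0 (T : Type) (W : nmodType) (s : seq T) (Phi : seq T -> seq T -> W) :
  (forall u v, Phi u v = 0) -> ssum s Phi = 0.
Proof. by move=> P0; apply: ssum0 => u v _. Qed.

(* The tautological morphism into the matrix ring, with no higher components. *)
Lemma is_Ainf_algebra_muA : is_Ainf_algebra muA.
Proof.
pose M s := if s is [:: x] then mxA x else 0.
split=> [||s]; [exact: multilinear_muA | by [] |].
rewrite (insert_sumE _ multilinear_muA) //.
apply: (@ins_mu_mu0 _ muA _ md0 M).
- exact: mat_char2.
- exact: md0_sqrC.
- by move=> [|? []] [] //=; rewrite mxA0.
- by move=> [|? [|? ?]] ? ? [|? ?]; rewrite /= ?mxAD ?addr0.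
- by move=> x /= Mx; apply: mxA_inj; rewrite Mx mxA0.
move=> {}s; rewrite /ins (@ssum_unique _ _ _ [::] s) //; last first.
  by move=> [//|u0 u] z _ _; apply: ssum_eq0 => p [|? ?]; case: u.
rewrite (@ssum_unique _ _ _ s [::]) ?cats0 //; last by move=> p [|? ?] //=; rewrite cats0 => ->.
rewrite [M _]/=; case: s => [|x [|y [|z s]]].
- by rewrite /= mxA0 !(mulr0, mul0r, addr0).
- by rewrite mxA_muA1 /= !(mulr0, mul0r, addr0).
- by rewrite /= mxAM !(mulr0, mul0r, addr0, add0r).
rewrite [muA _]/= mxA0 [M _]/= mul0r mulr0 !add0r ssum0 // => -[|u [|u' us]] [|v [|v' vs]] //= _;
  by rewrite ?mul0r ?mulr0.
Qed.

(** * The morphism *)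

Lemma midemM v v' : midem v * midem v' = if v == v' then midem v else 0.
Proof. by rewrite /midem mx_ofM -mx_of_nil; case: v v' => [] []; apply: mx_of_eq. Qed.

Lemma midem_cycle v : midem v * md0 + md0 * midem v = 0.
Proof. by rewrite /midem /md0 !mx_ofM mx_ofD -mx_of_nil; case: v; apply: mx_of_eq. Qed.

Definition functor_series : series mat :=
  proj1_sig (constructive_indefinite_description _ exists_functor_series).

Definition functor_basis (bs : seq Bbasis) : mat := fb functor_series midem bs.

Lemma functor_basis_eq bs :
  ssum bs (fun u z => ssum z (fun m v => oapp (fun b => functor_basis (u ++ b :: v)) 0 (muo m))) =
  functor_basis bs * md0 + md0 * functor_basis bs
  + ssum bs (fun u v => functor_basis u * functor_basis v).
Proof.
rewrite /functor_basis /functor_series.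
case: (constructive_indefinite_description _ _) => F [/= Feq evF Fev _ _].
exact: (functor_eq mat_char2 Feq evF Fev midemM midem_cycle).
Qed.

Definition functor (xs : seq Bv) : Aalg := mlx xs (fun bs => toA (functor_basis bs)).

Lemma multilinear_functor : multilinear functor.
Proof. exact: multilinear_mlx. Qed.

Lemma toA0 : toA 0 = 0.
Proof. by apply/ffunP => ij; rewrite !ffunE mxE. Qed.

Lemma functor_nil : functor [::] = 0.
Proof. exact: toA0. Qed.

Lemma functor_bvec bs : functor [seq bvec b | b <- bs] = toA (functor_basis bs).
Proof. exact: mlx_basis. Qed.

Lemma ins_functor_basis bs :
  mxA (ins muB functor [seq bvec b | b <- bs]) =
  bnd (functor_basis bs) + ssum bs (fun u v => functor_basis u * functor_basis v).
Proof.
rewrite -functor_basis_eq ins_muB_bvec mxA_ssum; apply: eq_ssum => u z.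
rewrite mxA_ssum; apply: eq_ssum => m v.
by case: (muo m) => [b|] /=; [apply: toAK | apply: mxA0].
Qed.

Lemma ins_functor s :
  ins muB functor s = muA [:: functor s] + ssum s (fun u v => Acomp (functor u) (functor v)).
Proof.
have fL := multilinear_functor; have aL := multilinear_muA; move: s; apply: multilinear_ext.
- exact: multilinear_ins multilinear_muB.
- apply: multilinear_eq_add => [s1 s2 a x y|]; first by rewrite fL; apply: (aL [::]).
  apply: multilinear_ssum => [v|u] s1 s2 a x y; rewrite fL; first exact: AcompDl.
  exact: AcompDr.
move=> bs; apply: mxA_inj; rewrite ins_functor_basis mxAD mxA_muA1 functor_bvec toAK.
congr (_ + _); rewrite ssum_map mxA_ssum; apply: eq_ssum => u v.
by rewrite mxAM !functor_bvec !toAK.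
Qed.

Lemma is_Ainf_morphism_functor : is_Ainf_morphism muB muA functor.
Proof.
split=> [||s]; [exact: multilinear_functor | exact: functor_nil |].
have muB0 : muB [::] = 0 by [].
rewrite (insert_sumE _ multilinear_functor muB0) ins_functor.
have Ac0 f : Acomp 0 f = 0 by have := AcompDl (-1) f f f; rewrite !scaleN1r !addNr.
have Acr0 f : Acomp f 0 = 0.
  by have := AcompDr (-1) f f f; rewrite !scaleN1r !addNr.
case: s => [|x s].
  by rewrite big_cons big_nil /= functor_nil !Ac0 !Acr0 !addr0.
rewrite big_compositions => [|? ? ? ?] //; congr (_ + _).
rewrite /= functor_nil Ac0 add0r; apply: eq_ssum => u [|y v] //=.
by rewrite functor_nil Acr0.
Qed.

(** * The linear part of the morphism *)

(** Products of the matrices [T1]: two consecutive S-arrows multiply to z times an idempotent, hence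
    the halves of [n]. *)
Definition llin (b : Bbasis) : entries :=
  match b with
  | Be v => lidem v
  | BD false n => [:: ((0, n.+1, 0), (o0, o0)); ((0, n.+1, 0), (o1, o1))]
  | BD true n => [:: ((n.+1, 0, 0), (o2, o2)); ((n.+1, 0, 0), (o3, o3))]
  | BS false n =>
      if odd n then [:: ((0, 0, n./2.+1), (o1, o1)); ((0, 0, n./2.+1), (o0, o0))]
      else [:: ((0, 0, n./2), (o1, o2)); ((0, 0, n./2.+1), (o0, o3))]
  | BS true n =>
      if odd n then [:: ((0, 0, n./2.+1), (o3, o3)); ((0, 0, n./2.+1), (o2, o2))]
      else [:: ((0, 0, n./2), (o3, o0)); ((0, 0, n./2.+1), (o2, o1))]
  end%N.

Lemma functor_series_nseq q n : functor_series q (nseq n Ext) = mx_of (llin (letter q n)).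
Proof.
rewrite /functor_series.
case: (constructive_indefinite_description _ _) => F [/= _ _ _ F0 FS].
elim: n q => [|n IHn] q; first by rewrite F0 /T1; case: q => [] [] [].
rewrite [nseq _ _]/= FS IHn /T1 mx_ofM; congr mx_of.
case: q => [] [] [] //=; rewrite /letter /= ?uphalf_half; case: (odd n) => //=.
Qed.

Lemma functor_basis1 b : functor_basis [:: b] = mx_of (llin b).
Proof.
have gen : nonidem b -> functor_series (bst b) (wd [:: b]) = mx_of (llin b).
  by move=> nb; rewrite /wd /te cats0 functor_series_nseq -letter_bst.
by rewrite /functor_basis /fb; case: b gen => [v|v n|v n] gen //; apply: gen.
Qed.

Definition mon (e : nat * nat * nat) : multinom 3 :=
  [multinom nth 0%N [:: e.1.1; e.1.2; e.2] i | i < 3].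

Lemma monE e : 'X_[mon e] = px ^+ e.1.1 * py ^+ e.1.2 * pz ^+ e.2.
Proof.
have iE (k : nat) (i : 'I_3) : k = i :> nat -> inord k = i by move->; exact: inord_val.
rewrite /px /py /pz (iE 0%N ord0) // (iE 1%N (lift ord0 ord0)) // (iE 2%N (lift ord0 (lift ord0 ord0))) //.
by rewrite mpolyXE_id !big_ord_recl big_ord0 mulr1 !mnmE mulrA.
Qed.

Lemma mon_inj : injective mon.
Proof.
move=> [[a b] c] [[a' b'] c'] /mnmP e.
by move: (e ord0) (e (lift ord0 ord0)) (e (lift ord0 (lift ord0 ord0)));
  rewrite !mnmE /= => -> -> ->.
Qed.

Definition not_below (d e : nat * nat * nat) : bool :=
  [|| e.1.1 < d.1.1, e.1.2 < d.1.2 | e.2 < d.2]%N.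

Lemma not_below_le d e : not_below d e -> ~~ (mon d <= mon e)%MM.
Proof.
apply: contraL => /mnm_lepP le; rewrite /not_below !negb_or -!leqNgt.
by move: (le ord0) (le (lift ord0 ord0)) (le (lift ord0 (lift ord0 ord0)));
  rewrite !mnmE /= => -> -> ->.
Qed.

Lemma mcoeff_not_below (p : Rd) d e : not_below d e -> (p * 'X_[mon d])@_(mon e) = 0.
Proof.
move=> /not_below_le nle; apply/eqP; rewrite mpoly.mcoeff_eq0 (perm_mem (msuppMX _ _)).
by apply/mapP => -[m _ e_m]; move: nle; rewrite e_m lem_addr.
Qed.

Definition coefA (t : (nat * nat * nat) * ('I_4 * 'I_4)) (f : Aalg) : 'F_2 := (f t.2)@_(mon t.1).

Lemma coefA_sum (I : Type) (r : seq I) (c : I -> 'F_2) (g : I -> Aalg) t :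
  coefA t (\sum_(i <- r) c i *: g i) = \sum_(i <- r) c i * coefA t (g i).
Proof.
elim: r => [|i r IHr]; first by rewrite !big_nil /coefA ffunE mpoly.mcoeff0.
by rewrite !big_cons -IHr /coefA !ffunE mpoly.mcoeffD mpoly.mcoeffZ.
Qed.

Lemma coefA_mx_of t l : coefA t (toA (mx_of l)) = (count_mem t l)%:R.
Proof.
elim: l => [|u l IHl].
  by rewrite mx_of_nil /coefA ffunE mxE mpoly.mcoeff0.
rewrite /= natrD -IHl /mx_of big_cons /coefA !ffunE [in LHS]mxE mpoly.mcoeffD; congr (_ + _).
rewrite mxE -monE mxE {IHl}; case: u t => [e [i j]] [e' [i' j']] /=.
rewrite mulr_natr mpoly.mcoeffMn mpoly.mcoeffX (inj_eq mon_inj) !xpair_eqE.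
by rewrite (eq_sym i') (eq_sym j'); case: (e == e'); case: (i == i'); case: (j == j').
Qed.

(* A monomial entry that occurs in the image of [b] and of no other basis
   element, and in no boundary. *)
Definition lead (b : Bbasis) := head ((0, 0, 0)%N, (o0, o0)) (llin b).

Lemma count_lead b b' : count_mem (lead b) (llin b') = (b' == b) :> nat.
Proof.
have eD v n n' : (BD v n' == BD v n) = (n' == n) by apply/eqP/eqP => [[->]|->].
have eS v n n' : (BS v n' == BS v n) = (odd n' == odd n) && (n'./2 == n./2).
  apply/eqP/andP => [[->]|[/eqP on /eqP hn]] //.
  by rewrite -(odd_double_half n) -(odd_double_half n') on hn.
case: b b' => [v|v n|v n] [v'|v' n'|v' n'].
all: rewrite /lead /=; try (case: v); try (case: v'); rewrite ?eD ?eS /=.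
all: try case on: (odd n); try case on': (odd n') => //=.
all: by rewrite ?xpair_eqE ?eqSS ?eqxx /= ?andbF ?andbT ?addn0.
Qed.

Definition dle (i : 'I_4) : nat * nat * nat :=
  if i == o0 then (1, 0, 0) else if i == o1 then (0, 1, 1)
  else if i == o2 then (0, 1, 0) else (1, 0, 1).

Lemma dlE i : dl i = 'X_[mon (dle i)].
Proof.
by rewrite monE; elim/ord4_ind: i; rewrite /dl /dle /= ?expr1 ?expr0 ?mul1r ?mulr1.
Qed.

(** An entry of a boundary lies in the ideal generated by the coefficients of [md0] for its row and
    its column; the leading monomial is divisible by neither of them. *)
Lemma lead_not_below b :
  not_below (dle (lead b).2.2) (lead b).1 && not_below (dle (sg (lead b).2.1)) (lead b).1.
Proof.
by case: b => [[]|[] n|[] n]; rewrite /lead /=; try case: (odd n).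
Qed.

Lemma coefA_boundary b w : coefA (lead b) (muA [:: w]) = 0.
Proof.
have /andP[nb nb'] := lead_not_below b.
have -> : muA [:: w] = toA (bnd (mxA w)) by rewrite -mxA_muA1 mxAK.
rewrite /coefA ffunE bndE mpoly.mcoeffD !dlE (mulrC 'X_[_]).
by rewrite !mcoeff_not_below ?addr0.
Qed.

Lemma coefA_functor b x : coefA (lead b) (functor [:: x]) = monalg.mcoeff b x.
Proof.
have -> : functor [:: x] = \sum_(b <- msupp x) monalg.mcoeff b x *: toA (functor_basis [:: b]) by [].
rewrite coefA_sum; under eq_bigr => c _ do rewrite functor_basis1 coefA_mx_of count_lead.
case: (boolP (b \in msupp x)) => bx.
  rewrite (big_fsetD1 b) //= eqxx mulr1 big_seq big1 ?addr0 // => c.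
  by rewrite in_fsetD1 => /andP[/negbTE-> _]; rewrite mulr0.
rewrite (mcoeff_outdom bx) big_seq big1 // => c cx.
by case: (c =P b) => [cb|_]; [rewrite -cb cx in bx | rewrite mulr0].
Qed.

(** The coefficients at the leading entries are dual to the basis of B and vanish on boundaries.
    This gives injectivity on homology and, with [w = 0], of the linear part. *)
Lemma functor_eq_boundary x w : functor [:: x] = muA [:: w] -> x = 0.
Proof.
move=> fx; apply/malgP => b.
by rewrite -coefA_functor fx coefA_boundary mcoeff0.
Qed.

Lemma is_Ainf_algebra_muB : is_Ainf_algebra muB.
Proof.
have fL := multilinear_functor.
split=> [||s]; [exact: multilinear_muB | by [] |].
rewrite (insert_sumE _ multilinear_muB) //.
apply: (@ins_mu_mu0 _ muB _ md0 (fun s => mxA (functor s))).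
- exact: mat_char2.
- exact: md0_sqrC.
- by move=> u v; rewrite (multilinear0 _ _ fL) mxA0.
- by move=> u x y v; rewrite (multilinearD _ _ _ _ fL) mxAD.
- move=> x fx; apply: (@functor_eq_boundary _ 0).
  by apply: mxA_inj; rewrite fx mxA_muA1 mxA0 /bnd mul0r mulr0 addr0.
move=> {}s; transitivity (mxA (ins muB functor s)).
  by rewrite mxA_ssum; apply: eq_ssum => u z; rewrite mxA_ssum.
rewrite ins_functor mxAD mxA_muA1 mxA_ssum; congr (_ + _).
by apply: eq_ssum => u v; rewrite mxAM.
Qed.

(** * Every cocycle of A is homologous to an image *)

Definition hit (N : mat) := exists x w, N = mxA (functor [:: x]) + bnd w.

Lemma hitD M N : hit M -> hit N -> hit (M + N).
Proof.
move=> [x [w ->]] [x' [w' ->]]; exists (x + x'), (w + w').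
by rewrite (multilinearD [::] _ _ _ multilinear_functor) mxAD bndD addrACA.
Qed.

Lemma hit_bnd w : hit (bnd w).
Proof. by exists 0, w; rewrite (multilinear0 [::] _ multilinear_functor) mxA0 add0r. Qed.

Lemma hit_basis b : hit (mx_of (llin b)).
Proof.
exists << b >>, 0; rewrite (functor_bvec [:: b]) toAK functor_basis1.
by rewrite /bnd mul0r mulr0 !addr0.
Qed.

Lemma Rd_ind (P : Rd -> Prop) : P 0 -> (forall p q, P p -> P q -> P (p + q)) ->
  (forall a b c, P (px ^+ a * py ^+ b * pz ^+ c)) -> forall p, P p.
Proof.
move=> P0 PD PX; elim/mpolyind => // c m p _ _ Pp; apply: PD => //.
have -> : m = mon (m ord0, m (lift ord0 ord0), m (lift ord0 (lift ord0 ord0))).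
  apply/mnmP => -[[|[|[|//]]] lti]; rewrite mnmE /=; congr (m _); exact: val_inj.
rewrite monE; case: c => -[|[|//]] ltc.
  by rewrite (_ : Ordinal ltc = 0) ?scale0r //; apply: val_inj.
by rewrite (_ : Ordinal ltc = 1) ?scale1r //; apply: val_inj.
Qed.

Lemma hit_scaled (X : mat) : (forall a b c, hit ((px ^+ a * py ^+ b * pz ^+ c) *: X)) ->
  forall r, hit (r *: X).
Proof.
move=> hX; elim/Rd_ind => [|p q hp hq|//].
  by rewrite scale0r; have := hit_bnd 0; rewrite /bnd mul0r mulr0 addr0.
by rewrite scalerDl; apply: hitD.
Qed.

Lemma delta_boundary_entry (R : comPzRingType) (d : 'I_4 -> R) (r : R) i j k l :
  (r *: delta_mx i j : 'M_4) k (sg l) * d l + d (sg k) * (r *: delta_mx i j : 'M_4) (sg k) l =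
  ((r * d (sg j)) *: delta_mx i (sg j) + (d i * r) *: delta_mx (sg i) j : 'M_4) k l.
Proof.
rewrite !mxE (inv_eq sgK l) (inv_eq sgK k); congr (_ + _).
  case: (k == i); rewrite ?mulr0 ?mul0r //=.
  by case: (l =P sg j) => [->|_]; rewrite ?sgK ?mulr1 ?mulr0 ?mul0r.
case: (k =P sg i) => [->|_] /=; last by rewrite !mulr0.
by case: (l == j); rewrite ?sgK ?mulr1 ?mulr0.
Qed.

Lemma bnd_delta r i j : bnd (r *: delta_mx i j) =
  (r * dl (sg j)) *: delta_mx i (sg j) + (dl i * r) *: delta_mx (sg i) j.
Proof. by apply/matrixP => k l; rewrite bndE; exact: delta_boundary_entry. Qed.

Lemma hit_bnd_delta r i j :
  hit ((r * dl (sg j)) *: delta_mx i (sg j) + (dl i * r) *: delta_mx (sg i) j).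
Proof. by rewrite -bnd_delta; apply: hit_bnd. Qed.

Lemma hit_basis2 b t u : llin b = [:: t; u] -> hit (entry t + entry u).
Proof.
move=> eb; have := hit_basis b; rewrite eb -[[:: t; u]]/([:: t] ++ [:: u]) -mx_ofD.
by rewrite /mx_of !big_seq1.
Qed.

Lemma monomialSl (S : comPzRingType) (x y z : S) a b c :
  x ^+ a.+1 * y ^+ b * z ^+ c = x ^+ a * y ^+ b * z ^+ c * x.
Proof. by rewrite exprSr (mulrAC _ x) (mulrAC _ x). Qed.

Lemma monomialSm (S : comPzRingType) (x y z : S) a b c :
  x ^+ a * y ^+ b.+1 * z ^+ c = x ^+ a * y ^+ b * z ^+ c * y.
Proof. by rewrite exprSr mulrA (mulrAC _ y). Qed.

Lemma monomialSr (S : comPzRingType) (x y z : S) a b c :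
  x ^+ a * y ^+ b * z ^+ c.+1 = x ^+ a * y ^+ b * z ^+ c * z.
Proof. by rewrite exprSr mulrA. Qed.

Lemma hit_addC M N : hit (M + N) -> hit (N + M).
Proof. by rewrite addrC. Qed.

Lemma hit_basis2r b t u : llin b = [:: u; t] -> hit (entry t + entry u).
Proof. by move=> eb; apply/hit_addC/(hit_basis2 eb). Qed.

(** Multiples of x and of y z are boundaries, of entries at (0, 1) and (1, 0). The monomials left
    are 1 and the powers of y and of z: images of the idempotent, of powers of D, and of S-words of
    even length. *)
Lemma hit_idem0 r : hit (r *: (delta_mx o0 o0 + delta_mx o1 o1)).
Proof.
move: r; apply: hit_scaled => -[|a] b c; last first.
  rewrite monomialSl scalerDr; set r := (X in X * px).
  by have := hit_bnd_delta r o0 o1; rewrite /sg /dl /= (mulrC px).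
case: b c => [|b] [|c]; last first.
- rewrite monomialSm monomialSr scalerDr; set r := (X in X * pz * py).
  have := hit_bnd_delta r o1 o0; rewrite /sg /dl /= (mulrC _ r) (mulrC py) mulrA.
  exact: hit_addC.
- rewrite scalerDr; exact: (@hit_basis2 (BD false b) ((0, b.+1, 0)%N, (o0, o0)) ((0, b.+1, 0)%N, (o1, o1))).
- rewrite scalerDr; apply: (@hit_basis2r (BS false c.*2.+1) ((0, 0, c.+1)%N, (o0, o0)) ((0, 0, c.+1)%N, (o1, o1))).
  by rewrite /= odd_double /= uphalf_double.
- rewrite scalerDr; exact: (@hit_basis2 (Be false) ((0, 0, 0)%N, (o0,o0)) ((0, 0, 0)%N, (o1,o1))).
Qed.

Lemma hit_idem1 r : hit (r *: (delta_mx o2 o2 + delta_mx o3 o3)).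
Proof.
move: r; apply: hit_scaled => a [|b] c; last first.
  rewrite monomialSm scalerDr; set r := (X in X * py).
  by have := hit_bnd_delta r o2 o3; rewrite /sg /dl /= (mulrC py).
case: a c => [|a] [|c]; last first.
- rewrite monomialSl monomialSr scalerDr; set r := (X in X * pz * px).
  have := hit_bnd_delta r o3 o2; rewrite /sg /dl /= (mulrC _ r) (mulrC px) mulrA.
  exact: hit_addC.
- rewrite scalerDr; exact: (@hit_basis2 (BD true a) ((a.+1, 0, 0)%N, (o2, o2)) ((a.+1, 0, 0)%N, (o3, o3))).
- rewrite scalerDr; apply: (@hit_basis2r (BS true c.*2.+1) ((0, 0, c.+1)%N, (o2, o2)) ((0, 0, c.+1)%N, (o3, o3))).
  by rewrite /= odd_double /= uphalf_double.
- rewrite scalerDr; exact: (@hit_basis2 (Be true) ((0, 0, 0)%N, (o2,o2)) ((0, 0, 0)%N, (o3,o3))).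
Qed.

(** Multiples of x and of y are boundaries; the powers of z left over are the images of the S-words
    of odd length. *)
Lemma hit_arrow1 r : hit (r *: (delta_mx o3 o0 + pz *: delta_mx o2 o1)).
Proof.
move: r; apply: hit_scaled => -[|a] b c; last first.
  rewrite monomialSl scalerDr scalerA; set r := (X in X * px).
  by have := hit_bnd_delta r o3 o1; rewrite /sg /dl /= (mulrC _ r) mulrA.
case: b => [|b]; last first.
  rewrite monomialSm scalerDr scalerA; set r := (X in X * py).
  have := hit_bnd_delta r o2 o0; rewrite /sg /dl /= (mulrC _ r) mulrA; exact: hit_addC.
rewrite scalerDr scalerA -monomialSr.
apply: (@hit_basis2 (BS true c.*2) ((0, 0, c)%N, (o3, o0)) ((0, 0, c.+1)%N, (o2, o1))).
by rewrite /= odd_double /= doubleK.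
Qed.

Lemma hit_arrow0 r : hit (r *: (delta_mx o1 o2 + pz *: delta_mx o0 o3)).
Proof.
move: r; apply: hit_scaled => -[|a] b c; last first.
  rewrite monomialSl scalerDr scalerA; set r := (X in X * px).
  have := hit_bnd_delta r o0 o2; rewrite /sg /dl /= (mulrC _ r) mulrA; exact: hit_addC.
case: b => [|b]; last first.
  rewrite monomialSm scalerDr scalerA; set r := (X in X * py).
  by have := hit_bnd_delta r o1 o3; rewrite /sg /dl /= (mulrC _ r) mulrA.
rewrite scalerDr scalerA -monomialSr.
apply: (@hit_basis2 (BS false c.*2) ((0, 0, c)%N, (o1, o2)) ((0, 0, c.+1)%N, (o0, o3))).
by rewrite /= odd_double /= doubleK.
Qed.

(** Reduction modulo one variable, used as a test of divisibility by it. *)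
Definition kill (i : 'I_3) (p : Rd) : Rd := p \mPo [tuple (if j == i then 0 else 'X_j) | j < 3].

Lemma killM i p q : kill i (p * q) = kill i p * kill i q.
Proof. exact: rmorphM. Qed.

Lemma kill_X i j : kill i 'X_j = if j == i then 0 else 'X_j.
Proof. by rewrite /kill comp_mpolyXU -tnth_nth tnth_mktuple. Qed.

Lemma mul_congr (S : comPzRingType) (x p q t u : S) :
  (p + x * t) * (q + x * u) = p * q + x * (p * u + t * q + t * (x * u)).
Proof. by rewrite mulrDl !mulrDr !addrA (mulrCA p) !mulrA. Qed.

Lemma kill_mod i p : exists t, kill i p = p + 'X_i * t.
Proof.
have PM p' q' : (exists t, kill i p' = p' + 'X_i * t) -> (exists t, kill i q' = q' + 'X_i * t) ->
    exists t, kill i (p' * q') = p' * q' + 'X_i * t.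
  move=> [t et] [u eu]; exists (p' * u + t * q' + t * ('X_i * u)); rewrite killM et eu.
  exact: mul_congr.
have PX j : exists t, kill i 'X_j = 'X_j + 'X_i * t.
  rewrite kill_X; case: (j =P i) => [->|_]; last by exists 0; rewrite mulr0 addr0.
  by exists 1; rewrite mulr1 Rd_char2.
have PXn j n : exists t, kill i ('X_j ^+ n) = 'X_j ^+ n + 'X_i * t.
  elim: n => [|n IHn]; last by rewrite exprS; apply: PM.
  by exists 0; rewrite expr0 mulr0 addr0 /kill comp_mpoly1.
move: p; apply: Rd_ind => [|p q [t et] [u eu]|a b c].
- by exists 0; rewrite /kill comp_mpoly0 mulr0 addr0.
- exists (t + u); have -> : kill i (p + q) = kill i p + kill i q by apply: comp_mpolyD.
  by rewrite et eu mulrDr addrACA.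
by apply: (PM _ _ (PM _ _ _ _)); apply: PXn.
Qed.

Lemma var_neq0 i : 'X_i != 0 :> Rd.
Proof.
apply/eqP => /(congr1 (mpoly.mcoeff U_(i)%MM)) /eqP.
by rewrite mpoly.mcoeff0 mcoeffXU eqxx oner_eq0.
Qed.

(** The variable is prime: modulo it the ring is still a domain, and [q] survives there, so [b] must
    vanish. *)
Lemma var_factor i (a b q : Rd) : a * 'X_i = q * b -> kill i q != 0 ->
  exists t, b = 'X_i * t /\ a = q * t.
Proof.
move=> e q0; have kb : kill i b = 0.
  apply: (mulfI q0); rewrite mulr0 -killM -e killM kill_X eqxx mulr0 //.
have [t et] := kill_mod i b; exists t.
have bt : b = 'X_i * t by rewrite -[LHS]addr0 -(Rd_char2 ('X_i * t)) addrA -et kb add0r.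
split=> //; apply: (mulIf (var_neq0 i)).
by rewrite e bt mulrAC mulrA.
Qed.

Lemma inord_neq j i : (j < 3)%N -> (i < 3)%N -> j <> i -> (inord j == inord i :> 'I_3) = false.
Proof. by move=> lj li ji; rewrite -val_eqE /= !inordK //; apply/eqP. Qed.

Lemma cycle_decomposition (R : comPzRingType) (x y z : R) (N : 'M[R]_4) t t' u w :
  N o0 o0 = N o1 o1 -> N o2 o2 = N o3 o3 -> N o2 o1 = z * N o3 o0 -> N o0 o3 = z * N o1 o2 ->
  N o1 o0 = x * t /\ N o0 o1 = y * z * t -> N o3 o2 = y * t' /\ N o2 o3 = x * z * t' ->
  N o2 o0 = x * u /\ N o3 o1 = y * u -> N o1 o3 = x * w /\ N o0 o2 = y * w ->
  N = N o1 o1 *: (delta_mx o0 o0 + delta_mx o1 o1) + N o3 o3 *: (delta_mx o2 o2 + delta_mx o3 o3)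
    + N o3 o0 *: (delta_mx o3 o0 + z *: delta_mx o2 o1)
    + N o1 o2 *: (delta_mx o1 o2 + z *: delta_mx o0 o3)
    + ((t * (y * z)) *: delta_mx o0 o1 + (x * t) *: delta_mx o1 o0)
    + ((t' * (x * z)) *: delta_mx o2 o3 + (y * t') *: delta_mx o3 o2)
    + ((u * x) *: delta_mx o2 o0 + (y * u) *: delta_mx o3 o1)
    + ((w * y) *: delta_mx o0 o2 + (x * w) *: delta_mx o1 o3).
Proof.
move=> e0 e2 e21 e03 [e10 e01] [e32 e23] [e20 e31] [e13 e02].
apply/matrixP => i j; rewrite !mxE.
by elim/ord4_ind: i; elim/ord4_ind: j;
  rewrite ?(e0, e2, e21, e03, e10, e01, e32, e23, e20, e31, e13, e02) /=
    ?mulr0n ?mulr1n !(mulr0, mulr1, addr0, add0r) // mulrC.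
Qed.

Lemma hit_cycle N : bnd N = 0 -> hit N.
Proof.
move=> N0; have eN i j : N i (sg j) * dl j = dl (sg i) * N (sg i) j.
  have := congr1 (fun M : mat => M i j) N0; rewrite bndE mxE => /(congr1 (+%R^~ (dl (sg i) * N (sg i) j))).
  by rewrite -addrA Rd_char2 addr0 add0r.
have x0 : px != 0 by apply: var_neq0.
have y0 : py != 0 by apply: var_neq0.
have z0 : pz != 0 by apply: var_neq0.
have kxy : kill (inord 0) py = py by rewrite kill_X inord_neq.
have kxz : kill (inord 0) pz = pz by rewrite kill_X inord_neq.
have kyx : kill (inord 1) px = px by rewrite kill_X inord_neq.
have kyz : kill (inord 1) pz = pz by rewrite kill_X inord_neq.
(* The cocycle condition splits into equations between two entries each: four of them make one entry
   a multiple of its partner, the other four only yield a common factor. *)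
have h00 := eN o0 o0; have h01 := eN o0 o1; have h22 := eN o2 o2; have h23 := eN o2 o3.
have h20 := eN o2 o0; have h21 := eN o2 o1; have h02 := eN o0 o2; have h03 := eN o0 o3.
rewrite /sg /dl /= in h00 h01 h22 h23 h20 h21 h02 h03.
have [|t t10] := var_factor h00; first by rewrite killM kxy kxz mulf_neq0.
have [|t' t32] := var_factor h22; first by rewrite killM kyx kyz mulf_neq0.
(* Cancelling z in [h21] leaves y times entry (2, 0) equal to x times entry (3, 1), so x divides the
   former and y the latter with the same quotient. *)
have [||u u20] := @var_factor (inord 0) (N o3 o1) (N o2 o0) py.
- by apply: (mulIf z0); rewrite (mulrC py) -[RHS]mulrA h21 [RHS]mulrC mulrA.
- by rewrite kxy.
have [||w w13] := @var_factor (inord 0) (N o0 o2) (N o1 o3) py.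
- by apply: (mulIf z0); rewrite -mulrA h03 mulrAC.
- by rewrite kxy.
have e0 : N o0 o0 = N o1 o1.
  by apply: (mulIf (mulf_neq0 y0 z0)); rewrite h01 mulrC.
have e2 : N o2 o2 = N o3 o3.
  by apply: (mulIf (mulf_neq0 x0 z0)); rewrite h23 mulrC.
have e21 : N o2 o1 = pz * N o3 o0.
  by apply: (mulIf x0); rewrite h20 [RHS]mulrC mulrA.
have e03 : N o0 o3 = pz * N o1 o2.
  by apply: (mulIf y0); rewrite h02 [RHS]mulrC mulrA.
rewrite (cycle_decomposition e0 e2 e21 e03 t10 t32 u20 w13).
apply: hitD; last exact: (hit_bnd_delta w o0 o3).
apply: hitD; last exact: (hit_bnd_delta u o2 o1).
apply: hitD; last exact: (hit_bnd_delta t' o2 o2).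
apply: hitD; last exact: (hit_bnd_delta t o0 o0).
apply: hitD; last exact: hit_arrow0.
apply: hitD; last exact: hit_arrow1.
apply: hitD; [exact: hit_idem0 | exact: hit_idem1].
Qed.

Lemma muB1 x : muB [:: x] = 0.
Proof. by rewrite muBE /= big1 // => b _; rewrite scaler0. Qed.

Lemma is_quasi_iso_functor : is_quasi_iso muB muA functor.
Proof.
split=> [x _ [w fx]|y cy].
  by exists 0; rewrite muB1 (functor_eq_boundary fx).
have [|x [w yE]] := @hit_cycle (mxA y); first by rewrite -mxA_muA1 cy mxA0.
exists x; split; first exact: muB1.
exists (toA w); apply: (addIr (functor [:: x])); rewrite subrK; apply: mxA_inj.
by rewrite mxAD mxA_muA1 toAK yE addrC.
Qed.

Theorem mainTheorem3 :
  is_Ainf_algebra muA /\ is_Ainf_algebra muB /\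
  exists f : seq Bv -> Aalg, Ainf_quasi_isomorphism muB muA f.
Proof.
split; first exact: is_Ainf_algebra_muA.
split; first exact: is_Ainf_algebra_muB.
by exists functor; split; [exact: is_Ainf_morphism_functor | exact: is_quasi_iso_functor].
Qed.
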